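(* Let $(m(u),\,0\le u\leq 1)$ be a Brownian meander, $(\tilde\lambda_1^y,\ y\ge 0)$ its family of local times at time $1$, and $U$ a uniform random variable on $[0,1]$ independent of $m$. Then: (1) The variable $m(1)$ is Rayleigh distributed. (2) The density of $m(U)$ at point $y\geq 0$ is $$\mathbb{E}[\tilde{\lambda}_1^y]=2\int_y^{2y}\exp(-z^2/2)\,dz.$$ Thus $m(U)$ has the same law as $\sqrt{2\mathcal{E}}\,W$, with $\mathcal{E}$ a standard exponential variable independent of $W$, which is uniformly distributed on $[1/2,1]$.
   Context: The Brownian meander is the process on $[0,1]$ with the law of $\big(\frac{|B_{\sigma+u(1-\sigma)}|}{\sqrt{1-\sigma}},\,0\le u\le1\big)$, where $B$ is a standard Brownian motion started at $0$ and $\sigma=\sup\{t\le 1: B_t=0\}$. Local times are normalized as occupation densities with respect to Lebesgue measure: $\int_0^1\phi(m(s))\,ds=\int_0^\infty\phi(y)\tilde\lambda_1^y\,dy$ for non-negative measurable $\phi$. Rayleigh distributed means having density $l\exp(-l^2/2)$ on $[0,\infty)$. ''Standard exponential'' means exponential with mean $1$. *)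

(* Defs.v *)
From HB Require Import structures.
From mathcomp Require Import all_boot all_order all_algebra.
From mathcomp Require Import all_classical all_reals all_analysis.
From mathcomp Require Import measurable_realfun.

Set Implicit Arguments.
Unset Strict Implicit.
Unset Printing Implicit Defensive.

Import Order.TTheory GRing.Theory Num.Theory.
Import numFieldNormedType.Exports.

Local Open Scope classical_set_scope.
Local Open Scope ring_scope.

Section Laws.
Context {R : realType} {d : measure_display} {T : measurableType d}.
Variable P : probability T R.

(* [X] is a random variable whose law has density [f] with respect to
   Lebesgue measure; [X] is a bare function, so its measurability is part of
   the predicate. *)
Definition has_density (X : T -> R) (f : R -> \bar R) : Prop :=
  [/\ measurable_fun [set: T] X,
      measurable_fun [set: R] f,
      forall x, (0 <= f x)%E &
      forall A : set R, measurable A ->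
        P (X @^-1` A) = (\int[lebesgue_measure]_(x in A) f x)%E].

Definition rayleigh_pdf : R -> R :=
  (fun l => l * expR (- l ^+ 2 / 2)) \_ `[0, +oo[.

Definition uniformly_distributed (a b : R) (X : {RV P >-> R}) : Prop :=
  exists ab : a < b,
    forall A : set R, measurable A -> distribution P X A = uniform_prob ab A.

Definition standard_exponential (X : {RV P >-> R}) : Prop :=
  forall A : set R, measurable A ->
    distribution P X A = exponential_prob 1 A.

Definition independent_rv (X Y : {RV P >-> R}) : Prop :=
  forall A B : set R, measurable A -> measurable B ->
    P (X @^-1` A `&` Y @^-1` B) = (P (X @^-1` A) * P (Y @^-1` B))%E.

End Laws.

Arguments uniformly_distributed {R d T} P a b X.
Arguments standard_exponential {R d T} P X.
Arguments independent_rv {R d T} P X Y.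

(* A real process is a family of random variables indexed by [R], of which only
   the indices in the relevant time set [I] matter. *)

(* The sigma-algebra on paths generated by the evaluations at the times of
   [I]. *)
Definition path_events {R : realType} (I : set R) : set (set (R -> R)) :=
  <<s [set C | exists t, exists A : set R,
         [/\ I t, measurable A & C = [set x : R -> R | A (x t)]] ] >>.

Definition independent_of_process {R : realType} {d : measure_display}
    {T : measurableType d} (P : probability T R) (I : set R)
    (U : {RV P >-> R}) (X : R -> {RV P >-> R}) : Prop :=
  forall (A : set R) (C : set (R -> R)), measurable A -> path_events I C ->
    P (U @^-1` A `&` [set w | C (X ^~ w)]) =
      (P (U @^-1` A) * P [set w | C (X ^~ w)])%E.
Arguments independent_of_process {R d T} P I U X.

Definition brownian_motion {R : realType} {d : measure_display}
    {T : measurableType d} (P : probability T R)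
    (B : R -> {RV P >-> R}) : Prop :=
  [/\ forall w, B 0 w = 0,
      forall s t : R, 0 <= s -> s < t ->
        forall A : set R, measurable A ->
          distribution P (B t \- B s)%R A = normal_prob 0 (Num.sqrt (t - s)) A,
      forall (n : nat) (t : nat -> R) (A : nat -> set R),
        0 <= t 0%N -> {homo t : i j / (i <= j)%N >-> i <= j} ->
        (forall i, measurable (A i)) ->
        P (\bigcap_(i < n) ((B (t i.+1) \- B (t i)) @^-1` A i)) =
          (\prod_(i < n) P ((B (t i.+1) \- B (t i))%R @^-1` A i))%E &
      forall w, {within `[0, +oo[, continuous (fun t => B t w)}].
Arguments brownian_motion {R d T} P B.

Definition last_zero {R : realType} (b : R -> R) : R :=
  sup [set t | 0 <= t <= 1 /\ b t = 0].

(* On the null set of paths with [last_zero b = 1] the value is 0. *)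
Definition meander_path {R : realType} (b : R -> R) (u : R) : R :=
  let s := last_zero b in `|b (s + u * (1 - s))| / Num.sqrt (1 - s).

Definition brownian_meander {R : realType} {d : measure_display}
    {T : measurableType d} (P : probability T R)
    (m : R -> {RV P >-> R}) : Prop :=
  (forall w, {within `[0, 1], continuous (fun u => m u w)}) /\
  exists (d' : measure_display) (T' : measurableType d')
         (P' : probability T' R) (B : R -> {RV P' >-> R}),
    brownian_motion P' B /\
    forall C : set (R -> R), path_events `[0, 1] C ->
      P [set w | C (m ^~ w)] = P' [set w | C (meander_path (B ^~ w))].
Arguments brownian_meander {R d T} P m.

(* The occupation density formula determines a local time only for almost every
   level; continuity in the level selects the version for which the value at
   each level is meaningful. *)
Definition local_times {R : realType} {d : measure_display}
    {T : measurableType d} (P : probability T R)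
    (m L : R -> {RV P >-> R}) : Prop :=
  {ae P, forall w,
    {within `[0, +oo[, continuous (fun y => L y w)} /\
    forall phi : R -> R, measurable_fun [set: R] phi -> (forall y, 0 <= phi y) ->
      (\int[lebesgue_measure]_(s in `[0%R, 1%R]) (phi (m s w))%:E =
       \int[lebesgue_measure]_(y in `[0%R, +oo[) (phi y * L y w)%:E)%E}.
Arguments local_times {R d T} P m L.

(* Main.v *)
(* Fix a Brownian motion B, let g_t be its last zero before t and g = g_1.
   Reflecting B at a zero exchanges {B_s B_T > 0} and {B_s B_T < 0} among the
   paths that vanish on [s, T], so the probability of {no zero on [s, T],
   |B_t| > a} is a difference of Gaussian probabilities.  This shows that
   (|B_t|, g_t) is distributed as (sqrt t |X|, t Y^2 / (X^2 + Y^2)) for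
   independent standard normal X and Y.  At t = 1, polar coordinates turn
   |B_1| / sqrt (1 - g) into a Rayleigh variable.

   Substituting t = g + u (1 - g) in the occupation time of the meander gives
     \int_0^1 phi(m(u)) du
       = \int_0^1 phi(|B_t| / sqrt (1 - g_t)) / (1 - g_t) 1{no zero on [t, 1]} dt,
   whose mean, computed from the joint law above, is \int phi(y) D(y) dy with
   D(y) = 2 \int_y^(2y) exp (- z^2 / 2) dz.  This is the law of m(U).

   The local time at y is the limit of n \int_0^1 1{y <= m(u) <= y + 1/n} du.
   The means converge to D(y), and the independence of B_t' - B_t from (B_t, g_t)
   bounds the second moments, so no mass escapes and the local time has mean D(y).

   Finally sqrt (2 E) is Rayleigh, and given sqrt (2 E) = z the variable
   sqrt (2 E) W has density 2 / z on [z / 2, z]; integrating over z gives D. *)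
Require Import Defs.
From HB Require Import structures.
From mathcomp Require Import all_boot all_order all_algebra.
From mathcomp Require Import all_classical all_reals all_analysis.
From mathcomp Require Import measurable_realfun.
From mathcomp Require Import zify ring lra.

Set Implicit Arguments.
Unset Strict Implicit.
Unset Printing Implicit Defensive.

Import Order.TTheory GRing.Theory Num.Theory.
Import numFieldNormedType.Exports.

Local Open Scope classical_set_scope.
Local Open Scope ring_scope.

(** * Change of variables *)

(** [brownian_motion] supplies laws of increments and continuous paths, but no stopping times. The
    reflection is therefore made on a finite dyadic grid, at the first grid time where |B| is at
    most delta. It sends B only to within 2 delta of - B; the grid is refined first, then delta
    tends to 0, and the error shrinks to the null events B_T = 0 and |B_t| = a. Given B_t = x, the
    absence of zeros on [t, 1] has probability P(|sqrt (1 - t) Z| < |x|); [gband] is this function.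
    In polar form the slope |Y / X| is half-Cauchy up to its constant: its mass pi / 2 cancels the 2
    / pi of the polar density in both places where it occurs. For the second moment, independence of
    increments applies only after the event of no zero up to time 1 is dropped. It is put back at
    the price of a factor [gband 1 y]: a meander above the level y at time t has |B_t| >= y sqrt (1
    - t). This factor vanishes at y = 0, where D(0) = 0 makes the lower bound trivial. Integrands
    are kept non-negative for all arguments, often by an absolute value that changes nothing on the
    range of integration. *)

Section ImageDensity.
Context {R : realType} {d d' : measure_display}.
Context {X : measurableType d} {Y : measurableType d'}.
Variables (mu : {measure set X -> \bar R}) (phi : X -> Y) (p : X -> R).
Hypotheses (mphi : measurable_fun setT phi) (mp : measurable_fun setT p).
Hypothesis p0 : forall x, 0 <= p x.

(** The image under [phi] of the measure with density [p]. With an indicator as density it is the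
    image of a law restricted to an event. *)
Lemma image_density_is_measure :
  exists m : {measure set Y -> \bar R},
    forall A, m A = (\int[mu]_(x in phi @^-1` A) (p x)%:E)%E.
Proof.
pose f (A : set Y) : \bar R := (\int[mu]_(x in phi @^-1` A) (p x)%:E)%E.
have f0 : f set0 = 0%E by rewrite /f preimage_set0 integral_set0.
have fge0 A : (0 <= f A)%E by apply: integral_ge0 => x _; rewrite lee_fin.
have mpre A : measurable A -> measurable (phi @^-1` A).
  by move=> mA; rewrite -[X in measurable X]setTI; exact: mphi.
have fsa : semi_sigma_additive f.
  move=> F mF tF mUF; rewrite /f preimage_bigcup.
  rewrite ge0_integral_bigcup//=; last 4 first.
  - by move=> k; exact: mpre.
  - by apply: measurable_funTS; exact/measurable_EFinP.
  - by move=> x _; rewrite lee_fin.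
  - apply/trivIsetP => i j _ _ ij; rewrite -preimage_setI.
    by move/trivIsetP : tF => /(_ _ _ _ _ ij) ->//; rewrite preimage_set0.
  apply: is_cvg_ereal_nneg_natsum_cond => n _ _.
  by apply: integral_ge0 => x _; rewrite lee_fin.
pose m : {measure set Y -> \bar R} :=
  HB.pack f (isMeasure.Build _ _ _ f f0 fge0 fsa).
by exists m.
Qed.

Variable nu : {measure set Y -> \bar R}.
Hypothesis nuE : forall A, measurable A ->
  nu A = (\int[mu]_(x in phi @^-1` A) (p x)%:E)%E.

Import HBNNSimple.

(** [nu] is any measure with these values on measurable sets, so taking [phi] to be the identity
    covers the normal, uniform and exponential laws. Both sides agree on simple functions and pass
    to the limit by monotone convergence. *)
Lemma ge0_integral_image_density (f : Y -> \bar R) :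
  measurable_fun setT f -> (forall y, (0 <= f y)%E) ->
  (\int[nu]_y f y = \int[mu]_x (f (phi x) * (p x)%:E))%E.
Proof.
move=> mf f0.
have mpre A : measurable A -> measurable (phi @^-1` A).
  by move=> mA; rewrite -[X in measurable X]setTI; exact: mphi.
pose f_ := nnsfun_approx measurableT mf.
have mf_ n : measurable_fun setT (fun x => (f_ n (phi x))%:E).
  apply/measurable_EFinP; apply: measurableT_comp => //.
have mpE : measurable_fun setT (fun x => (p x)%:E) by exact/measurable_EFinP.
transitivity (limn (fun n => \int[nu]_y (f_ n y)%:E)%E).
  rewrite -monotone_convergence//=.
  - by apply: eq_integral => y _; apply/esym/cvg_lim => //; exact: cvg_nnsfun_approx.
  - by move=> n; exact/measurable_EFinP.
  - by move=> n y _; rewrite lee_fin.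
  - by move=> y _ m n mn; rewrite lee_fin; exact/lefP/nd_nnsfun_approx.
transitivity (limn (fun n => \int[mu]_x ((f_ n (phi x))%:E * (p x)%:E))%E); last first.
  rewrite -monotone_convergence//=; last 3 first.
  - by move=> n; exact: emeasurable_funM.
  - by move=> n x _; rewrite mule_ge0// lee_fin.
  - move=> x _ m n mn; rewrite lee_wpmul2r// lee_fin//.
    exact/lefP/nd_nnsfun_approx.
  apply: eq_integral => x _; apply/cvg_lim => //.
  by apply: cvgeZr => //; exact: cvg_nnsfun_approx.
congr (limn _); apply/funext => n.
under eq_integral do rewrite fimfunE -fsumEFin//.
under [RHS]eq_integral.
  move=> x _; rewrite fimfunE -fsumEFin// ge0_mule_fsuml; last first.
    by move=> r; rewrite nnfun_muleindic_ge0.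
  over.
rewrite ge0_integral_fsum//; last 2 first.
- by move=> r; exact/measurable_EFinP/measurableT_comp.
- by move=> r y _; rewrite EFinM nnfun_muleindic_ge0.
rewrite [RHS]ge0_integral_fsum//; last 2 first.
- move=> r; apply: emeasurable_funM => //; apply/measurable_EFinP.
  by apply: measurable_funM => //; apply: measurableT_comp => //.
- by move=> r y _; rewrite mule_ge0// ?lee_fin// -lee_fin EFinM nnfun_muleindic_ge0.
apply: eq_fsbigr => r /set_mem [y _ <-].
under eq_integral do rewrite EFinM.
under [RHS]eq_integral do rewrite EFinM -muleA.
rewrite ge0_integralZl//=; [|exact/measurable_EFinP|by rewrite lee_fin].
rewrite ge0_integralZl//=; last 3 first.
- apply: emeasurable_funM => //; apply/measurable_EFinP.
  by apply: measurableT_comp.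
- by move=> x _; rewrite mule_ge0 ?lee_fin.
- by rewrite lee_fin.
rewrite integral_indic// setIT nuE//; congr (_ * _)%E.
rewrite integral_mkcond; apply: eq_integral => x _.
rewrite patchE indicE; case: ifPn => [xA|xA].
  by rewrite mem_set ?mul1e//; exact: set_mem xA.
by rewrite memNset ?mul0e//; move: xA; rewrite notin_setE.
Qed.

End ImageDensity.

Section Rays.
Context {R : realType}.

Lemma finite_measure_rays_unique (m1 m2 : {measure set (measurableTypeR R) -> \bar R}) :
  (m1 setT < +oo)%E -> m1 setT = m2 setT ->
  (forall a, m1 `]a, +oo[%classic = m2 `]a, +oo[%classic) ->
  forall A, measurable A -> m1 A = m2 A.
Proof.
move=> fin1 mT mray A mA.
(* The whole line joins the rays because the generating family has to cover the space by sets of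
   finite measure. *)
pose G := [set B | B = setT \/ exists a : R, B = `]a, +oo[%classic].
apply: (@measure_unique _ R (measurableTypeR R) G (fun _ => setT)) => //.
- rewrite RGenOInfty.measurableE; apply/seteqP; split.
    apply: smallest_sub; first exact: smallest_sigma_algebra.
    by move=> _ [a ->]; apply: sub_sigma_algebra; right; exists a.
  apply: smallest_sub; first exact: smallest_sigma_algebra.
  move=> B [->|[a ->]]; last by apply: sub_sigma_algebra; exists a.
  have := (@measurableT _ (g_sigma_algebraType (@RGenOInfty.G R))); exact.
- move=> _ _ [->|[a ->]] [->|[b ->]]; rewrite ?setTI ?setIT; [by left|by right;exists b|by right;exists a|].
  right; exists (Num.max a b); apply/seteqP; split => x /=; rewrite !in_itv/= !andbT ?gt_max.
    by move=> [-> ->].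
  by move=> /andP[].
- by left.
- by rewrite -subTset => x _; exists 0%N.
- by move=> B [->|[a ->]].
Qed.

End Rays.

Section Substitution.
Context {R : realType}.
Notation mu := (@lebesgue_measure R).
Variables (F F' : R -> R) (D : set R).
Hypotheses (oD : open D) (iD : is_interval D).
Hypothesis dF : forall x, D x -> is_derive x 1 F (F' x).
Hypothesis cF' : forall x, D x -> {for x, continuous F'}.
Hypothesis F'0 : forall x, D x -> 0 < F' x.

Let mD : measurable D. Proof. exact: open_measurable. Qed.

Let cF x : D x -> {for x, continuous F}.
Proof.
move=> Dx; apply: differentiable_continuous.
by apply/derivable1_diffP; have [] := dF Dx.
Qed.

Let seg x y z : D x -> D y -> x <= z <= y -> D z.
Proof. by move=> Dx Dy; exact: iD. Qed.

Let incF x y : D x -> D y -> x < y -> F x < F y.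
Proof.
move=> Dx Dy xy.
have Doo z : z \in `]x, y[ -> D z.
  by rewrite in_itv/= => /andP[/ltW xz /ltW zy]; apply: (seg Dx Dy); rewrite xz.
apply: (@gtr0_derive1_lt_cc _ F x y) => //.
- by move=> z /Doo Dz; have [] := dF Dz.
- by move=> z /Doo Dz; rewrite derive1E; have [_ ->] := dF Dz; exact: F'0.
- apply: continuous_in_subspaceT => z /set_mem/=; rewrite in_itv/= => zxy.
  exact/cF/(seg Dx Dy).
- by rewrite in_itv/= lexx ltW.
- by rewrite in_itv/= lexx ltW.
Qed.

Let leF x y : D x -> D y -> (F x <= F y) = (x <= y).
Proof.
move=> Dx Dy; apply/idP/idP => [|].
  by apply: contraTT; rewrite -!ltNge; exact: incF.
by rewrite le_eqVlt => /predU1P[->//|/incF H]; exact/ltW/H.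
Qed.

Let ltF x y : D x -> D y -> (F x < F y) = (x < y).
Proof. by move=> Dx Dy; rewrite !ltNge leF. Qed.

(** The value 0 outside [D] is harmless because the density [p] vanishes there. *)
Let phi := F \_ D.
Let p := F' \_ D.

Let mphi : measurable_fun [set: R] phi.
Proof.
apply/(measurable_restrictT _ mD); apply: open_continuous_measurable_fun => //.
by move=> x /set_mem; exact: cF.
Qed.

Let mp : measurable_fun [set: R] p.
Proof.
apply/(measurable_restrictT _ mD); apply: open_continuous_measurable_fun => //.
by move=> x /set_mem; exact: cF'.
Qed.

Let p0 x : 0 <= p x.
Proof. by rewrite /p patchE; case: ifPn => // /set_mem /F'0 /ltW. Qed.

Let ftc x y : D x -> D y -> x <= y ->
  (\int[mu]_(z in `[x, y]) (F' z)%:E)%E = (F y - F x)%:E.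
Proof.
move=> Dx Dy; rewrite le_eqVlt => /predU1P[->|xy].
  by rewrite set_itv1 integral_set1 subrr.
rewrite (@continuous_FTC2 _ F' F)//.
- apply: continuous_in_subspaceT => z /set_mem/=; rewrite in_itv/= => zxy.
  exact/cF'/(seg Dx Dy).
- split.
  + move=> z; rewrite in_itv/= => /andP[/ltW xz /ltW zy].
    have Dz : D z by apply: (seg Dx Dy); rewrite xz.
    by have [] := dF Dz.
  + by apply: cvg_at_right_filter; exact: cF.
  + by apply: cvg_at_left_filter; exact: cF.
- move=> z; rewrite in_itv/= => /andP[/ltW xz /ltW zy].
  have Dz : D z by apply: (seg Dx Dy); rewrite xz.
  by rewrite derive1E; have [_ ->] := dF Dz.
Qed.

Let img_dens b x y : D x -> D y -> x <= y ->
  (\int[mu]_(z in phi @^-1` [set` Interval (BSide b (F x)) (BRight (F y))])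
     (p z)%:E)%E = (F y - F x)%:E.
Proof.
move=> Dx Dy xy.
have mF' : measurable_fun [set` Interval (BSide b x) (BRight y)] (EFin \o F').
  apply/measurable_EFinP; apply: (@measurable_funS _ _ _ _ D) => //.
    move=> z/=; rewrite in_itv/= => /andP[xz zy]; apply: (seg Dx Dy).
    by rewrite zy andbT (lteifW xz).
  apply: open_continuous_measurable_fun => //.
  by move=> z /set_mem; exact: cF'.
have <- : (\int[mu]_(z in [set` Interval (BSide b x) (BRight y)]) (F' z)%:E)%E
    = (F y - F x)%:E.
  case: b mF' => mF'; first exact: ftc.
  by rewrite integral_itv_obnd_cbnd//; exact: ftc.
rewrite integral_mkcond [RHS]integral_mkcond; apply: eq_integral => z _.
rewrite !patchE.
have [/set_mem Dz|nDz] := boolP (z \in D).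
  have -> : (z \in phi @^-1` [set` Interval (BSide b (F x)) (BRight (F y))]) =
            (z \in [set` Interval (BSide b x) (BRight y)]).
    have E : (F z \in Interval (BSide b (F x)) (BRight (F y))) =
             (z \in Interval (BSide b x) (BRight y)).
      by rewrite !in_itv/= leF//; case: (b); rewrite /= ?leF ?ltF.
    have phiz : phi z = F z by rewrite /phi patchE (mem_set Dz).
    by apply/idP/idP => /set_mem H; apply/mem_set; move: H; rewrite /= phiz E.
  by rewrite /p patchE (mem_set Dz).
rewrite /p patchE (negbTE nDz).
suff -> : (z \in [set` Interval (BSide b x) (BRight y)]) = false by case: ifP.
apply/negbTE; apply: contra nDz => /set_mem/=; rewrite in_itv/= => /andP[xz zy].
by apply/mem_set/(seg Dx Dy); rewrite zy (lteifW xz).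
Qed.

(** A ray meets [[F x, F y]] in everything, in nothing or, by the intermediate value theorem, in
    some []F z, F y]]; in each case the fundamental theorem of calculus gives both measures the same
    value. *)
Let agree (m : {measure set (measurableTypeR R) -> \bar R}) :
  (forall A : set (measurableTypeR R), m A = (\int[mu]_(x in phi @^-1` A) (p x)%:E)%E) ->
  forall x y, D x -> D y -> x <= y -> forall A : set (measurableTypeR R),
    measurable A ->
  m (A `&` `[F x, F y]) =
  mu (A `&` `[F x, F y]).
Proof.
move=> mE x y Dx Dy xy A mA.
have Fxy : F x <= F y by rewrite leF.
have mI : measurable (`[F x, F y] : set (measurableTypeR R)) by exact: measurable_itv.
suff H : mrestr m mI A = mrestr mu mI A by exact: H.
have itvE (b : bool) (t s : R) : t <= s ->
    mu [set` Interval (BSide b t) (BRight s)] = (s - t)%:E.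
  rewrite lebesgue_measure_itv/= lte_fin le_eqVlt => /predU1P[->|->].
    by rewrite ltxx subrr.
  by rewrite EFinB.
apply: (finite_measure_rays_unique (R := R)) => //.
- by rewrite /= /mrestr setTI mE img_dens// ltry.
- by rewrite /= /mrestr setTI mE img_dens// itvE.
- move=> c; rewrite /= /mrestr.
  have [cFx|Fxc] := ltP c (F x).
    rewrite (_ : _ `&` _ = `[F x, F y]%classic) ?mE ?img_dens ?itvE//.
    apply/seteqP; split => [z []//|z/= ]; rewrite !in_itv/= => zFxy.
    by rewrite andbT (lt_le_trans cFx)//; case/andP: zFxy.
  have [Fyc|cFy] := leP (F y) c.
    rewrite (_ : _ `&` _ = set0) ?measure0//; apply/seteqP; split => // z/= [].
    rewrite !in_itv/= andbT => cz /andP[_ zy].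
    by have := lt_le_trans cz (le_trans zy Fyc); rewrite ltxx.
  have [z] : exists2 z, z \in `[x, y] & F z = c.
    apply: IVT => //.
      apply: continuous_in_subspaceT => z /set_mem/=; rewrite in_itv/= => zxy.
      exact/cF/(seg Dx Dy).
    by rewrite min_l ?max_r// Fxc ltW.
  rewrite in_itv/= => /andP[xz zy] zc.
  have Dz : D z by apply: (seg Dx Dy); rewrite xz.
  rewrite (_ : _ `&` _ = `]F z, F y]%classic).
    by rewrite mE img_dens// itvE// leF.
  rewrite zc; apply/seteqP; split => t/=; rewrite !in_itv/= ?andbT.
    by move=> [-> /andP[_ ->]].
  by move=> /andP[ct ->]; rewrite ct (le_trans Fxc (ltW ct)).
Qed.

(** [agree] compares the measures on images of compact intervals only. Those with rational endpoints
    in [D] are countably many and exhaust the image because [D] is open, so the comparisons can be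
    glued. *)
Let cover : exists G : nat -> set (measurableTypeR R),
  [/\ forall n, measurable (G n), F @` D = \bigcup_n G n &
   forall n, G n = set0 \/ exists a b, [/\ D a, D b, a <= b & G n = `[F a, F b]%classic] ].
Proof.
pose G n : set (measurableTypeR R) :=
  if (unpickle n : option (rat * rat)) is Some pq then
    if (ratr pq.1 \in D) && (ratr pq.2 \in D) && (pq.1 <= pq.2) then
      `[F (ratr pq.1), F (ratr pq.2)]%classic else set0
  else set0.
have mG n : measurable (G n).
  rewrite /G; case: unpickle => // -[a b]/=; case: ifPn => // _.
have GE n a b : unpickle n = Some (a, b) -> D (ratr a) -> D (ratr b) -> a <= b ->
    G n = `[F (ratr a), F (ratr b)]%classic.
  by move=> ne Da Db ab; rewrite /G ne/= !mem_set//= ab.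
have DG : F @` D = \bigcup_n G n.
  apply/seteqP; split => [_ [x Dx <-]|z [n _]].
    have [e /= e0 xeD] := oD Dx.
    have [|a] := @rat_in_itvoo R (x - e) x; first by rewrite ltrBlDr ltrDl.
    rewrite in_itv/= => /andP[xea ax].
    have [|b] := @rat_in_itvoo R x (x + e); first by rewrite ltrDl.
    rewrite in_itv/= => /andP[xb bxe].
    have Da : D (ratr a).
      by apply: xeD; rewrite /ball_/= ltr_distlC xea/= (lt_trans ax)// ltrDl.
    have Db : D (ratr b).
      by apply: xeD; rewrite /ball_/= ltr_distlC bxe andbT (lt_trans _ xb)// ltrBlDr ltrDl.
    have ab : a <= b by rewrite -(ler_rat R) ltW// (lt_trans ax xb).
    exists (pickle (a, b)); first exact: I.
    rewrite (GE _ _ _ (pickleK (a, b)) Da Db ab)/=.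
    by rewrite in_itv/= !leF// !ltW.
  rewrite /G; case: unpickle => // -[a b]/=; case: ifPn => // /andP[/andP[]].
  move=> /set_mem Da /set_mem Db ab; rewrite /= in_itv/= => Fz.
  have [t] : exists2 t, t \in `[ratr a, ratr b] & F t = z.
    apply: IVT; first by rewrite ler_rat.
      apply: continuous_in_subspaceT => t /set_mem/=; rewrite in_itv/= => zxy.
      exact/cF/(seg Da Db).
    by rewrite min_l ?max_r ?leF ?ler_rat.
  by rewrite in_itv/= => tab <-; exists t => //; exact: (seg Da Db).
exists G; split => // n; rewrite /G; case: unpickle => [[a b]/=|]; last by left.
case: ifPn => [/andP[/andP[/set_mem Da /set_mem Db] ab]|]; last by left.
by right; exists (ratr a), (ratr b); rewrite ler_rat.
Qed.

Let img_densE (A : set (measurableTypeR R)) : measurable A ->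
  mu (A `&` F @` D) = (\int[mu]_(x in phi @^-1` A) (p x)%:E)%E.
Proof.
move=> mA.
have [m mE] := @image_density_is_measure R _ _ (measurableTypeR R) (measurableTypeR R) (@lebesgue_measure R) phi p mphi mp p0.
have [G [mG DG GE]] := cover.
have mGA n : measurable (A `&` seqDU G n).
  by apply: measurableI => //; apply: measurableD => //; exact: bigsetU_measurable.
have tI : trivIset setT (fun n => A `&` seqDU G n).
  exact/trivIset_setIl/trivIset_seqDU.
transitivity (m (A `&` F @` D)).
  rewrite DG seqDU_bigcup_eq setI_bigcupr !measure_bigcup//.
  apply: eq_eseriesr => n _.
  have seqDU_sub : seqDU G n `<=` G n by exact: subDsetl.
  have -> : A `&` seqDU G n = (A `&` seqDU G n) `&` G n.
    by rewrite -setIA (setIidl seqDU_sub).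
  have [->|[a [b [Da Db ab ->]]]] := GE n; first by rewrite setI0 !measure0.
  by apply/esym/agree.
rewrite mE integral_mkcond [RHS]integral_mkcond; apply: eq_integral => x _.
rewrite !patchE.
have [/set_mem Dx|nDx] := boolP (x \in D).
  suff -> : (x \in phi @^-1` (A `&` F @` D)) = (x \in phi @^-1` A) by [].
  apply/idP/idP => /set_mem/= H; apply/mem_set => /=; first by case: H.
  by split => //; rewrite /phi patchE (mem_set Dx); exists x.
by rewrite /p patchE (negbTE nDx); case: ifPn => //; case: ifPn.
Qed.

(** The fundamental theorem of calculus is applied on compact subintervals, so [D] may have infinite
    ends or ends where [F] is singular, as for v - 1 / v on the positive half-line. *)
Lemma ge0_integral_image_increasing (f : R -> \bar R) :
  measurable_fun setT f -> (forall y, (0 <= f y)%E) ->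
  (\int[mu]_(y in F @` D) f y = \int[mu]_(x in D) (f (F x) * (F' x)%:E))%E.
Proof.
move=> mf f0.
have mFD : measurable (F @` D : set (measurableTypeR R)).
  by have [G [mG -> _]] := cover; exact: bigcupT_measurable.
transitivity (\int[mrestr mu mFD]_y f y)%E.
  rewrite (@ge0_integral_image_density R _ _ (measurableTypeR R) (measurableTypeR R) (@lebesgue_measure R) id (\1_(F @` D)))//.
  - rewrite [LHS]integral_mkcond; apply: eq_integral => x _; rewrite patchE indicE.
    by case: ifPn; rewrite ?mule1 ?mule0.
  - by move=> A mA; rewrite integral_indic// setIC.
rewrite (@ge0_integral_image_density R _ _ (measurableTypeR R) (measurableTypeR R) (@lebesgue_measure R) phi p)//.
rewrite [RHS]integral_mkcond; apply: eq_integral => x _.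
rewrite patchE /phi /p !patchE; case: ifPn => //; by rewrite mule0.
Qed.
End Substitution.

Section SubstitutionCorollaries.
Context {R : realType}.
Notation mu := (@lebesgue_measure R).

Lemma ge0_integral_reflect (E : set (measurableTypeR R)) (f : R -> \bar R) : measurable E ->
  measurable_fun setT f -> (forall y, (0 <= f y)%E) ->
  (\int[mu]_(y in -%R @^-1` E) f (- y)%R = \int[mu]_(y in E) f y)%E.
Proof.
move=> mE mf f0.
transitivity (\int[pushforward mu (-%R : measurableTypeR R -> measurableTypeR R)]_(y in E) f y)%E.
  rewrite ge0_integral_pushforward//.
  exact: measurable_funTS.
by apply: eq_measure_integral => A mA _; exact: lebesgue_measureN.
Qed.

(** The increasing case for [- F], after reflecting the integral. *)
Lemma ge0_integral_image_decreasing (F F' : R -> R) (D : set R) (f : R -> \bar R) :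
  open D -> is_interval D ->
  (forall x, D x -> is_derive x 1 F (F' x)) ->
  (forall x, D x -> {for x, continuous F'}) ->
  (forall x, D x -> F' x < 0) -> measurable (F @` D : set (measurableTypeR R)) ->
  measurable_fun setT f -> (forall y, (0 <= f y)%E) ->
  (\int[mu]_(y in F @` D) f y = \int[mu]_(x in D) (f (F x) * (- F' x)%:E))%E.
Proof.
move=> oD iD dF cF' F'0 mFD mf f0.
rewrite -(ge0_integral_reflect mFD)//.
have -> : -%R @^-1` (F @` D) = (fun x => - F x) @` D.
  apply/seteqP; split => [y /= [x Dx Fxy]|_ [x Dx <-]/=].
    by exists x => //; rewrite Fxy opprK.
  by exists x => //; rewrite opprK.
rewrite (@ge0_integral_image_increasing R (fun x => - F x) (fun x => - F' x) D oD iD _ _ _ (fun y => f (- y)))//.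
- by apply: eq_integral => x _; rewrite opprK.
- by move=> x Dx; apply: is_deriveN; exact: dF.
- by move=> x Dx; apply: continuousN; exact: cF'.
- by move=> x Dx; rewrite oppr_gt0 F'0.
- by apply: measurableT_comp => //; exact: oppr_measurable.
Qed.

Lemma ge0_integral_scale (k : R) (f : R -> \bar R) : 0 < k ->
  measurable_fun setT f -> (forall y, (0 <= f y)%E) ->
  (\int[mu]_(x in `]0%R, +oo[) f x = \int[mu]_(x in `]0%R, +oo[) (f (k * x)%R * k%:E))%E.
Proof.
move=> k0 mf f0.
have {1}-> : `]0, +oo[%classic = (fun x => k * x) @` `]0, +oo[%classic.
  apply/seteqP; split => [y|_ [x + <-]]/=; rewrite !in_itv/= !andbT.
    move=> y0; exists (k^-1 * y); last by rewrite mulVKf// gt_eqF.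
    by rewrite in_itv/= andbT mulr_gt0// invr_gt0.
  by rewrite in_itv/= andbT; exact: mulr_gt0.
apply: ge0_integral_image_increasing => //.
- exact: interval_is_interval.
- by move=> x _; apply: is_derive_eq; rewrite /GRing.scale/= mulr1.
- by move=> x _; exact: cst_continuous.
Qed.

Lemma ge0_integral_affine (k c : R) (f : R -> \bar R) : k != 0 ->
  measurable_fun setT f -> (forall y, (0 <= f y)%E) ->
  (\int[mu]_x f x = \int[mu]_x (f (k * x + c)%R * `|k|%:E))%E.
Proof.
move=> k0 mf f0.
have fT : [set: R] = (fun x => k * x + c) @` setT.
  apply/esym; rewrite -subTset => y _; exists (k^-1 * (y - c)) => //.
  by rewrite mulVKf// subrK.
have dF (x : R) : is_derive x 1 (fun x : R => k * x + c) k.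
  by apply: is_derive_eq; rewrite /GRing.scale/= mulr1 addr0.
have [kgt0|klt0|k0'] := ltgtP 0 k; last by rewrite k0' eqxx in k0.
- rewrite {1}fT ge0_integral_image_increasing => //.
  + by rewrite gtr0_norm.
  + exact: openT.
  + by move=> x _; exact: cst_continuous.
- rewrite {1}fT (@ge0_integral_image_decreasing _ (fun=> k)) => //.
  + by rewrite ltr0_norm.
  + exact: openT.
  + by move=> x _; exact: cst_continuous.
  + by rewrite -fT.
Qed.

End SubstitutionCorollaries.

(** * Gaussian integrals *)

Section Gaussian.
Context {R : realType}.
Notation mu := (@lebesgue_measure R).

Lemma integral_normal_prob (m s : R) (f : R -> \bar R) :
  measurable_fun setT f -> (forall x, (0 <= f x)%E) ->
  (\int[normal_prob m s]_x f x = \int[mu]_x (f x * (normal_pdf m s x)%:E))%E.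
Proof.
move=> mf f0.
apply: (@ge0_integral_image_density R _ _ (measurableTypeR R) (measurableTypeR R) (@lebesgue_measure R) id) => //.
- exact: measurable_normal_pdf.
- by move=> x; exact: normal_pdf_ge0.
Qed.

(** The standard normal density as a plain formula; [normal_pdf] treats a vanishing deviation
    separately. *)
Definition gauss_pdf (x : R) : R := (Num.sqrt (2 * pi))^-1 * expR (- x ^+ 2 / 2).

Lemma normal_pdf01 : normal_pdf 0 1 = gauss_pdf.
Proof.
apply/funext => x; rewrite normal_pdfE ?oner_neq0// /normal_peak /normal_fun /gauss_pdf.
by rewrite expr1n mul1r subr0 mulr_natl.
Qed.

Lemma gauss_pdf_gt0 x : 0 < gauss_pdf x.
Proof. by rewrite mulr_gt0 ?expR_gt0// invr_gt0 sqrtr_gt0 mulr_gt0 ?pi_gt0. Qed.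

Lemma measurable_gauss_pdf : measurable_fun setT gauss_pdf.
Proof. by rewrite -normal_pdf01; exact: measurable_normal_pdf. Qed.

Notation N := (@normal_prob R 0 1).

Lemma integral_gauss (f : R -> \bar R) :
  measurable_fun setT f -> (forall x, (0 <= f x)%E) ->
  (\int[N]_x f x = \int[mu]_x (f x * (gauss_pdf x)%:E))%E.
Proof. by move=> mf f0; rewrite integral_normal_prob// normal_pdf01. Qed.

Lemma gauss_pdfE (s x : R) : 0 < s -> normal_pdf 0 s x = s^-1 * gauss_pdf (x / s).
Proof.
move=> s0; rewrite normal_pdfE ?gt_eqF// /normal_peak /normal_fun /gauss_pdf.
have s20 : 0 <= s ^+ 2 by rewrite sqr_ge0.
rewrite subr0 -[_ *+ 2]mulr_natl mulrCA sqrtrM// sqrtr_sqr gtr0_norm// invfM mulrA; congr (_ * expR _).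
by rewrite expr_div_n -mulr_natl invfM; ring.
Qed.

Lemma normal_prob_scale (s : R) (A : set (measurableTypeR R)) : 0 < s -> measurable A ->
  normal_prob 0 s A = N ((fun x => s * x) @^-1` A).
Proof.
move=> s0 mA.
have mA' : measurable ((fun x : R => s * x) @^-1` A).
  by rewrite -[X in measurable X]setTI; apply: mulrl_measurable.
have mi (m t : R) B : measurable B -> normal_prob m t B = (\int[mu]_x ((\1_B x)%:E * (normal_pdf m t x)%:E))%E.
  move=> mB; rewrite -integral_normal_prob//; last exact/measurable_EFinP.
  by rewrite integral_indic// setIT.
rewrite (mi _ _ _ mA) (mi _ _ _ mA').
pose g x := ((\1_A x)%:E * (normal_pdf 0 s x)%:E)%E.
have mg : measurable_fun setT g.
  apply: emeasurable_funM; apply/measurable_EFinP; first exact: measurable_indic.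
  exact: measurable_normal_pdf.
have g0 x : (0 <= g x)%E by rewrite mule_ge0// lee_fin normal_pdf_ge0.
have -> := ge0_integral_affine 0 (lt0r_neq0 s0) mg g0; rewrite {}/g in mg g0 *.
apply: eq_integral => x _; rewrite addr0 -muleA -!EFinM; congr ((_ * _)%:E).
have sn0 : s != 0 by rewrite gt_eqF.
by rewrite (gtr0_norm s0) gauss_pdfE// normal_pdf01 mulrAC mulVf// mul1r mulrAC divff// mul1r.
Qed.

(** The two half-lines contribute equally, and Lebesgue measure ignores the point 0. *)
Lemma integral_gauss_abs (f : R -> \bar R) :
  measurable_fun setT f -> (forall x, (0 <= f x)%E) ->
  (\int[N]_x f (`|x|)%R = \int[mu]_(x in `]0%R, +oo[) (f x * (2 * gauss_pdf x)%:E))%E.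
Proof.
move=> mf f0.
have mfa : measurable_fun setT (fun x : R => f `|x|) by apply: measurableT_comp.
rewrite integral_gauss//.
have [g gE] : exists g : R -> \bar R,
  g = fun x => (f (`|x|)%R * (gauss_pdf x)%:E)%E by eexists.
rewrite -[X in integral _ _ X]gE.
have mg : measurable_fun setT g.
  by rewrite gE; apply: emeasurable_funM => //; apply/measurable_EFinP; exact: measurable_gauss_pdf.
have g0 x : (0 <= g x)%E by rewrite gE mule_ge0// lee_fin ltW ?gauss_pdf_gt0.
have gN x : g (- x) = g x by rewrite gE normrN /gauss_pdf sqrrN.
have -> : [set: R] = `]-oo, 0[%classic `|` `[0, +oo[%classic.
  by apply/esym; rewrite -subTset => x _ /=; rewrite !in_itv/= andbT; case: ltP; [left|right].
have dis : [disjoint (`]-oo, 0%R[%classic : set R) & `[0%R, +oo[%classic].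
  rewrite disj_set2E; apply/eqP/seteqP; split => // x/=; rewrite !in_itv/= andbT => -[/lt_le_trans H /H].
  by rewrite ltxx.
rewrite ge0_integral_setU;
  [|exact: measurable_itv|exact: measurable_itv|exact: measurable_funTS|by move=> x _; exact: g0|exact: dis].
rewrite -(integral_itv_obnd_cbnd (r := 0)); last exact: measurable_funTS.
rewrite -(@ge0_integral_reflect R `]-oo, 0%R[%classic g (measurable_itv _) mg g0).
rewrite (_ : -%R @^-1` _ = `]0, +oo[%classic); last first.
  by apply/seteqP; split => x/=; rewrite !in_itv/= andbT oppr_lt0.
under eq_integral do rewrite gN.
rewrite -ge0_integralD; [|exact: measurable_itv|by []|exact: measurable_funTS|by []|exact: measurable_funTS].
apply: eq_integral => x /set_mem/=; rewrite in_itv/= andbT => x0.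
rewrite gE gtr0_norm//.
by rewrite -ge0_muleDr ?lee_fin ?ltW ?gauss_pdf_gt0// -EFinD mulr_natl mulr2n.
Qed.

End Gaussian.

Lemma measurable_fun_comp2 d d1 d2 d3 (X : measurableType d) (T1 : measurableType d1)
    (T2 : measurableType d2) (T3 : measurableType d3) (g : T1 -> T2 -> T3)
    (u : X -> T1) (v : X -> T2) :
  measurable_fun setT (fun z : T1 * T2 => g z.1 z.2) ->
  measurable_fun setT u -> measurable_fun setT v ->
  measurable_fun setT (fun x => g (u x) (v x)).
Proof.
move=> mg mu mv.
have muv : measurable_fun setT (fun x => (u x, v x)) by exact/measurable_fun_pair.
exact: (measurableT_comp mg muv).
Qed.

Section GaussianRotation.
Context {R : realType}.
Notation mu := (@lebesgue_measure R).
Notation N := (@normal_prob R 0 1).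

Lemma gauss_pdf_rotation (c s x y : R) : c ^+ 2 + s ^+ 2 = 1 ->
  gauss_pdf (c * x + s * y) * gauss_pdf (s * x - c * y) = gauss_pdf x * gauss_pdf y.
Proof.
move=> cs; rewrite /gauss_pdf mulrACA [RHS]mulrACA; congr (_ * _).
rewrite -!expRD; congr expR.
transitivity (- ((c ^+ 2 + s ^+ 2) * (x ^+ 2 + y ^+ 2)) / 2); first by field.
by rewrite cs; field.
Qed.

(** The map with rows (c, s) and (s, - c) is orthogonal of determinant -1. It factors into two
    one-dimensional affine substitutions separated by an exchange of integrals, and [s] is the
    divisor in them. *)
Lemma integral_gauss_rotation (c s : R) (f : R -> R -> \bar R) : 0 < s ->
  c ^+ 2 + s ^+ 2 = 1 ->
  measurable_fun setT (fun z : R * R => f z.1 z.2) -> (forall x y, (0 <= f x y)%E) ->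
  (\int[N]_x \int[N]_y f x y =
   \int[N]_x \int[N]_y f (c * x + s * y)%R (s * x - c * y)%R)%E.
Proof.
move=> s0 cs mf f0.
have sn0 : s != 0 by rewrite gt_eqF.
have meas_sec (g : R -> R -> \bar R) x : measurable_fun setT (fun z : R * R => g z.1 z.2) ->
    measurable_fun setT (g x).
  by move=> mg; apply: (measurable_fun_comp2 (u := fun=> x) mg).
have leb2 (g : R -> R -> \bar R) : measurable_fun setT (fun z : R * R => g z.1 z.2) ->
   (forall x y, (0 <= g x y)%E) ->
   (\int[N]_x \int[N]_y g x y = \int[mu]_x \int[mu]_y (g x y * (gauss_pdf x * gauss_pdf y)%:E))%E.
  move=> mg g0.
  rewrite integral_gauss; [|exact: (measurable_fun_fubini_tonelli_F (m2 := N) (fun z => g z.1 z.2))|by move=> x; apply: integral_ge0].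
  apply: eq_integral => x _; rewrite integral_gauss//; last exact: meas_sec.
  rewrite muleC -ge0_integralZl//=.
  - by apply: eq_integral => y _; rewrite muleCA EFinM.
  - apply: emeasurable_funM; [exact: meas_sec|apply/measurable_EFinP; exact: measurable_gauss_pdf].
  - by move=> y _; rewrite mule_ge0// lee_fin ltW ?gauss_pdf_gt0.
  - by rewrite lee_fin ltW ?gauss_pdf_gt0.
have mgp := @measurable_gauss_pdf R.
have mlin (a b : R) : measurable_fun setT (fun z : R * R => a * z.1 + b * z.2).
  by apply: measurable_funD; apply: measurable_funM.
have mgg (a b c' d : R) : measurable_fun setT
   (fun z : R * R => (gauss_pdf (a * z.1 + b * z.2) * gauss_pdf (c' * z.1 + d * z.2))%:E).
  by apply/measurable_EFinP; apply: measurable_funM; apply: measurableT_comp.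
have mf2 (a b c' d : R) : measurable_fun setT
   (fun z : R * R => f (a * z.1 + b * z.2) (c' * z.1 + d * z.2)).
  by apply: (measurable_fun_comp2 mf); exact: mlin.
have mfr : measurable_fun setT
    (fun z : R * R => f (c * z.1 + s * z.2) (s * z.1 - c * z.2)).
  by have := mf2 c s s (- c); under eq_fun do rewrite mulNr.
rewrite (leb2 f mf f0).
rewrite (leb2 (fun x y => f (c * x + s * y) (s * x - c * y)) mfr); last by move=> x y; exact: f0.
pose g1 (x y : R) : \bar R := (f x y * (gauss_pdf x * gauss_pdf y)%:E)%E.
have mg1 : measurable_fun setT (fun z : R * R => g1 z.1 z.2).
  apply: emeasurable_funM => //; have := mgg 1 0 0 1.
  by under eq_fun do rewrite !mul1r !mul0r addr0 add0r.
have g10 x y : (0 <= g1 x y)%E by rewrite mule_ge0// lee_fin mulr_ge0 ?ltW ?gauss_pdf_gt0.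
have mlin1 (a b : R) : measurable_fun setT (fun z : R * R => g1 z.1 (a * z.2 + b * z.1)).
  apply: (measurable_fun_comp2 mg1) => //.
  by under eq_fun do rewrite addrC; exact: mlin.
(* The second coordinate is written (y - c x) / s. After the exchange y is the outer variable, and x
   is in turn replaced by s times the new inner variable plus c y. *)
transitivity (\int[mu]_x \int[mu]_y (g1 x (s^-1 * y + (- c / s) * x)%R * (s^-1)%:E))%E.
  apply: eq_integral => x _.
  rewrite (ge0_integral_affine ((- c / s) * x) (k := s^-1) (f := g1 x)).
  - by rewrite gtr0_norm ?invr_gt0.
  - by rewrite invr_eq0.
  - exact: meas_sec.
  - by move=> y; exact: g10.
rewrite (fubini_tonelli (m1 := mu) (m2 := mu)
   (fun z : R * R => (g1 z.1 (s^-1 * z.2 + (- c / s) * z.1)%R * (s^-1)%:E)%E))/=; last 2 first.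
- by apply: emeasurable_funM => //; exact: mlin1.
- by move=> z; rewrite mule_ge0// lee_fin invr_ge0 ltW.
apply: eq_integral => x _.
rewrite (ge0_integral_affine (c * x) (k := s)
  (f := fun z => (g1 z (s^-1 * x + - c / s * z)%R * (s^-1)%:E)%E)); first last.
- by move=> y; rewrite mule_ge0// lee_fin invr_ge0 ltW.
- apply: emeasurable_funM => //.
  apply: (measurable_fun_comp2 mg1) => //.
  by apply: measurable_funD => //; apply: measurable_funM.
- by [].
apply: eq_integral => y _.
rewrite -muleA -EFinM (gtr0_norm s0) mulVf// mule1 /g1.
have -> : s^-1 * x + - c / s * (s * y + c * x) = s * x - c * y.
  have -> : s * x = (1 - c ^+ 2) / s * x by rewrite -cs addrAC subrr add0r expr2 mulfK.
  by field.
have -> : s * y + c * x = c * x + s * y by rewrite addrC.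
by rewrite gauss_pdf_rotation.
Qed.

End GaussianRotation.

(** * The reflection principle *)

Section TupleLaw.
Context {R : realType} {n : nat}.
Implicit Types A : 'I_n -> set R.

Definition box A : set (n.-tuple R) :=
  [set z | forall i, A i (tnth z i)].

Lemma measurable_box A : (forall i, measurable (A i)) -> measurable (box A).
Proof.
move=> mA; have -> : box A = \bigcap_(i in [set: 'I_n]) ((@tnth n R)^~ i @^-1` A i).
  by apply/seteqP; split => z /= H i; [move=> _|]; exact: H.
apply: fin_bigcap_measurable; first exact: finite_finset.
by move=> i _; rewrite -[X in measurable X]setTI; exact: measurable_tnth.
Qed.

Lemma box_measure_unique (m1 m2 : {measure set (n.-tuple R) -> \bar R}) :
  (m1 setT < +oo)%E ->
  (forall A, (forall i, measurable (A i)) -> m1 (box A) = m2 (box A)) ->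
  forall C, measurable C -> m1 C = m2 C.
Proof.
move=> fin1 H C mC.
pose G := [set C | exists2 A, (forall i, measurable (A i)) & C = box A].
have boxT : box (fun=> setT) = setT by apply/seteqP; split.
apply: (measure_unique G (fun _ => setT)) => //.
- apply/seteqP; split.
    apply: smallest_sub; first exact: smallest_sigma_algebra.
    move=> B; rewrite -bigcup_seq/= => -[i _ [D mD <-]].
    apply: sub_sigma_algebra; exists (fun j => if j == i then D else setT).
      by move=> j; case: ifP.
    apply/seteqP; split => z/=.
      by move=> [_ Dz] j; case: eqP => // ->.
    by move=> /(_ i); rewrite eqxx.
  apply: smallest_sub; first exact: sigma_algebra_measurable.
  by move=> _ [A mA ->]; exact: measurable_box.
- move=> _ _ [A mA ->] [B mB ->]; exists (fun i => A i `&` B i).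
    by move=> i; exact: measurableI.
  by apply/seteqP; split => z /= => [[Az Bz] i|ABz]; split => // i; have [] := ABz i.
- by move=> _; exists (fun=> setT).
- by apply/seteqP; split => // x _; exists 0%N.
- by move=> _ [A mA ->]; exact: H.
Qed.

End TupleLaw.

Section Increments.
Context {R : realType} {d : measure_display} {T : measurableType d}.
Variables (P : probability T R) (B : R -> {RV P >-> R}).
Hypothesis hB : brownian_motion P B.

Let B0 w : B 0 w = 0. Proof. by have [] := hB. Qed.

Let mB t : measurable_fun setT (B t : T -> R). Proof. exact: measurable_funPT. Qed.

Let mincr s t : measurable_fun setT (fun w => B t w - B s w).
Proof. by apply: measurable_funB; exact: mB. Qed.

(** Reflecting the integral uses the evenness of the centred normal density. The case s = t is
    included because grids may repeat a time. *)
Lemma increment_symmetric s t (A : set R) : 0 <= s -> s <= t -> measurable A ->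
  P [set w | A (- (B t w - B s w))] = P [set w | A (B t w - B s w)].
Proof.
move=> s0; rewrite le_eqVlt => /predU1P[->|st] mA.
  by congr (P _); apply/seteqP; split => w /=; rewrite subrr oppr0.
have [_ hB2 _ _] := hB.
have mNA : measurable (-%R @^-1` A : set R).
  by rewrite -[X in measurable X]setTI; exact: oppr_measurable.
have -> : P [set w | A (B t w - B s w)] = normal_prob 0 (Num.sqrt (t - s)) A.
  exact: hB2.
have -> : P [set w | A (- (B t w - B s w))] = normal_prob 0 (Num.sqrt (t - s)) (-%R @^-1` A).
  exact: (hB2 _ _ s0 st _ mNA).
rewrite /normal_prob.
rewrite -[RHS](ge0_integral_reflect mA); last 2 first.
- by apply/measurable_EFinP; exact: measurable_normal_pdf.
- by move=> x; rewrite lee_fin normal_pdf_ge0.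
apply: eq_integral => x _.
by rewrite !normal_pdfE ?gt_eqF ?sqrtr_gt0 ?subr_gt0// /normal_fun !subr0 sqrrN.
Qed.

Section Grid.
Variables (theta : nat -> R) (n : nat).
Hypotheses (theta0 : theta 0%N = 0) (theta_nd : {homo theta : i j / (i <= j)%N >-> i <= j}).

Let thetage0 i : 0 <= theta i. Proof. by rewrite -theta0; exact: theta_nd. Qed.

Definition increments (w : T) : n.-tuple R :=
  [tuple B (theta i.+1) w - B (theta i) w | i < n].

Lemma measurable_increments : measurable_fun setT increments.
Proof.
apply/measurable_fun_tnthP => i.
rewrite (_ : _ \o _ = fun w => B (theta i.+1) w - B (theta i) w) //.
by apply/funext => w /=; rewrite tnth_mktuple.
Qed.

Lemma increments_box (A : 'I_n -> set R) : (forall i, measurable (A i)) ->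
  P (increments @^-1` box A) = (\prod_(i < n) P [set w | A i (B (theta i.+1) w - B (theta i) w)%R])%E.
Proof.
move=> mA; have [_ _ hB3 _] := hB.
(* Independence of increments is stated for sets indexed by all naturals, so [A] is completed by the
   full line. *)
pose A' (i : nat) := if insub i is Some j then A j else setT.
have A'E (i : 'I_n) : A' i = A i by rewrite /A' valK.
have := hB3 n theta A'; rewrite theta0 lexx => /(_ isT theta_nd) H.
transitivity (P (\bigcap_(i < n) ((B (theta i.+1) \- B (theta i))%R @^-1` A' i))).
  congr (P _); apply/seteqP; split => w /=.
    move=> H' i/= ilt; have := H' (Ordinal ilt).
    by rewrite tnth_mktuple -A'E.
  by move=> H' i; rewrite tnth_mktuple -A'E; apply: H' => /=.
rewrite H; last by move=> i; rewrite /A'; case: insubP => [j _ _|_]; [exact: mA|exact: measurableT].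
by apply: eq_bigr => i _; rewrite A'E.
Qed.

(** The path reflected after the [k]-th grid time, seen through its increments. *)
Definition flip (k : nat) (z : n.-tuple R) : n.-tuple R :=
  [tuple if (i < k)%N then tnth z i else - tnth z i | i < n].

Lemma measurable_flip k : measurable_fun setT (flip k).
Proof.
apply/measurable_fun_tnthP => i.
rewrite (_ : _ \o _ = fun z => if (i < k)%N then tnth z i else - tnth z i); last first.
  by apply/funext => z /=; rewrite tnth_mktuple.
case: (i < k)%N; first exact: measurable_tnth.
exact: measurable_funN (measurable_tnth i).
Qed.

Lemma flip_increments k (C : set (n.-tuple R)) : measurable C ->
  P (increments @^-1` (flip k @^-1` C)) = P (increments @^-1` C).
Proof.
move=> mC.
have mf : measurable_fun setT (flip k \o increments).
  exact: measurableT_comp (measurable_flip k) measurable_increments.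
pose m1 : {measure set (n.-tuple R) -> \bar R} := pushforward P (flip k \o increments).
pose m2 : {measure set (n.-tuple R) -> \bar R} := pushforward P increments.
apply: (box_measure_unique (m1 := m1 mf) (m2 := m2 measurable_increments)) => //.
  by rewrite /m1/= /pushforward preimage_setT probability_setT ltry.
move=> A mA; rewrite /m1 /m2/= /pushforward (increments_box mA).
pose A' (i : 'I_n) := if (i < k)%N then A i else -%R @^-1` A i.
have mA' i : measurable (A' i).
  rewrite /A'; case: ifP => // _.
  by rewrite -[X in measurable X]setTI; exact: oppr_measurable.
transitivity (P (increments @^-1` box A')).
  congr (P _); apply/seteqP; split => w /= H i; have := H i; rewrite /A' /flip !tnth_mktuple;
    by case: ifP.
rewrite (increments_box mA'); apply: eq_bigr => i _; rewrite /A'; case: ifP => // _.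
by apply: increment_symmetric => //; exact: theta_nd.
Qed.

End Grid.

(** Both sides are finite measures in [C], so boxes suffice; for a box this is independence along
    the grid prolonged by [t] and [t']. *)
Lemma increments_independent (theta : nat -> R) n t t' (C : set (n.-tuple R)) (A : set R) :
  theta 0%N = 0 -> {homo theta : i j / (i <= j)%N >-> i <= j} ->
  theta n <= t -> t <= t' -> measurable C -> measurable A ->
  P (increments theta n @^-1` C `&` [set w | A (B t' w - B t w)]) =
  (P (increments theta n @^-1` C) * P [set w | A (B t' w - B t w)%R])%E.
Proof.
move=> theta0 theta_nd tn tt' mC mA.
have [_ _ hB3 _] := hB.
pose D := [set w | A (B t' w - B t w)].
have mD : measurable D by rewrite -[X in measurable X]setTI; exact: mincr.
have fD : P D \is a fin_num by exact: fin_num_measure.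
have [p pE] : exists p : {nonneg R}, p%:num%:E = P D.
  by exists (NngNum (fine_ge0 (measure_ge0 P D))); rewrite /= fineK.
have minc := @measurable_increments theta n.
pose mm : {measure set (n.-tuple R) -> \bar R} := mscale p (pushforward P (increments theta n)).
pose mr : {measure set (n.-tuple R) -> \bar R} := pushforward (mrestr P mD) (increments theta n).
rewrite muleC -/D -pE -[LHS]/(mr minc C) -[RHS]/(mm minc C).
apply: (box_measure_unique (m1 := mr minc) (m2 := mm minc)) => //.
  rewrite /mr/= /pushforward/= /mrestr preimage_setT setTI.
  by rewrite (le_lt_trans (probability_le1 P mD))// ltry.
move=> E mE; rewrite /mr /mm/= /mscale/= /pushforward/= /mrestr pE.
rewrite (increments_box theta0 theta_nd mE).
(* The increment from [theta n] to [t] is inserted as well and left free: below, [E' n] is the full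
   line. *)
pose theta' i := if (i <= n)%N then theta i else if i == n.+1 then t else t'.
have th'E i : (i <= n)%N -> theta' i = theta i by rewrite /theta' => ->.
have th'n1 : theta' n.+1 = t by rewrite /theta' ltnn eqxx.
have th'n2 : theta' n.+2 = t' by rewrite /theta' leqNgt (leqW (ltnSn n))/= gtn_eqF.
have th'nd : {homo theta' : i j / (i <= j)%N >-> i <= j}.
  move=> i j ij; rewrite /theta'.
  case: (leqP j n) => jn; first by rewrite (leq_trans ij jn); exact: theta_nd.
  case: (leqP i n) => ni.
    have H : theta i <= t by rewrite (le_trans _ tn)//; exact: theta_nd.
    by case: ifP => // _; rewrite (le_trans H).
  case: eqP => [_|i1]; case: eqP => [j1|j1] //.
  have : (n.+1 < i)%N by rewrite ltn_neqAle ni andbT eq_sym; apply/eqP.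
  by rewrite -j1 ltnNge ij.
pose E' (i : nat) : set R := if insub i is Some j then E j else if i == n.+1 then A else setT.
have E'E (i : 'I_n) : E' i = E i by rewrite /E' valK.
have E'n : E' n = setT by rewrite /E' insubF ?ltnn// -{1}[n]addn0 -addn1 eqn_add2l.
have E'n1 : E' n.+1 = A by rewrite /E' insubF ?eqxx// ltnNge leqnSn.
have := hB3 n.+2 theta' E'; rewrite th'E// theta0 lexx => /(_ isT th'nd) H.
transitivity (P (\bigcap_(i < n.+2) ((B (theta' i.+1) \- B (theta' i))%R @^-1` E' i))).
  congr (P _); apply/seteqP; split => w /=.
    move=> [H1 H2] i/=; rewrite ltnS leq_eqVlt => /predU1P[->|].
      by rewrite E'n1 th'n1 th'n2.
    rewrite ltnS leq_eqVlt => /predU1P[->|ilt]; first by rewrite E'n.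
    have := H1 (Ordinal ilt); rewrite tnth_mktuple -E'E/=.
    by rewrite !th'E// ltnW.
  move=> H'; split.
    move=> i; rewrite tnth_mktuple -E'E.
    have ilt : (i < n)%N := ltn_ord i.
    have := H' i (ltn_trans ilt (leqW (ltnSn n))).
    by rewrite /= (th'E i (ltnW ilt)) (th'E i.+1 ilt).
  have /= := H' n.+1 (ltnSn _).
  by rewrite E'n1 th'n1 th'n2.
rewrite H; last first.
  move=> i; rewrite /E'; case: insubP => [j _ _|_]; first exact: mE.
  by case: ifP => _ //; exact: measurableT.
rewrite big_ord_recr big_ord_recr/=.
rewrite E'n E'n1 preimage_setT probability_setT mule1 muleC; congr (_ * _)%E.
  by rewrite th'n1 th'n2.
apply: eq_bigr => i _; have ilt : (i < n)%N := ltn_ord i.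
by rewrite (th'E i (ltnW ilt)) (th'E i.+1 ilt) E'E.
Qed.

End Increments.

(** * Signs of products of Gaussian variables *)

Section GaussSign.
Context {R : realType}.
Notation mu := (@lebesgue_measure R).
Notation N := (@normal_prob R 0 1).

Let mN (A : set (measurableTypeR R)) : measurable A ->
  N A = (\int[mu]_x ((\1_A x)%:E * (gauss_pdf x)%:E))%E.
Proof.
move=> mA; rewrite -integral_gauss//; last exact/measurable_EFinP.
by rewrite integral_indic// setIT.
Qed.

Lemma gauss_opp (A : set (measurableTypeR R)) : measurable A -> N (-%R @^-1` A) = N A.
Proof.
move=> mA.
have mNA : measurable (-%R @^-1` A : set (measurableTypeR R)).
  by rewrite -[X in measurable X]setTI; exact: oppr_measurable.
rewrite (mN mNA) (mN mA).
pose g x := ((\1_A x)%:E * (gauss_pdf x)%:E)%E.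
have mg : measurable_fun setT g.
  by apply: emeasurable_funM; apply/measurable_EFinP; [exact: measurable_indic|exact: measurable_gauss_pdf].
have g0 x : (0 <= g x)%E by rewrite mule_ge0// lee_fin ltW// gauss_pdf_gt0.
rewrite -[RHS](@ge0_integral_reflect R setT g measurableT mg g0) preimage_setT.
by apply: eq_integral => x _; rewrite /g /gauss_pdf sqrrN.
Qed.

Lemma gauss_set1 (a : R) : N [set a] = 0%E.
Proof.
have /null_content_dominatesP := @normal_prob_dominates R 0 1.
by apply => //; exact: lebesgue_measure_set1.
Qed.

(** By the reflection principle this is the probability that a Brownian motion started at a height
    [a] > 0 does not vanish during a time [b] squared. *)
Definition gauss_band (b a : R) : \bar R := N [set y | `|b * y| < a].

Let mlin (a b : R) : measurable_fun setT (fun y : R => a + b * y).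
Proof. by apply: measurable_funD => //; apply: measurable_funM. Qed.

Lemma measurable_band (b a : R) : measurable ([set y | `|b * y| < a] : set (measurableTypeR R)).
Proof.
have -> : [set y | `|b * y| < a] = (fun y : R => `|b * y|) @^-1` `]-oo, a[%classic.
  by apply/seteqP; split => y/=; rewrite in_itv.
rewrite -[X in measurable X]setTI; by apply: (measurableT_comp (f := fun y : R => `|y|)) => //.
Qed.

(** By symmetry a + b Z < 0 has the probability of b Z > a, and what remains of b Z > - a is |b Z| <
    a up to the null event b Z = a. The case [b] = 0 corresponds to an interval of length 0. *)
Lemma gauss_sign (a b : R) : 0 < a ->
  N [set y | 0 < a + b * y] = (N [set y | (a + b * y < 0)%R] + gauss_band b a)%E.
Proof.
move=> a0.
have mpos c e : measurable ([set y | 0 < c + e * y] : set (measurableTypeR R)).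
  rewrite (_ : [set _ | _] = (fun y : R => c + e * y) @^-1` `]0, +oo[%classic).
    by rewrite -[X in measurable X]setTI; exact: mlin.
  by apply/seteqP; split => y/=; rewrite in_itv/= andbT.
have -> : [set y | a + b * y < 0] = -%R @^-1` [set y | 0 < - a + b * y].
  by apply/seteqP; split => y/=; rewrite mulrN -opprD oppr_gt0.
rewrite gauss_opp; last exact: mpos.
have m0 : measurable ([set y | a = b * y] : set (measurableTypeR R)).
  rewrite (_ : [set _ | _] = (fun y : R => - a + b * y) @^-1` [set 0]).
    by rewrite -[X in measurable X]setTI; exact: mlin.
  by apply/seteqP; split => y/=; [move=> ->; rewrite addrC subrr|move/eqP; rewrite addrC subr_eq0 => /eqP].
have -> : [set y | 0 < a + b * y] =
    ([set y | 0 < - a + b * y] `|` [set y | `|b * y| < a]) `|` [set y | a = b * y].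
  apply/seteqP; split => y /=.
    move=> H; have [ay|ay|ay] := ltgtP a (b * y); [by left; left; lra|left; right; rewrite ltr_norml; lra|by right].
  by move=> [[|]|<-]; [lra|rewrite ltr_norml; lra|lra].
have n0 : N [set y | a = b * y] = 0%E.
  have [->|b0] := eqVneq b 0.
    rewrite (_ : [set _ | _] = set0) ?measure0//.
    by apply/seteqP; split => y//=; rewrite mul0r => a0'; move: a0; rewrite a0' ltxx.
  rewrite (_ : [set _ | _] = [set a / b]) ?gauss_set1//.
  by apply/seteqP; split => y/=; [move=> ->; rewrite mulrAC mulfV// mul1r|move=> ->; rewrite mulrCA mulfV// mulr1].
rewrite measureU0//; last by apply: measurableU; [exact: mpos|exact: measurable_band].
rewrite measureU; [by []|exact: mpos|exact: measurable_band|].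
by apply/seteqP; split => y //= -[]; rewrite ltr_norml; lra.
Qed.

Let mposE c e : measurable ([set y | 0 < c + e * y] : set (measurableTypeR R)).
Proof.
rewrite (_ : [set _ | _] = (fun y : R => c + e * y) @^-1` `]0, +oo[%classic).
  by rewrite -[X in measurable X]setTI; exact: mlin.
by apply/seteqP; split => y/=; rewrite in_itv/= andbT.
Qed.

Let mnegE c e : measurable ([set y | c + e * y < 0] : set (measurableTypeR R)).
Proof.
rewrite (_ : [set _ | _] = (fun y : R => c + e * y) @^-1` `]-oo, 0[%classic).
  by rewrite -[X in measurable X]setTI; exact: mlin.
by apply/seteqP; split => y/=; rewrite in_itv/=.
Qed.

Let sign_integral (a b a' b' : R) (S : bool) :
  (\int[N]_y \int[N]_w (\1_(if S then [set u | 0 < u] else [set u | u < 0])%R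
      ((a + b * y) * (a' + b' * w))%R)%:E =
   (if S then N [set w | (0 < a' + b' * w)%R] else N [set w | (a' + b' * w < 0)%R]) * N [set y | (0 < a + b * y)%R]
   + (if S then N [set w | (a' + b' * w < 0)%R] else N [set w | (0 < a' + b' * w)%R]) * N [set y | (a + b * y < 0)%R])%E.
Proof.
set p := (if S then N [set w | (0 < a' + b' * w)%R] else N [set w | (a' + b' * w < 0)%R]).
set q := (if S then N [set w | (a' + b' * w < 0)%R] else N [set w | (0 < a' + b' * w)%R]).
transitivity (\int[N]_y (p * (\1_[set y | (0 < a + b * y)%R] y)%:E + q * (\1_[set y | (a + b * y < 0)%R] y)%:E))%E.
  apply: eq_integral => y _; rewrite !indicE.
  have E (D : set R) : measurable (D : set (measurableTypeR R)) -> forall h : R -> R, (forall w, \1_D w = h w) -> (\int[N]_w (h w)%:E = N D)%E.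
    move=> mD h hE; transitivity (\int[N]_w (\1_D w)%:E)%E.
      by apply: eq_integral => w _; rewrite hE.
    by rewrite integral_indic// setIT.
  have IE (D D' : set R) u v : (D u <-> D' v) -> \1_D u = \1_D' v :> R.
    move=> [h1 h2]; rewrite !indicE.
    by have -> : (u \in D) = (v \in D') by apply/idP/idP => /set_mem ?; apply/mem_set; auto.
  have [y0|y0|y0] := ltgtP (a + b * y) 0.
  - rewrite memNset/=; last by apply/negP; rewrite -leNgt ltW.
    rewrite mem_set//= mule0 add0e mule1 /q.
    case: S p q => p q; apply: E => // w; apply: IE => /=; rewrite ?nmulr_rgt0 ?nmulr_rlt0//.
  - rewrite mem_set//= memNset/=; last by apply/negP; rewrite -leNgt ltW.
    rewrite mule0 adde0 mule1 /p.
    case: S p q => p q; apply: E => // w; apply: IE => /=; rewrite ?pmulr_rgt0 ?pmulr_rlt0//.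
  - rewrite memNset/= ?y0 ?ltxx// memNset/= ?y0 ?ltxx// !mule0 adde0.
    apply: integral0_eq => w _; rewrite mul0r indicE memNset//.
    by case: S p q => /= p q; rewrite ltxx.
have p0 : (0 <= p)%E by rewrite /p; case: S p q.
have q0 : (0 <= q)%E by rewrite /q; case: S p q p0.
rewrite ge0_integralD//.
- rewrite !ge0_integralZl// ?integral_indic// ?setIT//.
  + exact/measurable_EFinP.
  + exact/measurable_EFinP.
- by move=> y _; rewrite mule_ge0.
- by apply: emeasurable_funM => //; apply/measurable_EFinP.
- by move=> y _; rewrite mule_ge0.
- by apply: emeasurable_funM => //; apply/measurable_EFinP.
Qed.

(** Let p, q be the probabilities of the two signs of a + b Y, and p', q' those of a' + b' W. The
    two integrals differ by (p p' + q q') - (p q' + q p') = (p - q) (p' - q'), and [gauss_sign]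
    evaluates each factor. *)
Lemma gauss_sign_prod (a b a' b' : R) : 0 < a * a' ->
  (\int[N]_y \int[N]_w (\1_[set u | 0 < u]%R ((a + b * y) * (a' + b' * w)))%:E =
   \int[N]_y \int[N]_w (\1_[set u | u < 0]%R ((a + b * y) * (a' + b' * w)))%:E +
   gauss_band b `|a| * gauss_band b' `|a'|)%E.
Proof.
wlog a0 : a b a' b' / 0 < a.
  move=> wl aa'; have [a0|a0|a0] := ltgtP a 0; [|exact: wl|by rewrite a0 mul0r ltxx in aa'].
  have := wl (- a) (- b) (- a') (- b'); rewrite oppr_gt0 mulrNN !normrN => /(_ a0 aa').
  have E x y u v : (- x + - u * y) * (- v + - b' * y) = 0 -> True by [].
  under eq_integral do under eq_integral do rewrite !mulNr -!opprD mulrNN.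
  under [in RHS]eq_integral do under eq_integral do rewrite !mulNr -!opprD mulrNN.
  rewrite /gauss_band.
  by under [X in N X]eq_set do rewrite mulNr normrN; under [X in (_ * N X)%E]eq_set do rewrite mulNr normrN.
move=> aa'; have a'0 : 0 < a' by rewrite pmulr_rgt0 in aa'.
rewrite (sign_integral a b a' b' true) (sign_integral a b a' b' false).
rewrite (gauss_sign b a0) (gauss_sign b' a'0) !gtr0_norm//.
set q := N [set y | (a + b * y < 0)%R]; set q' := N [set w | (a' + b' * w < 0)%R].
set k := gauss_band b a; set k' := gauss_band b' a'.
have fN A : measurable A -> N A \is a fin_num by move=> mA; exact: fin_num_measure.
have : q \is a fin_num by apply: fN; exact: mnegE.
have : q' \is a fin_num by apply: fN; exact: mnegE.
have : k \is a fin_num by apply: fN; exact: measurable_band.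
have : k' \is a fin_num by apply: fN; exact: measurable_band.
case: q => [q||]//; case: q' => [q'||]//; case: k => [k||]//; case: k' => [k'||]// _ _ _ _.
by rewrite -!(EFinD, EFinM); congr (_%:E); ring.
Qed.

End GaussSign.

Section MeasurableComparisons.
Context {R : realType} {d : measure_display} {T : measurableType d}.

Lemma measurable_set_le (f : T -> R) (c : R) :
  measurable_fun setT f -> measurable [set x | f x <= c].
Proof.
move=> mf; rewrite (_ : [set _ | _] = f @^-1` `]-oo, c]%classic).
  by rewrite -[X in measurable X]setTI; exact: mf.
by apply/seteqP; split => x/=; rewrite in_itv.
Qed.

Lemma measurable_set_gt (f : T -> R) (c : R) :
  measurable_fun setT f -> measurable [set x | c < f x].
Proof.
move=> mf; rewrite (_ : [set _ | _] = f @^-1` `]c, +oo[%classic).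
  by rewrite -[X in measurable X]setTI; exact: mf.
by apply/seteqP; split => x/=; rewrite in_itv/= andbT.
Qed.

End MeasurableComparisons.

Section PartialSums.
Context {R : realType} {n : nat}.
Implicit Types z : n.-tuple R.

Definition psum z (i : nat) : R := \sum_(j < n | (j < i)%N) tnth z j.

Lemma measurable_psum i : measurable_fun setT (psum ^~ i).
Proof.
rewrite /psum; under eq_fun do rewrite big_mkcond.
apply: measurable_sum => j; case: (j < i)%N => //; exact: measurable_tnth.
Qed.

Lemma psum_flip_le k z i : (i <= k)%N -> psum (flip k z) i = psum z i.
Proof.
move=> ik; apply: eq_bigr => j ji; rewrite tnth_mktuple.
by rewrite (leq_trans ji ik).
Qed.

Lemma psum_flip_ge k z i : (k <= i)%N -> psum (flip k z) i = 2 * psum z k - psum z i.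
Proof.
move=> ki; rewrite /psum (bigID (fun j : 'I_n => (j < k)%N))/=.
rewrite [in RHS](bigID (fun j : 'I_n => (j < k)%N) (fun j : 'I_n => (j < i)%N))/=.
have E (F : 'I_n -> R) : \sum_(j < n | (j < i)%N && (j < k)%N) F j = \sum_(j < n | (j < k)%N) F j.
  apply: eq_bigl => j; case: (ltnP j k) => jk; last by rewrite andbF.
  by rewrite (leq_trans jk ki).
rewrite !E.
under [X in X + _ = _]eq_bigr => j jk do rewrite tnth_mktuple jk.
under [X in _ + X]eq_bigr => j /andP[_ /negbTE jk] do rewrite tnth_mktuple jk.
rewrite sumrN mulr_natl mulr2n.
by rewrite opprD addrA addrK.
Qed.

End PartialSums.

Section GridReflection.
Context {R : realType} {d : measure_display} {T : measurableType d}.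
Variables (P : probability T R) (B : R -> {RV P >-> R}).
Hypothesis hB : brownian_motion P B.
Variables (theta : nat -> R) (n l : nat) (a delta : R).
Hypotheses (theta0 : theta 0%N = 0) (theta_nd : {homo theta : i j / (i <= j)%N >-> i <= j}).
Hypotheses (l0 : (0 < l)%N) (ln : (l <= n)%N).

Let mB t : measurable_fun setT (B t : T -> R). Proof. exact: measurable_funPT. Qed.

Let incr := increments B theta n.
Let mincr : measurable_fun setT incr. Proof. exact: measurable_increments. Qed.

Lemma psum_increments w i : (i <= n)%N -> psum (increments B theta n w) i = B (theta i) w.
Proof.
move=> ilen; have [B0 _ _ _] := hB.
rewrite /psum; under eq_bigr do rewrite tnth_mktuple.
rewrite -(big_ord_widen n (fun j => B (theta j.+1) w - B (theta j) w) ilen).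
by rewrite -(big_mkord xpredT (fun j => B (theta j.+1) w - B (theta j) w)) telescope_sumr// theta0 B0 subr0.
Qed.

Let psumE w i : (i <= n)%N -> psum (incr w) i = B (theta i) w.
Proof. exact: psum_increments. Qed.

Let D i : set T := [set w | `|B (theta i.+1) w| <= delta].
Let E (e : R) : set T :=
  [set w | 0 < e * (B (theta 1%N) w * B (theta n) w)] `&` [set w | a < `|B (theta l) w|].
Let Bad : set T :=
  [set w | `|B (theta n) w| <= 2 * delta] `|` [set w | `| `|B (theta l) w| - a| <= 2 * delta].

Let mD i : measurable (D i).
Proof. by apply: measurable_set_le; apply: measurableT_comp. Qed.

Let mE e : measurable (E e).
Proof.
apply: measurableI; apply: measurable_set_gt; last exact: measurableT_comp.
by apply: measurable_funM => //; exact: measurable_funM.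
Qed.

Let mBad : measurable Bad.
Proof.
apply: measurableU; apply: measurable_set_le; first exact: measurableT_comp.
apply: measurableT_comp => //; apply: measurable_funB => //.
exact: measurableT_comp.
Qed.

Let mF i : measurable (seqDU D i).
Proof. exact: seqDU_measurable. Qed.

(** On [seqDU D i] the index [i.+1] is the first with |B| at most delta. The reflected path is 2
    B_(i+1) - B afterwards, hence within 2 delta of - B: the last value changes sign and |B| at
    index [l] moves by at most 2 delta, unless one of the two is critical, which is [Bad]. *)
Let step e i : (i < n)%N ->
  (P (seqDU D i `&` E e) <= P (seqDU D i `&` (E (- e) `|` Bad)))%E.
Proof.
move=> iltn.
pose C : set (n.-tuple R) :=
  (([set z | `|psum z i.+1| <= delta] `\` \bigcup_(j < i) [set z | `|psum z j.+1| <= delta])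
   `&` ([set z | 0 < e * (psum z 1%N * psum z n)] `&` [set z | a < `|psum z l|])).
have mps j := @measurable_psum R n j.
have mC : measurable C.
  apply: measurableI.
    apply: measurableD; first by apply: measurable_set_le; exact: measurableT_comp.
    apply: bigcup_measurable => j _.
    by apply: measurable_set_le; exact: measurableT_comp.
  apply: measurableI; apply: measurable_set_gt; last exact: measurableT_comp.
  by apply: measurable_funM => //; exact: measurable_funM.
have n0 : (0 < n)%N by exact: leq_trans iltn.
have jn j : (j < i)%N -> (j.+1 <= n)%N by move=> ji; rewrite (leq_trans ji)// ltnW.
have -> : seqDU D i `&` E e = incr @^-1` C.
  rewrite /seqDU -bigcup_mkord.
  apply/seteqP; split => w /=.
    move=> [[Di nD] [E1 E2]]; rewrite /C/= !psumE//; split => //; split => //.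
    by move=> [j /= ji]; rewrite psumE ?jn// => Dj; apply: nD; exists j.
  rewrite /C/= !psumE// => -[[Di nD] [E1 E2]]; split => //; split => //.
  by move=> [j /= ji Dj]; apply: nD; exists j => //=; rewrite psumE ?jn.
rewrite -(flip_increments hB theta0 theta_nd i.+1 mC).
apply: le_measure.
- rewrite inE -[X in measurable X]setTI; apply: mincr => //.
  by rewrite -[X in measurable X]setTI; apply: measurable_flip.
- by rewrite inE; apply: measurableI => //; apply: measurableU.
move=> w; rewrite /C/=.
(* Index 1 is never after the reflection index [i.+1], so only the last factor of the product
   changes sign. *)
have E1 : psum (flip i.+1 (incr w)) 1%N = B (theta 1%N) w by rewrite psum_flip_le// psumE.
have En : psum (flip i.+1 (incr w)) n = 2 * B (theta i.+1) w - B (theta n) w.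
  by rewrite psum_flip_ge// !psumE.
have Ei : psum (flip i.+1 (incr w)) i.+1 = B (theta i.+1) w by rewrite psum_flip_le// psumE.
rewrite Ei En E1 => -[[Di nD] [H1 H2]]; split.
  split => //; rewrite -bigcup_mkord => -[j /= ji Dj]; apply: nD; exists j => //=.
  by rewrite psum_flip_le ?psumE ?jn// ltnS ltnW.
have [Bn|Bn] := leP `|B (theta n) w| (2 * delta); first by right; left.
have [Bl|Bl] := leP `| `|B (theta l) w| - a| (2 * delta); first by right; right.
left; split => /=.
  (* Since |B_n| > 2 delta >= |2 B_(i+1)|, the reflected last value has the sign opposite to B_n. *)
  have H : 0 < - (B (theta n) w * (2 * B (theta i.+1) w - B (theta n) w)).
    rewrite mulrBr opprB -expr2 subr_gt0.
    rewrite -[ltRHS]ger0_norm ?sqr_ge0// normrX expr2.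
    apply: (le_lt_trans (ler_norm _)); rewrite !normrM (ger0_norm (ler0n _ 2)).
    rewrite ltr_pM2l; first by rewrite (le_lt_trans _ Bn)// ler_pM2l.
    by rewrite (le_lt_trans _ Bn)// mulr_ge0// (le_trans _ Di).
  have := mulr_gt0 H1 H.
  set b1 := B (theta 1%N) w; set bi := B (theta i.+1) w; set bn := B (theta n) w.
  have -> : e * (b1 * (2 * bi - bn)) * - (bn * (2 * bi - bn)) =
     (2 * bi - bn) ^+ 2 * (- e * (b1 * bn)) by ring.
  rewrite pmulr_rgt0// lt0r sqr_ge0 andbT sqrf_eq0.
  by apply/eqP; rewrite /bi /bn => H0; rewrite H0 !mulr0 ltxx in H1.
have [li|il] := leqP l i.+1; first by rewrite psum_flip_le// psumE// in H2.
rewrite psum_flip_ge ?psumE// in H2; last exact: ltnW.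
have H3 : `|2 * B (theta i.+1) w - B (theta l) w| <= 2 * delta + `|B (theta l) w|.
  rewrite (le_trans (ler_normB _ _))// lerD2r normrM (ger0_norm (ler0n _ 2)).
  by rewrite ler_pM2l.
have d0 : 0 <= delta by rewrite (le_trans _ Di).
have {}H2 : a < 2 * delta + `|B (theta l) w| by exact: lt_le_trans H3.
move: Bl; rewrite ltr_normr => /orP[|]; lra.
Qed.

(* Reflecting the path after the first grid time at which |B| <= delta preserves the law of
   the increments and replaces B by a path within 2 delta of - B. *)
Lemma reflection_grid e :
  (P ((\bigcup_(i < n) [set w | `|B (theta i.+1) w| <= delta])%R `&`
      ([set w | (0 < e * (B (theta 1%N) w * B (theta n) w))%R] `&`
       [set w | (a < `|B (theta l) w|)%R])) <=
   P ((\bigcup_(i < n) [set w | `|B (theta i.+1) w| <= delta])%R `&`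
      ([set w | (0 < - e * (B (theta 1%N) w * B (theta n) w))%R] `&`
       [set w | (a < `|B (theta l) w|)%R])) +
   P ([set w | (`|B (theta n) w| <= 2 * delta)%R] `|`
      [set w | (`| `|B (theta l) w| - a| <= 2 * delta)%R]))%E.
Proof.
pose A := \bigcup_(i < n) D i.
suff : (P (A `&` E e) <= P (A `&` E (- e)) + P Bad)%E by [].
have decomp X : measurable X -> P (A `&` X) = (\sum_(i < n) P (seqDU D i `&` X))%E.
  move=> mX; rewrite /A bigcup_mkord bigsetU_seqDU big_distrl/=.
  rewrite (@measure_bigsetU _ _ _ P (fun i => seqDU D i `&` X))//.
    by move=> i; exact: measurableI.
  by apply: trivIset_setIr; exact: trivIset_seqDU.
have le1 : (P (A `&` E e) <= P (A `&` (E (- e) `|` Bad)))%E.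
  rewrite !decomp//; last exact: measurableU.
  by apply: lee_sum => i _; exact: step.
apply: (le_trans le1); rewrite setIUr.
have mA : measurable A by apply: fin_bigcup_measurable => // i _; exact: mD.
apply: (le_trans (measureU2 _ _ _)).
- exact: measurableI.
- exact: measurableI.
apply: leeD => //; apply: le_measure; rewrite ?inE//; first exact: measurableI.
Qed.

End GridReflection.

Definition no_zero {R : realType} (s T : R) (b : R -> R) : Prop :=
  forall r, s <= r <= T -> b r != 0.

(* The grid 0, s, ..., t, ..., T: index 0 is time 0, index 1 is s, and the intervals
   [s, t] and [t, T] are both cut into 2 ^ N steps. *)
Definition dyadic_grid {R : realType} (s t T : R) (N i : nat) : R :=
  if i is j.+1 then
    s + (t - s) * ((minn j (2 ^ N))%:R / (2 ^ N)%:R)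
      + (T - t) * ((j - 2 ^ N)%:R / (2 ^ N)%:R)
  else 0.
Arguments dyadic_grid : simpl never.

Section ReflectionPrinciple.
Context {R : realType} {d : measure_display} {Om : measurableType d}.
Variables (P : probability Om R) (B : R -> {RV P >-> R}).
Hypothesis hB : brownian_motion P B.

Let mB t : measurable_fun setT (B t : Om -> R). Proof. exact: measurable_funPT. Qed.

Lemma brownian_marginal t (A : set R) : 0 < t -> measurable A ->
  P (B t @^-1` A) = normal_prob 0 (Num.sqrt t) A.
Proof.
move=> t0 mA; have [B0 hB2 _ _] := hB.
have := hB2 0 t (lexx _) t0 A mA; rewrite subr0 => <-.
by congr (P _); apply/seteqP; split => w/=; rewrite B0 subr0.
Qed.

Lemma brownian_atomless t c : 0 < t -> P [set w | B t w = c] = 0%E.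
Proof.
move=> t0; have := @brownian_marginal t [set c] t0 (measurable_set1 c).
rewrite /preimage/= => ->.
have /null_content_dominatesP := @normal_prob_dominates R 0 (Num.sqrt t).
by apply => //; exact: lebesgue_measure_set1.
Qed.

Lemma brownian_continuous w r e : 0 <= r -> 0 < e ->
  exists2 eta, 0 < eta & forall x, 0 <= x -> `|x - r| < eta -> `|B x w - B r w| < e.
Proof.
move=> r0 e0; have [_ _ _ cB] := hB.
have /continuous_within_itvcyP[cB1 cB2] := cB w.
move: r0; rewrite le_eqVlt => /predU1P[<-|r0].
  move/cvgrPdist_lt : cB2 => /(_ _ e0) [eta /= eta0 H]; exists eta => // x x0.
  rewrite subr0 ger0_norm// => xeta.
  move: x0; rewrite le_eqVlt => /predU1P[<-|x0]; first by rewrite subrr normr0.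
  rewrite distrC; apply: H => //.
  by rewrite /ball_/= sub0r normrN gtr0_norm.
have /cB1/cvgrPdist_lt/(_ _ e0) [eta /= eta0 H] : r \in `]0, +oo[ by rewrite in_itv/= andbT.
exists eta => // x x0 xeta; rewrite distrC; apply: H => //.
by rewrite /ball_/= distrC.
Qed.

Variables (s t T a : R).
Hypotheses (s0 : 0 < s) (st : s < t) (tT : t <= T).

Let t0 : 0 < t. Proof. exact: lt_trans st. Qed.
Let T0 : 0 < T. Proof. exact: lt_le_trans tT. Qed.
Let sT : s < T. Proof. exact: lt_le_trans tT. Qed.

Local Notation grid := (dyadic_grid s t T).

Let M0 N : 0 < (2 ^ N)%:R :> R. Proof. by rewrite ltr0n expn_gt0. Qed.

Let grid1 N : grid N 1 = s.
Proof. by rewrite /dyadic_grid min0n sub0n !mul0r !mulr0 !addr0. Qed.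

Let gridt N : grid N (2 ^ N).+1 = t.
Proof. by rewrite /dyadic_grid minnn subnn mul0r divff ?gt_eqF// mulr0 addr0 mulr1 addrC subrK. Qed.

Let gridT N : grid N (2 ^ N + 2 ^ N).+1 = T.
Proof.
rewrite /dyadic_grid addnK (minn_idPr _) ?leq_addr// divff ?gt_eqF// !mulr1.
by ring.
Qed.

Let grid_nd N : {homo grid N : i j / (i <= j)%N >-> i <= j}.
Proof.
have tms : 0 <= t - s by rewrite subr_ge0 ltW.
have Tmt : 0 <= T - t by rewrite subr_ge0.
move=> [|i] [|j] // ij; rewrite /dyadic_grid.
  by rewrite -addrA addr_ge0 ?(ltW s0)// addr_ge0// mulr_ge0// divr_ge0.
rewrite ltnS in ij.
have H c x y : 0 <= c -> (x <= y)%N ->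
    c * (x%:R / (2 ^ N)%:R) <= c * (y%:R / (2 ^ N)%:R) :> R.
  move=> c0 xy; apply: ler_wpM2l => //.
  by apply: ler_wpM2r; rewrite ?invr_ge0 ?(ltW (M0 N))// ler_nat.
apply: lerD; first apply: lerD => //; apply: H => //.
  by rewrite leq_min (leq_trans (geq_minl _ _) ij) geq_minr.
exact: leq_sub2r.
Qed.

Let grid_bounds N i : (i < (2 ^ N + 2 ^ N).+1)%N -> s <= grid N i.+1 <= T.
Proof.
move=> iN; apply/andP; split.
  by rewrite -[leLHS](grid1 N); exact: grid_nd.
by rewrite -[leRHS](gridT N); exact: grid_nd.
Qed.

(** Nested grids make the events [D N del] below increase with [N]. *)
Let grid_nested N i : grid N.+1 (i.*2).+1 = grid N i.+1.
Proof.
have h x : (x.*2)%:R / (2 ^ N.+1)%:R = x%:R / (2 ^ N)%:R :> R.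
  by rewrite expnS natrM -muln2 natrM; field; rewrite gt_eqF.
have -> : grid N.+1 (i.*2).+1 = s + (t - s) * (((minn i (2 ^ N)).*2)%:R / (2 ^ N.+1)%:R)
    + (T - t) * (((i - 2 ^ N).*2)%:R / (2 ^ N.+1)%:R).
  rewrite /dyadic_grid expnS; congr (_ + _ * (_%:R / _) + _ * (_%:R / _)); lia.
by rewrite !h.
Qed.

Let grid_dense r eta : s <= r <= T -> 0 < eta ->
  exists N i, (i < (2 ^ N + 2 ^ N).+1)%N /\ `|grid N i.+1 - r| < eta.
Proof.
move=> /andP[sr rT] eta0.
(* Since N <= 2 ^ N, every cell of this grid is shorter than eta. *)
pose N := (Num.truncn ((T - s) / eta)).+1.
have HN : (T - s) / (2 ^ N)%:R < eta.
  rewrite ltr_pdivrMr// mulrC -ltr_pdivrMr//.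
  apply: (lt_le_trans (truncnS_gt _)); rewrite ler_nat.
  by rewrite (leq_trans _ (ltnW (ltn_expl N (ltnSn 1)))).
have cell (x y z : R) : x < y -> x <= z <= y -> y - x <= T - s ->
    exists2 j, (j <= 2 ^ N)%N & `|x + (y - x) * (j%:R / (2 ^ N)%:R) - z| < eta.
  move=> xy /andP[xz zy] yx.
  have xy0 : 0 < y - x by rewrite subr_gt0.
  pose q := (z - x) / (y - x) * (2 ^ N)%:R.
  have q0 : 0 <= q.
    by apply: mulr_ge0; [apply: divr_ge0; [rewrite subr_ge0|exact: ltW]|exact: ltW].
  have /andP[q1 q2] := truncn_itv q0.
  exists (Num.truncn q).
    rewrite -(ler_nat R) (le_trans q1)// /q ler_piMl//.
    by rewrite ler_pdivrMr// mul1r lerD2r.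
  apply: (@le_lt_trans _ _ ((T - s) / (2 ^ N)%:R)) => //.
  have -> : x + (y - x) * ((Num.truncn q)%:R / (2 ^ N)%:R) - z =
      (y - x) / (2 ^ N)%:R * ((Num.truncn q)%:R - q).
    by rewrite /q; field; rewrite !gt_eqF.
  rewrite normrM ger0_norm; last by apply: divr_ge0; exact: ltW.
  apply: (@le_trans _ _ ((y - x) / (2 ^ N)%:R * 1)).
    apply: ler_wpM2l; first by apply: divr_ge0; exact: ltW.
    by rewrite distrC ger0_norm ?subr_ge0// lerBlDr addrC natr1 ltW.
  by rewrite mulr1; apply: ler_wpM2r => //; rewrite invr_ge0 ltW.
have [rt|tr] := leP r t.
  have [||j jN Hj] := cell s t r st; first by rewrite sr.
    by rewrite lerD2r.
  exists N, j; split; first by rewrite ltnS (leq_trans jN)// leq_addr.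
  by rewrite /dyadic_grid (minn_idPl jN) (eqP (_ : j - 2 ^ N == 0)%N) ?subn_eq0// mul0r mulr0 addr0.
have [||j jN Hj] := cell t T r (lt_le_trans tr rT); first by rewrite (ltW tr).
  by rewrite lerD2l lerN2 ltW.
exists N, (2 ^ N + j)%N; split; first by rewrite ltnS leq_add2l.
rewrite /dyadic_grid (minn_idPr _) ?leq_addr// addKn divff ?gt_eqF// mulr1.
by rewrite (_ : s + (t - s) = t) //; ring.
Qed.

Let D N (del : R) : set Om :=
  \bigcup_(i < (2 ^ N + 2 ^ N).+1) [set w | `|B (grid N i.+1) w| <= del].

Let mD N del : measurable (D N del).
Proof.
apply: bigcup_measurable => i _.
by apply: measurable_set_le; apply: measurableT_comp.
Qed.

Let DN_nd del : nondecreasing_seq (D ^~ del).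
Proof.
apply/nondecreasing_seqP => N; apply/subsetPset => w [i /= iN Bi].
exists i.*2 => /=; last by rewrite grid_nested.
by rewrite expnS mul2n -doubleD ltnS leq_double -ltnS.
Qed.

Let Zer : set Om := [set w | exists2 r, s <= r <= T & B r w = 0].

(** One inclusion is continuity together with the density of the grids. For the other, |B| attains
    its minimum on the compact interval, and this minimum lies below every tolerance. *)
Let ZerE : Zer = \bigcap_j \bigcup_N D N j.+1%:R^-1.
Proof.
apply/seteqP; split => w.
  move=> [r rsT Br] j _.
  have r0 : 0 <= r by case/andP: rsT => sr _; rewrite (le_trans (ltW s0)).
  have j0 : (0 : R) < j.+1%:R^-1 by rewrite invr_gt0.
  have [eta eta0 H] := brownian_continuous w r0 j0.
  have [N [i [iN Hi]]] := grid_dense rsT eta0.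
  exists N => //; exists i => //=.
  have /andP[sg _] := grid_bounds iN.
  by have := H _ (le_trans (ltW s0) sg) Hi; rewrite Br subr0 => /ltW.
move=> H.
have [_ _ _ cB] := hB.
have cB' : {within `[s, T], continuous (fun r => `|B r w|)}.
  have cBw : {within `[s, T], continuous (fun r => B r w)}.
    apply: continuous_subspaceW (cB w).
    by move=> z/=; rewrite !in_itv/= andbT => /andP[sz _]; rewrite (le_trans (ltW s0)).
  by move=> x; apply: cvg_norm; exact: (cBw x).
have [c csT Hc] := EVT_min (ltW sT) cB'.
exists c; first by move: csT; rewrite in_itv.
apply/eqP; rewrite -normr_le0; apply/ler_addgt0Pr => e e0; rewrite add0r.
have [j /ltW Hj] : exists j : nat, j.+1%:R^-1 < e.
  by exists (Num.truncn e^-1); rewrite invf_plt ?posrE//; exact: truncnS_gt.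
have [N _ [i /= iN Bi]] := H j I.
rewrite (le_trans _ Hj)// (le_trans _ Bi)//; apply: Hc.
by rewrite in_itv/= grid_bounds.
Qed.

Let E (e : R) : set Om :=
  [set w | 0 < e * (B s w * B T w)] `&` [set w | a < `|B t w|].

Let mE e : measurable (E e).
Proof.
apply: measurableI; apply: measurable_set_gt; last exact: measurableT_comp.
by apply: measurable_funM => //; exact: measurable_funM.
Qed.

Let Bad (del : R) : set Om :=
  [set w | `|B T w| <= 2 * del] `|` [set w | `| `|B t w| - a| <= 2 * del].

Let mBad del : measurable (Bad del).
Proof.
apply: measurableU; apply: measurable_set_le; first exact: measurableT_comp.
apply: measurableT_comp => //; apply: measurable_funB => //.
exact: measurableT_comp.
Qed.

Let mUD del : measurable (\bigcup_N D N del).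
Proof. by apply: bigcupT_measurable. Qed.

Let mZer : measurable Zer.
Proof. by rewrite ZerE; apply: bigcapT_measurable. Qed.

(** The grid is refined with [del] fixed, where the events increase; [step2] then lets [del]
    decrease to 0, where they decrease. The error term does not depend on [N]. *)
Let step1 e del : (P ((\bigcup_N D N del) `&` E e) <= P ((\bigcup_N D N del) `&` E (- e)) + P (Bad del))%E.
Proof.
have mDE N : measurable (D N del `&` E e) by exact: measurableI.
have ndDE : nondecreasing_seq (fun N => D N del `&` E e).
  move=> m n mn; have /subsetPset H := @DN_nd del m n mn.
  by apply/subsetPset; exact: setSI.
have := nondecreasing_cvg_mu mDE _ ndDE (mu := P).
rewrite -setI_bigcupl => /(_ (measurableI _ _ (mUD _) (mE _))) cv.
rewrite -(cvg_lim _ cv)//; apply: lime_le; first by apply/cvg_ex; eexists; exact: cv.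
apply: nearW => N.
have H : (P (D N del `&` E e) <= P (D N del `&` E (- e)) + P (Bad del))%E.
  have := @reflection_grid _ _ _ P B hB (grid N) (2 ^ N + 2 ^ N).+1 (2 ^ N).+1 a del
   (erefl _) (@grid_nd N) _ e.
  by rewrite ltnS leq_addr grid1 gridt gridT => /(_ isT).
apply: (le_trans H); rewrite leeD2r//; apply: le_measure; rewrite ?inE.
- exact: measurableI.
- exact: measurableI.
by apply: setSI => w Dw; exists N.
Qed.

Let step2 e : (P (Zer `&` E e) <= P (Zer `&` E (- e)))%E.
Proof.
pose del j : R := j.+1%:R^-1.
have del_ni i j : (i <= j)%N -> del j <= del i.
  by move=> ij; rewrite lef_pV2 ?posrE// ler_nat.
pose F j := (\bigcup_N D N (del j)) `&` E (- e).
have mF j : measurable (F j) by exact: measurableI.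
have cF : P (F j) @[j --> \oo] --> P (\bigcap_j F j).
  apply: nonincreasing_cvg_mu => //.
  - by rewrite (le_lt_trans (probability_le1 _ _))// ltry.
  - exact: bigcapT_measurable.
  - move=> i j ij; apply/subsetPset; apply: setSI => w [N _ [k kN H]].
    by exists N => //; exists k => //=; rewrite (le_trans H)// del_ni.
have cBad : P (Bad (del j)) @[j --> \oo] --> P (\bigcap_j Bad (del j)).
  apply: nonincreasing_cvg_mu => //.
  - by rewrite (le_lt_trans (probability_le1 _ _))// ltry.
  - exact: bigcapT_measurable.
  - move=> i j ij; apply/subsetPset => w [H|H]; [left|right];
      by rewrite /= (le_trans H)// ler_pM2l// del_ni.
(* In the limit only B_T = 0 or |B_t| = a is left; the laws at the positive times T and t have no
   atoms. *)
have Bad0 : P (\bigcap_j Bad (del j)) = 0%E.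
  pose Z := [set w | B T w = 0] `|` ([set w | B t w = a] `|` [set w | B t w = - a]).
  have mset1 r c : measurable [set w | B r w = c].
    by rewrite -[X in measurable X]setTI; exact: (@mB r measurableT _ (measurable_set1 c)).
  have mZ : measurable Z by do 2 apply: measurableU => //.
  have Z0 : P Z = 0%E.
    have Z1 : P ([set w | B t w = a] `|` [set w | B t w = - a]) = 0%E.
      by rewrite measureU0; [exact: brownian_atomless|exact: mset1|exact: mset1|exact: brownian_atomless].
    by rewrite /Z measureU0; [exact: brownian_atomless|exact: mset1|exact: measurableU|exact: Z1].
  apply/eqP; rewrite eq_le measure_ge0 andbT -Z0; apply: le_measure; rewrite ?inE//.
    exact: bigcapT_measurable.
  move=> w H; apply: contrapT => nZ.
  have nz : 0 < Num.min `|B T w| `| `|B t w| - a|.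
    rewrite lt_min !normr_gt0; apply/andP; split.
      by apply/eqP => H0; apply: nZ; left.
    rewrite subr_eq0; apply/eqP => H0; apply: nZ; right => /=.
    by have [Bt|Bt] := leP 0 (B t w); [left; rewrite -H0 ger0_norm|right; rewrite -H0 ltr0_norm// opprK].
  set m := Num.min _ _ in nz.
  have [j Hj] : exists j : nat, 2 * del j < m.
    exists (Num.truncn (m / 2)^-1); rewrite mulrC -ltr_pdivlMr//.
    by rewrite /del invf_plt ?posrE ?divr_gt0//; exact: truncnS_gt.
  have [/= H1|/= H1] := H j I; have := lt_le_trans Hj (_ : m <= _).
    by move=> /(_ `|B T w|); rewrite /m ge_min lexx/= => /(_ isT); rewrite ltNge H1.
  by move=> /(_ `| `|B t w| - a|); rewrite /m ge_min lexx orbT => /(_ isT); rewrite ltNge H1.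
have cS : (P (F j) + P (Bad (del j)))%E @[j --> \oo] --> (P (\bigcap_j F j) + P (\bigcap_j Bad (del j)))%E.
  by apply: cvgeD => //; apply: fin_num_adde_defl; rewrite Bad0.
rewrite Bad0 adde0 in cS.
have -> : Zer `&` E (- e) = \bigcap_j F j.
  rewrite ZerE; apply/seteqP; split => w /=.
    by move=> [HZ HE] j _; split => //; exact: HZ.
  by move=> H; split; [move=> j _; have [] := H j I|have [] := H 0%N I].
rewrite -(cvg_lim _ cS)//; apply: lime_ge; first by apply/cvg_ex; eexists; exact: cS.
apply: nearW => j; apply: (le_trans _ (step1 e (del j))).
apply: le_measure; rewrite ?inE; [exact: measurableI|exact: measurableI|].
by apply: setSI; rewrite ZerE; exact: bigcap_inf.
Qed.

Lemma measurable_no_zero : measurable [set w | no_zero s T (B ^~ w)].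
Proof.
rewrite (_ : [set _ | _] = ~` Zer); first exact: measurableC.
apply/seteqP; split => w /=.
  by move=> H [r rsT Br]; have := H r rsT; rewrite Br eqxx.
by move=> H r rsT; apply/eqP => Br; apply: H; exists r.
Qed.

(* The reflection exchanges the two signs of B s * B T among the paths with a zero in [s, T]. *)
Lemma reflection_no_zero :
  (P [set w | (0 < B s w * B T w /\ a < `|B t w|)%R] =
   P [set w | (B s w * B T w < 0 /\ a < `|B t w|)%R] +
   P [set w | no_zero s T (B ^~ w) /\ (a < `|B t w|)%R])%E.
Proof.
have -> : [set w | (0 < B s w * B T w /\ a < `|B t w|)%R] = E 1.
  by apply/seteqP; split => w /=; rewrite /E/= mul1r.
have -> : [set w | (B s w * B T w < 0 /\ a < `|B t w|)%R] = E (- 1).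
  by apply/seteqP; split => w /=; rewrite /E/= mulN1r oppr_gt0.
have PZ : P (Zer `&` E 1) = P (Zer `&` E (- 1)).
  by apply/eqP; rewrite eq_le step2/= -{2}(opprK 1) step2.
(* A path without zeros keeps its sign on [s, T], so it is counted in the positive event only. *)
have nz w : ~ Zer w -> 0 < B s w * B T w.
  move=> nZ.
  have Bs : B s w != 0 by apply/eqP => H; apply: nZ; exists s => //; rewrite lexx ltW.
  have BT : B T w != 0 by apply/eqP => H; apply: nZ; exists T => //; rewrite lexx ltW.
  rewrite ltNge; apply/negP => H.
  have [_ _ _ cB] := hB.
  have cB' : {within `[s, T], continuous (fun r => B r w)}.
    apply: continuous_subspaceW (cB w).
    by move=> z/=; rewrite !in_itv/= andbT => /andP[sz _]; rewrite (le_trans (ltW s0)).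
  have [|c] := IVT (ltW sT) cB' (v := 0).
    move: H; rewrite le_eqVlt mulf_eq0 (negbTE Bs) (negbTE BT)/=.
    rewrite ge_min le_max => H'.
    have [b|b|b] := ltgtP (B s w) 0; last by rewrite b eqxx in Bs.
      by rewrite nmulr_rlt0// in H'; rewrite (ltW H').
    by rewrite pmulr_rlt0// in H'; rewrite (ltW H').
  by rewrite in_itv/= => csT Bc; apply: nZ; exists c.
have dec X : measurable X -> P X = (P (Zer `&` X) + P (X `\` Zer))%E.
  by move=> mX; rewrite (measureDI _ mX mZer) addeC setIC.
rewrite (dec (E 1))// (dec (E (- 1)))// PZ -addeA; congr (_ + _)%E.
have -> : E (- 1) `\` Zer = set0.
  apply/seteqP; split => w //= -[[+ _] /nz].
  by rewrite /= mulN1r oppr_gt0 => /lt_trans H /H; rewrite ltxx.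
rewrite measure0 add0e; congr (P _); apply/seteqP; split => w /=.
  move=> [[_ Bt] nZ]; split => // r rsT; apply/eqP => Br; apply: nZ; exists r => //.
move=> [nZ Bt].
have nZ' : ~ Zer w by move=> [r rsT Br]; have := nZ r rsT; rewrite Br eqxx.
by split => //; split => //=; rewrite mul1r nz.
Qed.

(** As functions of the path event both sides are finite measures, [m1] and [m2] below. They agree
    on grid events by [increments_independent], and equality passes to [Zer] through the limits in
    [N] and in the tolerance. *)
Lemma no_zero_increment_independent (c t' : R) (A : set R) : T <= t' -> measurable A ->
  P ([set w | no_zero s T (B ^~ w) /\ c < B T w] `&` [set w | A (B t' w - B T w)]) =
  (P [set w | no_zero s T (B ^~ w) /\ (c < B T w)%R] * P [set w | A (B t' w - B T w)%R])%E.
Proof.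
move=> Tt' mA.
set F := [set w | A (B t' w - B T w)].
have mF : measurable F.
  have mincr : measurable_fun setT (fun w => B t' w - B T w) by exact: measurable_funB.
  by rewrite -[X in measurable X]setTI; exact: mincr.
pose V := [set w | c < B T w].
have mV : measurable V by apply: measurable_set_gt.
have fF : P F \is a fin_num by exact: fin_num_measure.
have [p pE] : exists p : {nonneg R}, p%:num%:E = P F.
  by exists (NngNum (fine_ge0 (measure_ge0 P F))); rewrite /= fineK.
pose m1 : {measure set Om -> \bar R} := mrestr P mF.
pose m2 : {measure set Om -> \bar R} := mscale p P.
have m1E X : m1 X = P (X `&` F) by [].
have m2E X : m2 X = (P X * P F)%E by rewrite /m2/= /mscale/= pE muleC.
have fin1 : (m1 setT < +oo)%E by rewrite m1E (le_lt_trans (probability_le1 P _))// ?ltry// setTI.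
have fin2 : (m2 setT < +oo)%E.
  by rewrite m2E probability_setT mul1e (le_lt_trans (probability_le1 P mF))// ltry.
have grid_eq N del : m1 (D N del `&` V) = m2 (D N del `&` V).
  pose n := (2 ^ N + 2 ^ N).+1.
  pose C : set (n.-tuple R) := (\bigcup_(i < n) [set z | `|psum z i.+1| <= del]) `&` [set z | c < psum z n].
  have mps j := @measurable_psum R n j.
  have mC : measurable C.
    apply: measurableI; last by apply: measurable_set_gt; exact: mps.
    by apply: bigcup_measurable => i _; apply: measurable_set_le; apply: measurableT_comp => //; exact: mps.
  have psE w i : (i <= n)%N -> psum (increments B (grid N) n w) i = B (grid N i) w.
    by move=> iN; apply: psum_increments.
  have -> : D N del `&` V = increments B (grid N) n @^-1` C.
    apply/seteqP; split => w /=.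
      move=> [[i /= iN Hi] Vw]; split; last by rewrite /= psE// gridT.
      by exists i => //=; rewrite psE.
    move=> [[i /= iN Hi] Vw]; split; last by move: Vw; rewrite psE// gridT.
    by exists i => //=; move: Hi; rewrite psE.
  rewrite m1E m2E; apply: (increments_independent hB) => //.
  by rewrite /n gridT.
have lim_eq del : m1 ((\bigcup_N D N del) `&` V) = m2 ((\bigcup_N D N del) `&` V).
  have mDV N : measurable (D N del `&` V) by exact: measurableI.
  have ndDV : nondecreasing_seq (fun N => D N del `&` V).
    move=> m n mn; have /subsetPset H := @DN_nd del m n mn.
    by apply/subsetPset; exact: setSI.
  have mU : measurable (\bigcup_N (D N del `&` V)) by exact: bigcupT_measurable.
  rewrite setI_bigcupl.
  have h1 := nondecreasing_cvg_mu mDV mU ndDV (mu := m1).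
  have h2 := nondecreasing_cvg_mu mDV mU ndDV (mu := m2).
  apply: (cvg_unique _ h1) => //.
  suff -> : m1 \o (fun N => D N del `&` V) = m2 \o (fun N => D N del `&` V) by exact: h2.
  by apply/funext => N /=; exact: grid_eq.
have Zer_eq : m1 (Zer `&` V) = m2 (Zer `&` V).
  pose G j := (\bigcup_N D N j.+1%:R^-1) `&` V.
  have mG j : measurable (G j) by exact: measurableI.
  have niG : nonincreasing_seq G.
    move=> i j ij; apply/subsetPset; apply: setSI => w [N _ [k kN H]].
    by exists N => //; exists k => //=; rewrite (le_trans H)// lef_pV2 ?posrE// ler_nat.
  have GE : Zer `&` V = \bigcap_j G j.
    rewrite ZerE; apply/seteqP; split => w /=.
      by move=> [HZ HV] j _; split => //; exact: HZ.
    by move=> H; split; [move=> j _; have [] := H j I|have [] := H 0%N I].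
  have mGI : measurable (\bigcap_j G j) by exact: bigcapT_measurable.
  have finG (m : {measure set Om -> \bar R}) : (m setT < +oo)%E -> (m (G 0%N) < +oo)%E.
    by move=> fm; apply: le_lt_trans fm; apply: le_measure; rewrite ?inE.
  have h1 := nonincreasing_cvg_mu (finG m1 fin1) mG mGI niG.
  have h2 := nonincreasing_cvg_mu (finG m2 fin2) mG mGI niG.
  rewrite GE; apply: (cvg_unique _ h1) => //.
  suff -> : m1 \o G = m2 \o G by exact: h2.
  by apply/funext => j /=; exact: lim_eq.
(* The event without zeros is [V] minus [Zer], so [V] itself is needed too; it is an event of the
   grid 0, T. *)
have V_eq : m1 V = m2 V.
  pose th (i : nat) : R := if i is 0%N then 0 else T.
  have th_nd : {homo th : i j / (i <= j)%N >-> i <= j}.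
    by move=> [|i] [|j] //= _; exact: ltW.
  have := increments_independent hB (theta := th) (n := 1) (C := [set z | c < psum z 1]) (erefl _) th_nd (lexx T) Tt'.
  have -> : increments B th 1 @^-1` [set z | c < psum z 1] = V.
    by apply/seteqP; split => w /=; rewrite (psum_increments hB).
  by rewrite m1E m2E; apply => //; apply: measurable_set_gt; exact: measurable_psum.
have VE : [set w | no_zero s T (B ^~ w) /\ c < B T w] = V `\` Zer.
  apply/seteqP; split => w /=.
    by move=> [nz Vw]; split => // -[r rsT Br]; have := nz r rsT; rewrite Br eqxx.
  by move=> [Vw nZ]; split => // r rsT; apply/eqP => Br; apply: nZ; exists r.
have fV (m : {measure set Om -> \bar R}) : (m setT < +oo)%E -> (m V < +oo)%E.
  by move=> fm; apply: le_lt_trans fm; apply: le_measure; rewrite ?inE.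
rewrite VE -m1E -m2E.
transitivity (m1 V - m1 (V `&` Zer))%E; first exact: (measureD mV mZer (fV m1 fin1)).
transitivity (m2 V - m2 (V `&` Zer))%E; last exact/esym/(measureD mV mZer (fV m2 fin2)).
by rewrite [V `&` Zer]setIC; congr (_ - _)%E; [exact: V_eq|exact: Zer_eq].
Qed.

End ReflectionPrinciple.

Lemma measure_integral_indic d (T : measurableType d) (R : realType)
    (mu : {measure set T -> \bar R}) (A : set T) :
  measurable A -> mu A = (\int[mu]_x (\1_A x)%:E)%E.
Proof. by move=> mA; rewrite integral_indic// setIT. Qed.

(** The standard normal law retyped as a measure on [R], so that it can be a factor of products;
    [integral_gaussian] transfers integrals back to [normal_prob]. *)
Definition gaussian {R : realType} : set R -> \bar R := normal_prob 0 1.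

(** * Joint law of the position and the last zero *)

Section GaussianMeasure.
Context {R : realType}.
Notation mu := (@lebesgue_measure R).
Notation N := (@normal_prob R 0 1).

Let gaussian0 : (@gaussian R) set0 = 0%E. Proof. exact: measure0. Qed.

Let gaussian_ge0 A : (0 <= (@gaussian R) A)%E. Proof. exact: measure_ge0. Qed.

Let gaussian_sigma_additive : semi_sigma_additive (@gaussian R).
Proof. exact: (@measure_semi_sigma_additive _ _ _ N). Qed.

HB.instance Definition _ := isMeasure.Build _ _ _ (@gaussian R)
  gaussian0 gaussian_ge0 gaussian_sigma_additive.

Let gaussian_setT : (@gaussian R) [set: R] = 1%E.
Proof. exact: (probability_setT N). Qed.

HB.instance Definition _ := @Measure_isProbability.Build _ _ R (@gaussian R) gaussian_setT.

Lemma integral_gaussian (f : R -> \bar R) :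
  measurable_fun setT f -> (forall x, (0 <= f x)%E) ->
  (\int[gaussian]_x f x = \int[N]_x f x)%E.
Proof.
move=> mf f0; rewrite (integral_gauss mf f0).
apply: (@ge0_integral_image_density R _ _ (measurableTypeR R) R (@lebesgue_measure R) id) => //.
- exact: measurable_gauss_pdf.
- by move=> x; exact: ltW (gauss_pdf_gt0 x).
- by move=> A mA; rewrite /= /gaussian /normal_prob normal_pdf01.
Qed.

Definition gaussian1 : subprobability R R := (@gaussian R).

Definition gaussian3 : subprobability (R * (R * R))%type R :=
  product_subprobability (gaussian1, product_subprobability (gaussian1, gaussian1)).

Lemma gaussian3_box (A1 A2 A3 : set R) : measurable A1 -> measurable A2 -> measurable A3 ->
  gaussian3 (A1 `*` (A2 `*` A3)) = (N A1 * (N A2 * N A3))%E.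
Proof.
move=> mA1 mA2 mA3.
pose g2 := product_subprobability (gaussian1, gaussian1).
have E2 : g2 (A2 `*` A3) = (N A2 * N A3)%E.
  exact: (@product_measure1E _ _ _ _ R gaussian1 gaussian1 A2 A3 mA2 mA3).
rewrite -E2.
exact: (@product_measure1E _ _ _ _ R gaussian1 g2 A1 (A2 `*` A3) mA1 (measurableX mA2 mA3)).
Qed.

Lemma fubini_gaussian3 (f : R * (R * R) -> \bar R) :
  measurable_fun setT f -> (forall z, (0 <= f z)%E) ->
  (\int[gaussian3]_z f z = \int[N]_x \int[N]_y \int[N]_z f (x, (y, z)))%E.
Proof.
move=> mf f0.
have mfx x : measurable_fun setT (fun y => f (x, y)).
  exact: (measurableT_comp mf (measurable_pair1 x)).
have mfxy x y : measurable_fun setT (fun z => f (x, (y, z))).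
  exact: (measurableT_comp (mfx x) (measurable_pair1 y)).
pose g2 := product_subprobability (gaussian1, gaussian1).
transitivity (\int[gaussian]_x \int[gaussian]_y \int[gaussian]_z f (x, (y, z)))%E.
  have -> := @fubini_tonelli1 _ _ _ _ R gaussian1 g2 f mf f0.
  apply: eq_integral => x _; rewrite /fubini_F.
  by have -> := @fubini_tonelli1 _ _ _ _ R gaussian1 gaussian1 (fun y => f (x, y)) (mfx x) (fun y => f0 (x, y)).
rewrite integral_gaussian.
- apply: eq_integral => x _; rewrite integral_gaussian.
  + by apply: eq_integral => y _; rewrite integral_gaussian.
  + exact: (@measurable_fun_fubini_tonelli_F _ _ _ _ R gaussian1 (fun y => f (x, y)) (mfx x) (fun y => f0 (x, y))).
  + by move=> y; apply: integral_ge0.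
- have H := @measurable_fun_fubini_tonelli_F _ _ _ _ R g2 f mf f0.
  apply: eq_measurable_fun H => x _; rewrite /fubini_F.
  by have -> := @fubini_tonelli1 _ _ _ _ R gaussian1 gaussian1 (fun y => f (x, y)) (mfx x) (fun y => f0 (x, y)).
- by move=> x; apply: integral_ge0 => y _; apply: integral_ge0.
Qed.

Lemma measurable_integral_gauss d' (X : measurableType d') (f : X -> R -> \bar R) :
  measurable_fun setT (fun z : X * R => f z.1 z.2) -> (forall x y, (0 <= f x y)%E) ->
  measurable_fun setT (fun x => \int[N]_y f x y)%E.
Proof.
move=> mf f0.
exact: (@measurable_fun_fubini_tonelli_F _ _ X (measurableTypeR R) R N (fun z => f z.1 z.2) mf (fun z => f0 z.1 z.2)).
Qed.

Lemma measurable_gauss_band (b : R) : measurable_fun setT (gauss_band b).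
Proof.
pose A := [set z : R * R | `|b * z.2| - z.1 < 0].
have mA : measurable A.
  have -> : A = [set z : R * R | 0 < z.1 - `|b * z.2|].
    by apply/seteqP; split => z; rewrite /A/= subr_gt0 subr_lt0.
  apply: measurable_set_gt; apply: measurable_funB => //.
  apply: measurableT_comp => //; apply: measurable_funM => //.
have -> : gauss_band b = (fun q => \int[N]_y (\1_A (q, y))%:E)%E.
  apply/funext => q; rewrite /gauss_band (measure_integral_indic _ (measurable_band b q)).
  apply: eq_integral => y _; rewrite !indicE; congr ((nat_of_bool _)%:R%:E).
  by apply/idP/idP => /set_mem/= H; apply/mem_set; move: H; rewrite /A/= subr_lt0.
apply: (measurable_integral_gauss (f := fun q y => (\1_A (q, y))%:E)) => //.
apply/measurable_EFinP.
by apply: (measurableT_comp (measurable_indic mA) (g := fun z : R * R => (z.1, z.2))); apply/measurable_fun_pair.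
Qed.

End GaussianMeasure.

Section IncrementLaw.
Context {R : realType} {d : measure_display} {Om : measurableType d}.
Variables (P : probability Om R) (B : R -> {RV P >-> R}).
Hypothesis hB : brownian_motion P B.
Notation N := (@normal_prob R 0 1).

(** When s = t both sides only test whether 0 belongs to [A]; this case is needed for T = t. *)
Lemma increment_law s t (A : set R) : 0 <= s -> s <= t -> measurable A ->
  P [set w | A (B t w - B s w)] = N [set z | A (Num.sqrt (t - s) * z)].
Proof.
move=> s0; rewrite le_eqVlt => /predU1P[->|st] mA.
  rewrite subrr sqrtr0.
  have [A0|nA0] := pselect (A 0).
    rewrite (_ : [set w | _] = setT); last by apply/seteqP; split => // w _/=; rewrite subrr.
    rewrite (_ : [set z | _] = setT) ?probability_setT//.
    by apply/seteqP; split => // w _/=; rewrite mul0r.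
  rewrite (_ : [set w | _] = set0); last by apply/seteqP; split => // w/=; rewrite subrr.
  rewrite (_ : [set z | _] = set0) ?measure0//.
  by apply/seteqP; split => // w/=; rewrite mul0r.
have [_ hB2 _ _] := hB.
have -> : P [set w | A (B t w - B s w)] = normal_prob 0 (Num.sqrt (t - s)) A.
  exact: hB2.
by rewrite normal_prob_scale// sqrtr_gt0 subr_gt0.
Qed.

Variables (s t T : R).
Hypotheses (s0 : 0 < s) (st : s < t) (tT : t <= T).

(** The default value of [nth] keeps the grid at [T] from index 3 on. *)
Let theta (i : nat) : R := nth T [:: 0; s; t] i.

Let theta_nd : {homo theta : i j / (i <= j)%N >-> i <= j}.
Proof.
have ss := ltW s0; have st' := ltW st.
have t0 : 0 <= t := le_trans ss st'; have T0 : 0 <= T := le_trans t0 tT.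
have sT : s <= T := le_trans st' tT.
by move=> [|[|[|i]]] [|[|[|j]]] //= _; rewrite /theta/= ?nth_nil.
Qed.

Lemma increments3_integral (Psi : R -> R -> R -> \bar R) :
  measurable_fun setT (fun z : R * (R * R) => Psi z.1 z.2.1 z.2.2) ->
  (forall x y z, (0 <= Psi x y z)%E) ->
  (\int[P]_w Psi (B s w) (B t w - B s w)%R (B T w - B t w)%R =
   \int[N]_x \int[N]_y \int[N]_z
     Psi (Num.sqrt s * x)%R (Num.sqrt (t - s) * y)%R (Num.sqrt (T - t) * z)%R)%E.
Proof.
move=> mPsi Psi0.
have B0 w : B 0 w = 0 by have [] := hB.
pose v (z : R * (R * R)) : 3.-tuple R :=
  [tuple of [:: Num.sqrt s * z.1; Num.sqrt (t - s) * z.2.1; Num.sqrt (T - t) * z.2.2]].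
have mv : measurable_fun setT v.
  apply/measurable_fun_tnthP => -[[|[|[|//]]] i3].
  - rewrite (_ : _ \o _ = fun z : R * (R * R) => Num.sqrt s * z.1); first exact: measurable_funM.
    by apply/funext => z.
  - rewrite (_ : _ \o _ = fun z : R * (R * R) => Num.sqrt (t - s) * z.2.1); last by apply/funext => z.
    by apply: measurable_funM => //; exact: measurableT_comp.
  - rewrite (_ : _ \o _ = fun z : R * (R * R) => Num.sqrt (T - t) * z.2.2); last by apply/funext => z.
    by apply: measurable_funM => //; exact: measurableT_comp.
have minc := @measurable_increments _ _ _ P B theta 3.
pose m1 : {measure set (3.-tuple R) -> \bar R} := pushforward P (increments B theta 3).
pose m2 : {measure set (3.-tuple R) -> \bar R} := pushforward gaussian3 v.
have m12 C : measurable C -> m1 minc C = m2 mv C.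
  apply: (box_measure_unique (m1 := m1 minc) (m2 := m2 mv)) => //.
    by rewrite /m1/= /pushforward preimage_setT probability_setT ltry.
  move=> A mA; rewrite /m1 /m2/= /pushforward.
  rewrite (increments_box hB (erefl _) theta_nd mA).
  pose A' (i : 'I_3) (c : R) := [set z | A i (c * z)].
  have mA' i c : measurable (A' i c).
    have mc : measurable_fun setT (fun z : R => c * z) by exact: measurable_funM.
    by rewrite -[X in measurable X]setTI; exact: (mc measurableT _ (mA i)).
  have -> : v @^-1` box A = A' ord0 (Num.sqrt s) `*`
      (A' (lift ord0 ord0) (Num.sqrt (t - s)) `*` A' (lift ord0 (lift ord0 ord0)) (Num.sqrt (T - t))).
    apply/seteqP; split => z /=.
      move=> H; split; first by have := H ord0.
      by split; [have := H (lift ord0 ord0)|have := H (lift ord0 (lift ord0 ord0))].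
    move=> [H0 [H1 H2]] [[|[|[|//]]] i3].
    - by rewrite (_ : Ordinal i3 = ord0) //; apply/val_inj.
    - by rewrite (_ : Ordinal i3 = lift ord0 ord0) //; apply/val_inj.
    - by rewrite (_ : Ordinal i3 = lift ord0 (lift ord0 ord0)) //; apply/val_inj.
  rewrite gaussian3_box// !big_ord_recl big_ord0 mule1/=.
  have st0 : 0 <= s := ltW s0.
  congr (_ * (_ * _))%E.
  - by rewrite increment_law// subr0.
  - by rewrite increment_law// ltW.
  - by rewrite increment_law// (le_trans st0)// ltW.
pose Phi (z : 3.-tuple R) := Psi (tnth z ord0) (tnth z (lift ord0 ord0)) (tnth z (lift ord0 (lift ord0 ord0))).
have mPhi : measurable_fun setT Phi.
  apply: (measurableT_comp mPsi (g := fun z : 3.-tuple R => (tnth z ord0,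
     (tnth z (lift ord0 ord0), tnth z (lift ord0 (lift ord0 ord0)))))).
  apply/measurable_fun_pair; first exact: measurable_tnth.
  by apply/measurable_fun_pair; exact: measurable_tnth.
transitivity (\int[m1 minc]_z Phi z)%E.
  have -> := @ge0_integral_pushforward _ _ _ _ R (increments B theta 3) minc P setT Phi measurableT mPhi (fun y _ => Psi0 _ _ _).
  by apply: eq_integral => w _; rewrite /Phi/= !tnth_mktuple /theta/= B0 subr0.
transitivity (\int[m2 mv]_z Phi z)%E.
  by apply: eq_measure_integral => A mA _; exact: m12.
have -> := @ge0_integral_pushforward _ _ _ _ R v mv gaussian3 setT Phi measurableT mPhi (fun y _ => Psi0 _ _ _).
rewrite preimage_setT fubini_gaussian3//.
  exact: measurableT_comp mPhi mv.
by move=> z; exact: Psi0.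
Qed.

(** After a rotation of the first two Gaussian variables the first one, x, is B_t / sqrt t. Given x,
    the signs of B_s and B_T are those of independent Gaussians centred at sqrt s * x and sqrt t *
    x, so [gauss_sign_prod] evaluates the difference of probabilities in [reflection_no_zero]. *)
Lemma no_zero_abs_law (a : R) : 0 <= a ->
  P [set w | no_zero s T (B ^~ w) /\ a < `|B t w|] =
  (\int[N]_x ((\1_[set x | a < Num.sqrt t * `|x|]%R x)%:E *
     (gauss_band (Num.sqrt (t - s)) (Num.sqrt s * `|x|)%R *
      gauss_band (Num.sqrt (T - t)) (Num.sqrt t * `|x|)%R)))%E.
Proof.
move=> a0.
have t0 : 0 < t := lt_trans s0 st.
have rt0 : 0 < Num.sqrt t by rewrite sqrtr_gt0.
have rs0 : 0 < Num.sqrt s by rewrite sqrtr_gt0.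
have rts0 : 0 < Num.sqrt (t - s) by rewrite sqrtr_gt0 subr_gt0.
(* Cosine and sine of the angle that aligns the first axis with B_t. *)
pose c := Num.sqrt s / Num.sqrt t; pose c' := Num.sqrt (t - s) / Num.sqrt t.
have sqs : Num.sqrt s ^+ 2 = s by rewrite sqr_sqrtr// ltW.
have sqt : Num.sqrt t ^+ 2 = t by rewrite sqr_sqrtr// ltW.
have sqts : Num.sqrt (t - s) ^+ 2 = t - s by rewrite sqr_sqrtr// subr_ge0 ltW.
have c'0 : 0 < c' by rewrite divr_gt0.
have cc' : c ^+ 2 + c' ^+ 2 = 1.
  by rewrite /c /c' !expr_div_n sqs sqt sqts -mulrDl addrC subrK divff// gt_eqF.
pose S : bool -> set R := fun e => if e then [set u | 0 < u] else [set u | u < 0].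
have mS e : measurable (S e).
  rewrite /S; case: e.
    rewrite (_ : [set u | _] = `]0, +oo[%classic); first exact: measurable_itv.
    by apply/seteqP; split => u/=; rewrite in_itv/= andbT.
  rewrite (_ : [set u | _] = `]-oo, 0[%classic); first exact: measurable_itv.
  by apply/seteqP; split => u/=; rewrite in_itv/=.
pose Ca : set R := [set u | a < `|u|].
have mCa : measurable Ca by apply: measurable_set_gt; exact: normr_measurable.
pose Psi e (u v z : R) : \bar R := ((\1_(S e) (u * (u + v + z)))%:E * (\1_Ca (u + v))%:E)%E.
pose J e := (\int[N]_x ((\1_Ca (Num.sqrt t * x))%:E * \int[N]_y \int[N]_z
   (\1_(S e) ((Num.sqrt s * x + Num.sqrt (t - s) * y) * (Num.sqrt t * x + Num.sqrt (T - t) * z)))%:E))%E.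
have mEv e : measurable [set w | S e (B s w * B T w) /\ a < `|B t w|].
  rewrite (_ : [set w | _] = [set w | S e (B s w * B T w)] `&` [set w | a < `|B t w|]) //.
  apply: measurableI; last by apply: measurable_set_gt; apply: measurableT_comp.
  have mBB : measurable_fun setT (fun w => B s w * B T w : R) by apply: measurable_funM.
  by rewrite -[X in measurable X]setTI; exact: (mBB measurableT _ (mS e)).
have m1S e : measurable_fun setT (\1_(S e) : R -> R) by exact: measurable_indic.
have m1C : measurable_fun setT (\1_Ca : R -> R) by exact: measurable_indic.
have mPsi e : measurable_fun setT (fun z : R * (R * R) => Psi e z.1 z.2.1 z.2.2).
  apply: emeasurable_funM; apply/measurable_EFinP.
    apply: (measurableT_comp (m1S e)); apply: measurable_funM => //.
    by apply: measurable_funD; [apply: measurable_funD => //|]; apply: measurableT_comp.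
  apply: (measurableT_comp m1C); apply: measurable_funD => //.
  exact: measurableT_comp.
have Psi0 e u v z : (0 <= Psi e u v z)%E by rewrite mule_ge0// lee_fin.
have PE e : P [set w | S e (B s w * B T w) /\ a < `|B t w|] = J e.
  transitivity (\int[P]_w Psi e (B s w) (B t w - B s w)%R (B T w - B t w)%R)%E.
    rewrite (measure_integral_indic _ (mEv e)); apply: eq_integral => w _.
    rewrite /Psi -EFinM; congr EFin.
    have -> : B s w + (B t w - B s w) + (B T w - B t w) = B T w by ring.
    have -> : B s w + (B t w - B s w) = B t w by ring.
    rewrite !indicE -natrM mulnb; congr ((nat_of_bool _)%:R).
    apply/idP/andP => [/set_mem[h1 h2]|[/set_mem h1 /set_mem h2]].
      by split; apply/mem_set.
    exact/mem_set.
  rewrite increments3_integral//.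
  pose f x y := (\int[N]_z Psi e (Num.sqrt s * x)%R (Num.sqrt (t - s) * y)%R (Num.sqrt (T - t) * z)%R)%E.
  have mf : measurable_fun setT (fun z : R * R => f z.1 z.2).
    apply: (measurable_integral_gauss (f := fun (p : R * R) z => Psi e (Num.sqrt s * p.1) (Num.sqrt (t - s) * p.2) (Num.sqrt (T - t) * z))) => //.
    apply: (measurableT_comp (mPsi e) (g := fun q : (R * R) * R => (Num.sqrt s * q.1.1, (Num.sqrt (t - s) * q.1.2, Num.sqrt (T - t) * q.2)))).
    apply/measurable_fun_pair; first by apply: measurable_funM => //; exact: measurableT_comp.
    apply/measurable_fun_pair; apply: measurable_funM => //; exact: measurableT_comp.
  rewrite (@integral_gauss_rotation R c c' f c'0 cc' mf); last by move=> x y; apply: integral_ge0.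
  apply: eq_integral => x _.
  have E1 y z : Psi e (Num.sqrt s * (c * x + c' * y)) (Num.sqrt (t - s) * (c' * x - c * y)) (Num.sqrt (T - t) * z)
     = ((\1_Ca (Num.sqrt t * x))%:E * (\1_(S e) ((Num.sqrt s * x + Num.sqrt (t - s) * y) * (Num.sqrt t * x + Num.sqrt (T - t) * z)))%:E)%E.
    have H1 : Num.sqrt s * (c * x + c' * y) + Num.sqrt (t - s) * (c' * x - c * y) = Num.sqrt t * x.
      have -> : Num.sqrt s * (c * x + c' * y) + Num.sqrt (t - s) * (c' * x - c * y) =
          (Num.sqrt s ^+ 2 + Num.sqrt (t - s) ^+ 2) / Num.sqrt t * x.
        by rewrite /c /c'; field; rewrite gt_eqF.
      by rewrite sqs sqts addrC subrK -{1}sqt expr2 mulfK// gt_eqF.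
    (* Only the sign of B_s matters, so the positive factor c is dropped below. *)
    have H2 : Num.sqrt s * (c * x + c' * y) = c * (Num.sqrt s * x + Num.sqrt (t - s) * y).
      by rewrite /c /c'; field; rewrite gt_eqF.
    rewrite /Psi H1 H2 muleC -mulrA; congr (_ * _%:E)%E.
    have c0 : 0 < c by rewrite divr_gt0.
    rewrite !indicE; congr ((nat_of_bool _)%:R).
    have SE q : S e (c * q) = S e q.
      rewrite /S; clear -c0; apply/propext.
      by case: e => /=; split; rewrite ?(pmulr_rgt0 _ c0) ?(pmulr_rlt0 _ c0).
    by apply/idP/idP => /set_mem H; apply/mem_set; move: H; rewrite SE.
  rewrite /f; under eq_integral do under eq_integral do rewrite E1.
  have [xC|xC] := boolP (Num.sqrt t * x \in Ca).
    rewrite indicE xC mul1e; apply: eq_integral => y _; apply: eq_integral => z _.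
    by rewrite mul1e.
  rewrite indicE (negbTE xC) mul0e; apply: integral0_eq => y _.
  by apply: integral0_eq => z _; rewrite mul0e.
have mI e : measurable_fun setT (fun x : R => \int[N]_y \int[N]_z
   (\1_(S e) ((Num.sqrt s * x + Num.sqrt (t - s) * y) * (Num.sqrt t * x + Num.sqrt (T - t) * z)))%:E)%E.
  apply: (measurable_integral_gauss (f := fun x y => \int[N]_z
   (\1_(S e) ((Num.sqrt s * x + Num.sqrt (t - s) * y) * (Num.sqrt t * x + Num.sqrt (T - t) * z)))%:E)%E); last first.
    by move=> x y; apply: integral_ge0 => z _; rewrite lee_fin.
  apply: (measurable_integral_gauss (f := fun (p : R * R) z =>
   (\1_(S e) ((Num.sqrt s * p.1 + Num.sqrt (t - s) * p.2) * (Num.sqrt t * p.1 + Num.sqrt (T - t) * z)))%:E)%E) => //.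
  apply/measurable_EFinP; apply: (measurableT_comp (m1S e)).
  apply: measurable_funM; apply: measurable_funD; apply: measurable_funM => //; exact: measurableT_comp.
have mCx : measurable_fun setT (fun x : R => (\1_Ca (Num.sqrt t * x) : R)%:E).
  by apply/measurable_EFinP; apply: (measurableT_comp m1C); exact: measurable_funM.
have mband (b q : R) : measurable_fun setT (fun x : R => gauss_band b (q * `|x|)).
  apply: (measurableT_comp (measurable_gauss_band b)).
  by apply: measurable_funM => //; exact: normr_measurable.
have Jpm : J true = (J false + \int[N]_x ((\1_[set x | a < Num.sqrt t * `|x|]%R x)%:E *
     (gauss_band (Num.sqrt (t - s)) (Num.sqrt s * `|x|)%R *
      gauss_band (Num.sqrt (T - t)) (Num.sqrt t * `|x|)%R)))%E.
  have CE (x : R) : \1_[set x | a < Num.sqrt t * `|x|]%R x = \1_Ca (Num.sqrt t * x) :> R.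
    rewrite !indicE; congr ((nat_of_bool _)%:R).
    apply/idP/idP => /set_mem H; apply/mem_set; move: H;
      by rewrite /Ca/= normrM (gtr0_norm rt0).
  have zero_law (u v w : \bar R) : (0%:E * u = 0%:E * v + 0%:E * w)%E by rewrite !mul0e add0e.
  have one_law (u v w : \bar R) : (u = v + w -> 1%:E * u = 1%:E * v + 1%:E * w)%E by rewrite !mul1e.
  rewrite /J -ge0_integralD//.
  - apply: eq_integral => x _; rewrite CE.
    have [xC|xC] := boolP (Num.sqrt t * x \in Ca); last first.
      have -> : \1_Ca (Num.sqrt t * x) = 0 :> R by rewrite indicE (negbTE xC).
      exact: zero_law.
    have -> : \1_Ca (Num.sqrt t * x) = 1 :> R by rewrite indicE xC.
    apply: one_law.
    (* Because 0 <= a, the condition a < sqrt t * |x| excludes x = 0, as [gauss_sign_prod]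
       requires. *)
    have x0 : x != 0.
      apply/eqP => x0; move/set_mem: xC; rewrite /Ca/= x0 mulr0 normr0 => aa0.
      by have := le_lt_trans a0 aa0; rewrite ltxx.
    have x2 : 0 < (x : R) * x by rewrite -expr2 exprn_even_gt0.
    have xx0 : 0 < (Num.sqrt s * x) * (Num.sqrt t * x).
      rewrite mulrACA; apply: mulr_gt0; last exact: x2.
      exact: mulr_gt0.
    have := @gauss_sign_prod R (Num.sqrt s * x) (Num.sqrt (t - s)) (Num.sqrt t * x) (Num.sqrt (T - t)) xx0.
    by rewrite !normrM (gtr0_norm rs0) (gtr0_norm rt0).
  - by move=> x _; rewrite mule_ge0 ?lee_fin//; apply: integral_ge0 => y _; apply: integral_ge0 => z _; rewrite lee_fin.
  - by apply: emeasurable_funM => //; exact: mI.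
  - by move=> x _; rewrite !mule_ge0 ?lee_fin.
  - apply: emeasurable_funM; first by under eq_fun do rewrite CE.
    by apply: emeasurable_funM; exact: mband.
have := reflection_no_zero hB a s0 st tT.
have := PE true; rewrite /S/= => ->; have := PE false; rewrite /S/= => PE0.
rewrite PE0 Jpm => /esym.
have fJ : J false \is a fin_num.
  by rewrite -PE0; apply: fin_num_measure; exact: (mEv false).
by move=> /(congr1 (fun x => x - J false)%E); rewrite ![(J false + _)%E]addeC !addeK.
Qed.

End IncrementLaw.

(** * Finite measures on the plane determined by quadrants *)

Section QuadrantsUnique.
Context {R : realType}.

(** Both measures charge only points above [c], so their total masses agree as limits along the rays
    from c + 1 / (n + 1). *)
Lemma finite_measure_rays_unique_above (c : R) (m1 m2 : {measure set (measurableTypeR R) -> \bar R}) :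
  (m1 setT < +oo)%E -> m1 `]-oo, c]%classic = 0%E -> m2 `]-oo, c]%classic = 0%E ->
  (forall a, c < a -> m1 `]a, +oo[%classic = m2 `]a, +oo[%classic) ->
  forall A : set (measurableTypeR R), measurable A -> m1 A = m2 A.
Proof.
move=> fin1 m1c m2c m12.
have mray a : measurable (`]a, +oo[%classic : set (measurableTypeR R)) by exact: measurable_itv.
have mcl a b : measurable (`]a, b]%classic : set (measurableTypeR R)) by exact: measurable_itv.
have mcc : measurable (`]-oo, c]%classic : set (measurableTypeR R)) by exact: measurable_itv.
have ray_c : m1 `]c, +oo[%classic = m2 `]c, +oo[%classic.
  pose F n : set (measurableTypeR R) := `]c + n.+1%:R^-1, +oo[%classic.
  have mF n : measurable (F n) by exact: mray.
  have UF : \bigcup_n F n = `]c, +oo[%classic.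
    apply/seteqP; split => [x [n _]|x]; rewrite /F/= !in_itv/= !andbT.
      by apply: lt_trans; rewrite ltrDl invr_gt0.
    move=> cx; have xc : 0 < x - c by rewrite subr_gt0.
    have [n nx] := ltr_add_invr xc.
    by exists n => //; rewrite /F/= in_itv/= andbT -ltrBDl; move: nx; rewrite add0r.
  have ndF : nondecreasing_seq F.
    move=> m n mn; apply/subsetPset => x; rewrite /F/= !in_itv/= !andbT.
    by apply: le_lt_trans; rewrite lerD2l lef_pV2 ?posrE// ler_nat.
  have mUF : measurable (\bigcup_n F n) by rewrite UF; exact: mray.
  have h1 := nondecreasing_cvg_mu mF mUF ndF (mu := m1).
  have h2 := nondecreasing_cvg_mu mF mUF ndF (mu := m2).
  rewrite -UF; apply: (cvg_unique _ h1) => //.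
  suff -> : m1 \o F = m2 \o F by exact: h2.
  by apply/funext => n /=; apply: m12; rewrite ltrDl invr_gt0.
have lowE (m : {measure set (measurableTypeR R) -> \bar R}) (A : set (measurableTypeR R)) :
    m `]-oo, c]%classic = 0%E -> measurable A -> `]c, +oo[%classic `<=` A -> m A = m `]c, +oo[%classic.
  move=> mc0 mA cA.
  have -> : A = `]c, +oo[%classic `|` (A `&` `]-oo, c]%classic).
    apply/seteqP; split => [x Ax|x [/cA//|[]//]].
    have [xc|cx] := leP x c; first by right; split => //; rewrite /= in_itv.
    by left; rewrite /= in_itv/= andbT.
  rewrite measureU0//; first exact: measurableI.
  exact: (subset_measure0 (measurableI _ _ mA mcc) mcc (@subIsetr _ _ _) mc0).
have mT : measurable (setT : set (measurableTypeR R)) by [].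
apply: finite_measure_rays_unique => //.
  by rewrite (lowE _ _ m1c mT)// (lowE _ _ m2c mT)// ray_c.
move=> a; have [ac|] := leP a c; last exact: m12.
have s : `]c, +oo[%classic `<=` (`]a, +oo[%classic : set (measurableTypeR R)).
  by move=> x; rewrite /= !in_itv/= !andbT; exact: le_lt_trans.
by rewrite (lowE _ _ m1c (mray a) s) (lowE _ _ m2c (mray a) s) ray_c.
Qed.

(** One coordinate is treated at a time: first measures in the first coordinate with the second ray
    fixed, then measures in the second with any first set. Quadrants are compared only strictly
    inside the support because the law of the last zero is known only for positive heights and for
    times strictly before t. *)
Lemma finite_measure_quadrants_unique (c e : R) (m1 m2 : {measure set (R * R)%type -> \bar R}) :
  (m1 setT < +oo)%E ->
  m1 (`]-oo, c]%classic `*` setT) = 0%E -> m2 (`]-oo, c]%classic `*` setT) = 0%E ->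
  m1 (setT `*` `]-oo, e]%classic) = 0%E -> m2 (setT `*` `]-oo, e]%classic) = 0%E ->
  (forall a b, c < a -> e < b ->
    m1 (`]a, +oo[%classic `*` `]b, +oo[%classic) = m2 (`]a, +oo[%classic `*` `]b, +oo[%classic)) ->
  forall C : set (R * R), measurable C -> m1 C = m2 C.
Proof.
move=> fin1 m1c m2c m1e m2e m12.
have image (m : {measure set (R * R)%type -> \bar R}) (phi : R * R -> measurableTypeR R) (D : set (R * R)) :
    measurable_fun setT phi -> measurable D ->
    exists nu : {measure set (measurableTypeR R) -> \bar R},
      forall A, measurable A -> nu A = m (phi @^-1` A `&` D).
  move=> mphi mD.
  have [nu nuE] := @image_density_is_measure R _ _ _ (measurableTypeR R) m phi (\1_D) mphi (measurable_indic mD) (fun x => ler0n _ _).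
  exists nu => A mA; have mpA : measurable (phi @^-1` A).
    by rewrite -[X in measurable X]setTI; exact: mphi.
  by rewrite nuE integral_indic// setIC.
have mfst : measurable_fun setT (fst : R * R -> measurableTypeR R) by exact: measurable_fst.
have msnd : measurable_fun setT (snd : R * R -> measurableTypeR R) by exact: measurable_snd.
have mA1 (A : set R) : measurable A -> measurable (A `*` [set: R]) by move=> mA; exact: measurableX.
have mA2 (A : set R) : measurable A -> measurable ([set: R] `*` A) by move=> mA; exact: measurableX.
have fstE (A B : set R) : fst @^-1` A `&` ([set: R] `*` B) = A `*` B.
  by apply/seteqP; split => [z/= [? []]|z/= []].
have sndE (A B : set R) : snd @^-1` B `&` (A `*` [set: R]) = A `*` B.
  by apply/seteqP; split => [z/= [? []]|z/= []].
have le0 (m : {measure set (R * R)%type -> \bar R}) X Y : measurable X -> measurable Y -> X `<=` Y -> m Y = 0%E -> m X = 0%E.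
  by move=> mX mY XY Y0; exact: (subset_measure0 mX mY XY Y0).
have le_fin (m : {measure set (R * R)%type -> \bar R}) X : (m setT < +oo)%E -> measurable X -> (m X < +oo)%E.
  by move=> fm mX; apply: le_lt_trans fm; apply: le_measure => //; rewrite inE.
have mlow (a : R) : measurable (`]-oo, a]%classic : set R) by exact: measurable_itv.
have mray (a : R) : measurable (`]a, +oo[%classic : set R) by exact: measurable_itv.
have H1 (A : set R) b : e < b -> measurable A -> m1 (A `*` `]b, +oo[%classic) = m2 (A `*` `]b, +oo[%classic).
  move=> eb mA.
  have mD := mA2 _ (mray b).
  have [n1 n1E] := image m1 fst _ mfst mD.
  have [n2 n2E] := image m2 fst _ mfst mD.
  have nE : n1 A = n2 A.
    apply: (@finite_measure_rays_unique_above c n1 n2) => //.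
    - by rewrite n1E// preimage_setT setTI; exact: le_fin.
    - rewrite n1E//.
      by apply: (le0 _ _ _ _ (mA1 _ (mlow c)) _ m1c); rewrite fstE; [exact: measurableX|exact: setSX].
    - rewrite n2E//.
      by apply: (le0 _ _ _ _ (mA1 _ (mlow c)) _ m2c); rewrite fstE; [exact: measurableX|exact: setSX].
    - by move=> a ca; rewrite n1E ?n2E; [rewrite !fstE; exact: m12|exact: mray|exact: mray].
  by move: nE; rewrite n1E// n2E// !fstE.
have H2 (A B : set R) : measurable A -> measurable B -> m1 (A `*` B) = m2 (A `*` B).
  move=> mA mB.
  have mD := mA1 _ mA.
  have [n1 n1E] := image m1 snd _ msnd mD.
  have [n2 n2E] := image m2 snd _ msnd mD.
  have nE : n1 B = n2 B.
    apply: (@finite_measure_rays_unique_above e n1 n2) => //.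
    - by rewrite n1E// preimage_setT setTI; exact: le_fin.
    - rewrite n1E//.
      by apply: (le0 _ _ _ _ (mA2 _ (mlow e)) _ m1e); rewrite sndE; [exact: measurableX|exact: setSX].
    - rewrite n2E//.
      by apply: (le0 _ _ _ _ (mA2 _ (mlow e)) _ m2e); rewrite sndE; [exact: measurableX|exact: setSX].
    - by move=> b eb; rewrite n1E ?n2E; [rewrite !sndE; exact: H1|exact: mray|exact: mray].
  by move: nE; rewrite n1E// n2E// !sndE.
apply: (@measure_unique _ R (R * R)%type
  [set A `*` B | A in @measurable _ R & B in @measurable _ R] (fun=> setT)).
- exact: measurable_prod_measurableType.
- move=> _ _ [A mA [B mB <-]] [A' mA' [B' mB' <-]]; exists (A `&` A'); first exact: measurableI.
  by exists (B `&` B'); [exact: measurableI|rewrite setXI].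
- by move=> _; exists setT => //; exists setT => //; rewrite setXTT.
- by rewrite bigcup_const.
- by move=> _ [A mA [B mB <-]]; exact: H2.
- by [].
Qed.

End QuadrantsUnique.

(** At [t] = 1 this is convertible to [last_zero]. *)
Definition last_zero_upto {R : realType} (t : R) (b : R -> R) : R :=
  sup [set r | 0 <= r <= t /\ b r = 0].

Lemma measurable_inv {R : realType} : measurable_fun setT (@GRing.inv R).
Proof.
have -> : [set: R] = [set 0] `|` ~` [set 0] by rewrite setUv.
apply/measurable_funU => //; first exact: measurableC.
split; first exact: measurable_fun_set1.
apply: open_continuous_measurable_fun; first exact: closed_openC.
by move=> x /set_mem/= /eqP x0; apply: inv_continuous.
Qed.

Section GaussianPair.
Context {R : realType}.
Notation N := (@normal_prob R 0 1).

Definition gaussian2 : subprobability (R * R)%type R :=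
  product_subprobability (gaussian1, gaussian1).

Lemma fubini_gaussian2 (f : R * R -> \bar R) :
  measurable_fun setT f -> (forall z, (0 <= f z)%E) ->
  (\int[gaussian2]_z f z = \int[N]_x \int[N]_y f (x, y))%E.
Proof.
move=> mf f0.
have mfx x : measurable_fun setT (fun y => f (x, y)).
  exact: (measurableT_comp mf (measurable_pair1 x)).
transitivity (\int[gaussian]_x \int[gaussian]_y f (x, y))%E.
  exact: (@fubini_tonelli1 _ _ _ _ R gaussian1 gaussian1 f mf f0).
rewrite integral_gaussian.
- by apply: eq_integral => x _; rewrite integral_gaussian.
- exact: (@measurable_fun_fubini_tonelli_F _ _ _ _ R gaussian1 f mf f0).
- by move=> x; apply: integral_ge0.
Qed.

End GaussianPair.

Section LastZero.
Context {R : realType} {d : measure_display} {Om : measurableType d}.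
Variables (P : probability Om R) (B : R -> {RV P >-> R}).
Hypothesis hB : brownian_motion P B.
Notation N := (@normal_prob R 0 1).
Local Notation g t w := (last_zero_upto t (B ^~ w)).

Let mB t : measurable_fun setT (B t : Om -> R). Proof. exact: measurable_funPT. Qed.

Lemma last_zero_upto_ge t w r : 0 <= r <= t -> B r w = 0 -> r <= g t w.
Proof.
move=> rt Br; apply: ub_le_sup => //.
by exists t => x [/andP[]].
Qed.

(** The set of zeros contains 0, and continuity makes its supremum a zero. *)
Lemma last_zero_uptoP t w : 0 <= t -> [/\ 0 <= g t w, g t w <= t & B (g t w) w = 0].
Proof.
move=> t0; set S := [set r | 0 <= r <= t /\ B r w = 0].
have B0 : B 0 w = 0 by have [] := hB.
have S0 : S 0 by split => //; rewrite lexx.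
have hsS : has_sup S by split; [exists 0|exists t => x [/andP[]]].
have g0 : 0 <= g t w by apply: last_zero_upto_ge => //; rewrite lexx.
have gt : g t w <= t by apply: ge_sup; [exists 0|move=> x [/andP[]]].
split => //; apply/eqP/negPn/negP => Bg.
have e0 : 0 < `|B (g t w) w| by rewrite normr_gt0.
have [eta eta0 H] := brownian_continuous hB w g0 e0.
have [r [rt Br] gr] := sup_adherent eta0 hsS.
have rg : r <= g t w by exact: last_zero_upto_ge.
have r0 : 0 <= r by case/andP: rt.
have : `|r - g t w| < eta by rewrite ler0_norm ?subr_le0// opprB ltrBlDl -ltrBlDr.
by move/(H _ r0); rewrite Br sub0r normrN ltxx.
Qed.

Lemma last_zero_upto_lt s t w : 0 <= s -> s <= t -> (g t w < s) <-> no_zero s t (B ^~ w).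
Proof.
move=> s0 st; have t0 := le_trans s0 st; split => [gs r /andP[sr rt]|nz].
  apply/eqP => Br; have rg : r <= g t w by apply: last_zero_upto_ge => //; rewrite (le_trans s0 sr).
  by have := lt_le_trans gs (le_trans sr rg); rewrite ltxx.
have [g0 gt Bg] := last_zero_uptoP w t0.
rewrite ltNge; apply/negP => sg; have := nz (g t w).
by rewrite sg gt Bg eqxx => /(_ isT).
Qed.

Lemma no_zero_cat s t T w : s <= t -> t <= T ->
  no_zero s T (B ^~ w) <-> no_zero s t (B ^~ w) /\ no_zero t T (B ^~ w).
Proof.
move=> st tT; split => [H|[H1 H2] r /andP[sr rT]].
  split => r /andP[h1 h2]; apply: H; first by rewrite h1 (le_trans h2).
  by rewrite h2 (le_trans st).
by have [rt|tr] := leP r t; [apply: H1; rewrite sr|apply: H2; rewrite (ltW tr)].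
Qed.

Lemma measurable_no_zero_le s t : 0 < s -> s <= t -> measurable [set w | no_zero s t (B ^~ w)].
Proof.
move=> s0; rewrite le_eqVlt => /predU1P[<-|st]; last exact: (measurable_no_zero hB s0 st (lexx t)).
rewrite (_ : [set w | _] = B s @^-1` (~` [set 0])).
  rewrite -[X in measurable X]setTI; apply: (mB s) => //.
  by apply: measurableC; exact: measurable_set1.
apply/seteqP; split => w /=.
  by move=> /(_ s); rewrite lexx => /(_ isT)/eqP.
by move=> /eqP Bs r /le_anti <-.
Qed.

Lemma measurable_last_zero_lt t s : 0 <= t -> measurable [set w | g t w < s].
Proof.
move=> t0; have [s0|s0] := leP s 0.
  rewrite (_ : [set w | _] = set0) //; apply/seteqP; split => // w /= gs.
  have [g0 _ _] := last_zero_uptoP w t0.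
  by have := lt_le_trans gs s0; rewrite ltNge g0.
have [st|ts] := leP s t.
  rewrite (_ : [set w | _] = [set w | no_zero s t (B ^~ w)]); first exact: measurable_no_zero_le.
  by apply/seteqP; split => w /= /last_zero_upto_lt; apply => //; exact: ltW.
rewrite (_ : [set w | _] = setT) //; apply/seteqP; split => // w _ /=.
by have [_ gt _] := last_zero_uptoP w t0; exact: le_lt_trans gt ts.
Qed.

Lemma measurable_last_zero t : 0 <= t -> measurable_fun setT (fun w => g t w).
Proof.
move=> t0.
(* The events known to be measurable are g_t < s, which are upward rays for - g_t. *)
have -> : (fun w => g t w) = (fun w => - (- g t w)) by apply/funext => w; rewrite opprK.
apply: measurableT_comp => //.
apply: (@measurability _ _ Om (measurableTypeR R) setT (fun w => - g t w) (@RGenOInfty.G R)).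
  exact: RGenOInfty.measurableE.
move=> _ [_ [a ->] <-]; rewrite setTI.
rewrite (_ : _ @^-1` _ = [set w | g t w < - a]); first exact: measurable_last_zero_lt.
by apply/seteqP; split => w /=; rewrite in_itv/= andbT ltrNr.
Qed.

(** For s < t, having g_t < s and no zero on [t, T] means having no zero on [s, T], and
    [no_zero_abs_law] gives the law of |B_t| there. Its first band is the probability that t Y^2 /
    (X^2 + Y^2) < s, which is where the ratio comes from. *)
Lemma abs_last_zero_law t T (F : R -> R -> \bar R) : 0 < t -> t <= T ->
  measurable_fun setT (fun z : R * R => F z.1 z.2) -> (forall x s, (0 <= F x s)%E) ->
  (\int[P]_w (F `|B t w|%R (g t w) * (\1_[set w | no_zero t T (B ^~ w)] w)%:E) =
   \int[N]_x \int[N]_y (F (Num.sqrt t * `|x|)%R (t * (y ^+ 2 / (x ^+ 2 + y ^+ 2)))%R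
     * gauss_band (Num.sqrt (T - t)) (Num.sqrt t * `|x|)%R))%E.
Proof.
move=> t0 tT mF F0.
have rt0 : 0 < Num.sqrt t by rewrite sqrtr_gt0.
pose NZ := [set w | no_zero t T (B ^~ w)].
have mNZ : measurable NZ by exact: measurable_no_zero_le.
(* The minus sign turns g_t < s into an upward quadrant. *)
pose phi1 w : R * R := (`|B t w|, - g t w).
have mphi1 : measurable_fun setT phi1.
  apply/measurable_fun_pair; first by apply: measurableT_comp => //; exact: mB.
  by apply: measurableT_comp => //; apply: measurable_last_zero; exact: ltW.
pose p (z : R * R) : R := fine (gauss_band (Num.sqrt (T - t)) (Num.sqrt t * `|z.1|)).
have mp : measurable_fun setT p.
  apply: (measurableT_comp (f := @fine R)) => //.
  apply: (measurableT_comp (measurable_gauss_band (Num.sqrt (T - t)))).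
  by apply: measurable_funM => //; apply: (measurableT_comp (@normr_measurable R setT)).
have p0 z : 0 <= p z by apply: fine_ge0; exact: measure_ge0.
have pE x y : (p (x, y))%:E = gauss_band (Num.sqrt (T - t)) (Num.sqrt t * `|x|).
  by rewrite fineK//; apply: fin_num_measure; exact: measurable_band.
pose q (z : R * R) : R := t * (z.2 ^+ 2 / (z.1 ^+ 2 + z.2 ^+ 2)).
pose phi2 (z : R * R) : R * R := (Num.sqrt t * `|z.1|, - q z).
have m1 : measurable_fun setT (fun z : R * R => z.1) by exact: measurable_fst.
have m2 : measurable_fun setT (fun z : R * R => z.2) by exact: measurable_snd.
have mq : measurable_fun setT q.
  apply: measurable_funM => //; apply: measurable_funM; first exact: measurable_funX.
  apply: (measurableT_comp (f := @GRing.inv R)); first exact: measurable_inv.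
  by apply: measurable_funD; exact: measurable_funX.
have mphi2 : measurable_fun setT phi2.
  apply/measurable_fun_pair; last exact: measurableT_comp.
  by apply: measurable_funM => //; exact: measurableT_comp.
have m1NZ : measurable_fun setT (\1_NZ : Om -> R) by exact: measurable_indic.
have NZ0 w : 0 <= \1_NZ w :> R by [].
have [nu1 nu1E] := image_density_is_measure P mphi1 m1NZ NZ0.
have [nu2 nu2E] := image_density_is_measure gaussian2 mphi2 mp p0.
have nu1i A : measurable A -> nu1 A = P (phi1 @^-1` A `&` NZ).
  move=> mA; rewrite nu1E integral_indic 1?setIC//.
  by rewrite -[X in measurable X]setTI; exact: mphi1.
have mpre A : measurable A -> measurable (phi2 @^-1` A).
  by move=> mA; rewrite -[X in measurable X]setTI; exact: mphi2.
have nu2i A : measurable A -> nu2 A = (\int[N]_x \int[N]_y ((\1_(phi2 @^-1` A) (x, y))%:E * (p (x, y))%:E))%E.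
  move=> mA; rewrite nu2E integral_mkcond fubini_gaussian2.
  - apply: eq_integral => x _; apply: eq_integral => y _.
    by rewrite patchE indicE; case: ifP => _; rewrite ?mul1e ?mul0e.
  - apply/(measurable_restrictT _ (mpre _ mA)); apply: measurable_funTS; exact/measurable_EFinP.
  - by move=> z; rewrite patchE; case: ifP => // _; rewrite lee_fin.
(* The weight removes the line x = 0, on which the ratio in [q] degenerates. *)
have p0E y : p (0, y) = 0.
  rewrite /p/= normr0 mulr0 /gauss_band (_ : [set _ | _] = set0) ?measure0//.
  by apply/seteqP; split => // z /=; rewrite ltNge normr_ge0.
have q0 z : 0 <= q z by rewrite mulr_ge0 ?divr_ge0 ?addr_ge0 ?sqr_ge0// ltW.
have mlow (a : R) : measurable (`]-oo, a]%classic : set R) by exact: measurable_itv.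
have mray (a : R) : measurable (`]a, +oo[%classic : set R) by exact: measurable_itv.
have nu1_0 A : measurable A -> (forall w, NZ w -> ~ A (phi1 w)) -> nu1 A = 0%E.
  move=> mA HA; rewrite nu1i// (_ : _ `&` _ = set0) ?measure0//.
  by apply/seteqP; split => // w [/= Aw /HA].
have nu2_0 A : measurable A -> (forall x y, A (phi2 (x, y)) -> x = 0) -> nu2 A = 0%E.
  move=> mA HA; rewrite nu2i//; apply: integral0_eq => x _; apply: integral0_eq => y _.
  have [/set_mem/HA ->|xA] := boolP ((x, y) \in phi2 @^-1` A); first by rewrite p0E mule0.
  by rewrite indicE (negbTE xA) mul0e.
have absB w : NZ w -> 0 < `|B t w|.
  by move=> /(_ t); rewrite lexx tT normr_gt0; exact.
have nuE (A : set (R * R)) : measurable A -> nu1 A = nu2 A.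
  apply: (@finite_measure_quadrants_unique R 0 (- t)).
  - rewrite nu1i//; apply: (le_lt_trans (probability_le1 _ _)); last exact: ltry.
    by rewrite preimage_setT setTI.
  - apply: nu1_0; first exact: measurableX.
    by move=> w /absB B0 [/=]; rewrite in_itv/= leNgt B0.
  - apply: nu2_0; first exact: measurableX.
    move=> x y [/=]; rewrite in_itv/= pmulr_rle0// normr_le0 => /eqP.
    by [].
  - apply: nu1_0; first exact: measurableX.
    move=> w NZw [_ /=]; rewrite in_itv/= lerN2 => tg.
    have [_ gt Bg] := last_zero_uptoP w (ltW t0).
    have gE : g t w = t by apply/le_anti/andP.
    by have := absB w NZw; rewrite -{1}gE Bg normr0 ltxx.
  - apply: nu2_0; first exact: measurableX.
    move=> x y [_ /=]; rewrite in_itv/= lerN2 /q/= -[X in X <= _]mulr1 ler_pM2l// => tq.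
    apply/eqP/negPn/negP => x0.
    have x2 : 0 < x ^+ 2 by rewrite exprn_even_gt0.
    have xy2 : 0 < x ^+ 2 + y ^+ 2 by rewrite ltr_pwDl// sqr_ge0.
    by move: tq; rewrite ler_pdivlMr// mul1r gerDr leNgt x2.
  - move=> a b a0 tb; have mQ : measurable (`]a, +oo[%classic `*` `]b, +oo[%classic) by exact: measurableX.
    have [b0|b0] := leP 0 b.
      rewrite nu1_0// ?nu2_0//.
        move=> x y [_ /=]; rewrite in_itv/= andbT => bq.
        by have := lt_le_trans (le_lt_trans b0 bq) (_ : - q (x, y) <= 0); rewrite ltxx oppr_le0 q0 => /(_ isT).
      move=> w _ [_ /=]; rewrite in_itv/= andbT => bg.
      have [g0 _ _] := last_zero_uptoP w (ltW t0).
      by have := le_lt_trans b0 bg; rewrite oppr_gt0 ltNge g0.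
    pose s := - b.
    have s0 : 0 < s by rewrite oppr_gt0.
    have st : s < t by rewrite ltrNl.
    rewrite nu1i//.
    have -> : phi1 @^-1` (`]a, +oo[ `*` `]b, +oo[) `&` NZ = [set w | no_zero s T (B ^~ w) /\ a < `|B t w|].
      apply/seteqP; split => w /=; rewrite !in_itv/= !andbT ltrNr -/s.
        move=> [[aB gs] nz]; split => //; apply/(no_zero_cat _ (ltW st) tT); split => //.
        exact/(last_zero_upto_lt _ (ltW s0) (ltW st)).
      move=> [/(no_zero_cat _ (ltW st) tT)[nz1 nz2] aB]; split => //; split => //.
      exact/(last_zero_upto_lt _ (ltW s0) (ltW st)).
    rewrite (no_zero_abs_law hB s0 st tT (ltW a0)) nu2i//; apply: eq_integral => x _.
    have [ax|ax] := ltP a (Num.sqrt t * `|x|); last first.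
      rewrite indicE memNset/= ?mul0e; last by apply/negP; rewrite -leNgt.
      rewrite integral0_eq// => y _.
      rewrite indicE memNset ?mul0e//= => -[]; rewrite in_itv/= andbT.
      by move=> /lt_le_trans/(_ ax); rewrite ltxx.
    rewrite indicE mem_set// mul1e.
    have x0 : x != 0.
      by apply/eqP => x0; move: (lt_trans a0 ax); rewrite x0 normr0 mulr0 ltxx.
    have x2 : 0 < x ^+ 2 by rewrite exprn_even_gt0.
    (* Clearing the denominator, t y^2 < s (x^2 + y^2) is (t - s) y^2 < s x^2. *)
    have bandE (y : R) : (- q (x, y) > b) = (`|Num.sqrt (t - s) * y| < Num.sqrt s * `|x|).
      have xy2 : 0 < x ^+ 2 + y ^+ 2 by rewrite ltr_pwDl// sqr_ge0.
      rewrite ltrNr -/s /q/= mulrA ltr_pdivrMr//.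
      have sx0 : 0 <= Num.sqrt s * `|x| by rewrite mulr_ge0.
      have <- := @ltr_pXn2r R 2 isT _ _ (normr_ge0 (Num.sqrt (t - s) * y)) sx0.
      rewrite real_normK ?num_real// !exprMn real_normK ?num_real//.
      rewrite sqr_sqrtr ?subr_ge0 ?(ltW st)// sqr_sqrtr ?(ltW s0)//.
      by rewrite mulrBl mulrDr ltrBlDr.
    have -> : gauss_band (Num.sqrt (T - t)) (Num.sqrt t * `|x|) = (p (x, 0))%:E by rewrite pE.
    rewrite (_ : gauss_band _ _ = \int[N]_y (\1_[set y | (`|Num.sqrt (t - s) * y| < Num.sqrt s * `|x|)%R] y)%:E)%E; last first.
      by rewrite /gauss_band (measure_integral_indic _ (measurable_band _ _)).
    rewrite -ge0_integralZr//.
    - apply: eq_integral => y _; congr (_ * _)%E; rewrite !indicE; congr ((nat_of_bool _)%:R%:E).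
      apply/idP/idP => /set_mem H; apply/mem_set; move: H; rewrite /= !in_itv/= !andbT bandE ax.
        by [].
      by case.
    - by apply/measurable_EFinP; apply: measurable_indic; exact: measurable_band.
    - by rewrite lee_fin.
transitivity (\int[nu1]_z F z.1 (- z.2)%R)%E.
  rewrite (ge0_integral_image_density mphi1 m1NZ NZ0 (fun A _ => nu1E A))//.
  - by apply: eq_integral => w _; rewrite /phi1/= opprK.
  - apply: (measurableT_comp mF (g := fun z : R * R => (z.1, - z.2))).
    by apply/measurable_fun_pair => //; exact: measurableT_comp.
transitivity (\int[nu2]_z F z.1 (- z.2)%R)%E.
  by apply: eq_measure_integral => A mA _; exact: nuE.
rewrite (ge0_integral_image_density mphi2 mp p0 (fun A _ => nu2E A))//.
- rewrite fubini_gaussian2.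
  + by apply: eq_integral => x _; apply: eq_integral => y _; rewrite pE /phi2/= opprK.
  + apply: emeasurable_funM; last exact/measurable_EFinP.
    apply: (measurableT_comp mF (g := fun z : R * R => ((phi2 z).1, - (phi2 z).2))).
    apply/measurable_fun_pair; first exact: (measurableT_comp measurable_fst mphi2).
    by apply: measurableT_comp => //; exact: (measurableT_comp measurable_snd mphi2).
  + by move=> z; rewrite mule_ge0// lee_fin.
- apply: (measurableT_comp mF (g := fun z : R * R => (z.1, - z.2))).
  by apply/measurable_fun_pair => //; exact: measurableT_comp.
Qed.

End LastZero.

(** * Exchange of Lebesgue integrals *)

Section LebesgueTonelli.
Context {R : realType}.
Notation mu := (@lebesgue_measure R).

Lemma measurable_integral_param d' (X : measurableType d') (E : set R) (f : X -> R -> \bar R) :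
  measurable E ->
  measurable_fun setT (fun z : X * R => f z.1 z.2) -> (forall x y, (0 <= f x y)%E) ->
  measurable_fun setT (fun x => \int[mu]_(y in E) f x y)%E.
Proof.
move=> mE mf f0.
have -> : (fun x => \int[mu]_(y in E) f x y)%E = (fun x => \int[mu]_y (f x y * (\1_E y)%:E))%E.
  by apply/funext => x; rewrite integral_mkcond; apply: eq_integral => y _; rewrite epatch_indic.
apply: (@measurable_fun_fubini_tonelli_F _ _ X (measurableTypeR R) R mu (fun z => f z.1 z.2 * (\1_E z.2)%:E)%E).
  apply: emeasurable_funM => //; apply/measurable_EFinP.
  exact: (measurableT_comp (measurable_indic mE) measurable_snd).
by move=> z; rewrite mule_ge0// lee_fin.
Qed.

Let integral_swap_ge0 (D E : set R) (f : R -> R -> \bar R) : measurable D -> measurable E ->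
  measurable_fun setT (fun z : R * R => f z.1 z.2) -> (forall x y, (0 <= f x y)%E) ->
  (\int[mu]_(x in D) \int[mu]_(y in E) f x y = \int[mu]_(y in E) \int[mu]_(x in D) f x y)%E.
Proof.
move=> mD mE mf f0.
have rE (E' D' : set R) (g : R -> R -> \bar R) : measurable E' -> measurable D' ->
    measurable_fun setT (fun z : R * R => g z.1 z.2) -> (forall x y, (0 <= g x y)%E) ->
    (\int[mu]_(x in D') \int[mu]_(y in E') g x y =
     \int[mu]_x \int[mu]_y (g x y * ((\1_D' x)%:E * (\1_E' y)%:E)))%E.
  move=> mE' mD' mg g0.
  rewrite integral_mkcond; apply: eq_integral => x _; rewrite epatch_indic integral_mkcond.
  have mgx : measurable_fun setT (fun y => g x y) by exact: (measurableT_comp mg (measurable_pair1 x)).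
  under [in RHS]eq_integral do rewrite muleCA muleC.
  rewrite ge0_integralZr//.
  - by congr (_ * _)%E; apply: eq_integral => y _; rewrite epatch_indic.
  - apply: emeasurable_funM => //; exact/measurable_EFinP/measurable_indic.
  - by move=> y _; rewrite mule_ge0// lee_fin.
have mf' : measurable_fun setT (fun z : R * R => f z.2 z.1).
  by apply: (measurableT_comp mf (g := fun z : R * R => (z.2, z.1))); exact: measurable_swap.
rewrite (rE E D f mE mD mf f0) (rE D E (fun x y => f y x) mD mE mf' (fun x y => f0 y x)).
rewrite (@fubini_tonelli _ _ (measurableTypeR R) (measurableTypeR R) R mu mu (fun z => f z.1 z.2 * ((\1_D z.1)%:E * (\1_E z.2)%:E))%E).
- by apply: eq_integral => y _; apply: eq_integral => x _ /=; rewrite [X in (_ * X)%E]muleC.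
- apply: emeasurable_funM => //; apply: emeasurable_funM; apply/measurable_EFinP.
    exact: (measurableT_comp (measurable_indic mD) measurable_fst).
  exact: (measurableT_comp (measurable_indic mE) measurable_snd).
- by move=> z; rewrite !mule_ge0// lee_fin.
Qed.

Lemma integral_swap (D E : set R) (f : R -> R -> \bar R) : measurable D -> measurable E ->
  measurable_fun setT (fun z : R * R => f z.1 z.2) -> (forall x y, D x -> E y -> (0 <= f x y)%E) ->
  (\int[mu]_(x in D) \int[mu]_(y in E) f x y = \int[mu]_(y in E) \int[mu]_(x in D) f x y)%E.
Proof.
move=> mD mE mf f0.
(* Truncation at 0 makes the integrand non-negative everywhere and leaves it unchanged on [D] times
   [E]. *)
pose f' x y := Order.max (f x y) 0%E.
have f'E x y : D x -> E y -> f x y = f' x y by move=> Dx Ey; rewrite /f' max_l// f0.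
transitivity (\int[mu]_(x in D) \int[mu]_(y in E) f' x y)%E.
  by apply: eq_integral => x /set_mem Dx; apply: eq_integral => y /set_mem Ey; exact: f'E.
rewrite integral_swap_ge0//.
- by apply: eq_integral => y /set_mem Ey; apply: eq_integral => x /set_mem Dx; rewrite -f'E.
- exact: measurable_maxe.
- by move=> x y; rewrite /f' le_max lexx orbT.
Qed.

End LebesgueTonelli.

Lemma measurable_sqrt {R : realType} : measurable_fun setT (@Num.sqrt R).
Proof. by apply: continuous_measurable_fun; exact: sqrt_continuous. Qed.

Ltac mfun := repeat
  match goal with
  | |- measurable_fun _ (fun z => @GRing.add _ _ _) => apply: measurable_funD
  | |- measurable_fun _ (fun z => @GRing.opp _ _) => apply: measurable_funN
  | |- measurable_fun _ (fun z => @GRing.exp _ _ _) => apply: measurable_funX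
  | |- measurable_fun _ (fun z => @GRing.mul _ _ _) => apply: measurable_funM
  | |- measurable_fun _ (fun z => GRing.inv _) => apply: (measurableT_comp measurable_inv)
  | |- measurable_fun _ (fun z => expR _) => apply: (measurableT_comp (@measurable_expR _))
  | |- measurable_fun _ (fun z => Num.sqrt _) => apply: (measurableT_comp measurable_sqrt)
  | |- measurable_fun _ (fun z => Num.norm _) => apply: (measurableT_comp (@normr_measurable _ setT))
  | |- measurable_fun _ (fun z => z) => exact: measurable_id
  | |- measurable_fun _ (fun z => ?c) => exact: measurable_cst
  | |- measurable_fun _ GRing.inv => exact: measurable_inv
  | |- measurable_fun _ GRing.opp => exact: oppr_measurable
  | |- measurable_fun _ expR => exact: measurable_expR
  | |- measurable_fun _ Num.sqrt => exact: measurable_sqrt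
  | |- measurable_fun _ Num.norm => exact: normr_measurable
  | |- measurable_fun _ fst => exact: measurable_fst
  | |- measurable_fun _ snd => exact: measurable_snd
  | |- measurable_fun _ (fun z => z.1) => exact: measurable_fst
  | |- measurable_fun _ (fun z => z.2) => exact: measurable_snd
  | |- measurable_fun _ (fun z => fst _) => apply: (measurableT_comp measurable_fst)
  | |- measurable_fun _ (fun z => snd _) => apply: (measurableT_comp measurable_snd)
  | _ => assumption
  end.

Section GaussBandReal.
Context {R : realType}.
Notation N := (@normal_prob R 0 1).

Definition gband (b a : R) : R := fine (gauss_band b a).

Lemma gbandE b a : (gband b a)%:E = gauss_band b a.
Proof. by rewrite fineK//; apply: fin_num_measure; exact: measurable_band. Qed.

Lemma gband_ge0 b a : 0 <= gband b a.
Proof. by apply: fine_ge0; exact: measure_ge0. Qed.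

Lemma gband_le1 b a : gband b a <= 1.
Proof. by rewrite -lee_fin gbandE; apply: probability_le1; exact: measurable_band. Qed.

Lemma gband0 a : 0 < a -> gband 0 a = 1.
Proof.
move=> a0; rewrite /gband /gauss_band (_ : [set _ | _] = setT) ?probability_setT//.
by apply/seteqP; split => // z _ /=; rewrite mul0r normr0.
Qed.

Lemma gband_scale (k b a : R) : 0 < k -> gband (k * b) (k * a) = gband b a.
Proof.
move=> k0; rewrite /gband /gauss_band; congr (fine (N _)).
have H (z : R) : (`|k * b * z| < k * a) = (`|b * z| < a).
  by rewrite -mulrA (normrM k) (gtr0_norm k0) ltr_pM2l.
by apply/seteqP; split => z /=; rewrite H.
Qed.

Lemma measurable_gband : measurable_fun setT (fun z : R * R => gband z.1 z.2).
Proof.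
apply: (measurableT_comp (f := @fine R)) => //.
pose A := [set z : (R * R) * R | 0 < z.1.2 - `|z.1.1 * z.2|].
have mA : measurable A by apply: measurable_set_gt; mfun.
rewrite (_ : (fun z => _) = (fun q : R * R => \int[N]_y (\1_A (q, y))%:E)%E); last first.
  apply/funext => q; rewrite /gauss_band (measure_integral_indic _ (measurable_band q.1 q.2)).
  apply: eq_integral => y _; rewrite !indicE; congr ((nat_of_bool _)%:R%:E).
  by apply/idP/idP => /set_mem/= H; apply/mem_set; move: H; rewrite /A/= subr_gt0.
apply: (measurable_integral_gauss (f := fun q y => (\1_A (q, y))%:E)) => //.
apply/measurable_EFinP.
by apply: (measurableT_comp (measurable_indic mA) (g := fun z : (R * R) * R => (z.1, z.2))); apply/measurable_fun_pair.
Qed.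

End GaussBandReal.

Section Integrals.
Context {R : realType}.
Notation mu := (@lebesgue_measure R).

Lemma integral_exp_tail (a c : R) : 0 <= a -> 0 < c ->
  (\int[mu]_(x in `]a, +oo[) (x * expR (- (c * x ^+ 2 / 2)))%:E = (c^-1 * expR (- (c * a ^+ 2 / 2)))%:E)%E.
Proof.
move=> a0 c0.
rewrite integral_itv_obnd_cbnd; last first.
  by apply/measurable_EFinP; apply: measurable_funTS; mfun.
pose F (x : R) := - (c^-1 * expR (- (c * x ^+ 2 / 2))).
have dF (x : R) : is_derive x 1 F (x * expR (- (c * x ^+ 2 / 2))).
  apply: is_derive_eq; rewrite /GRing.scale/= ?mulr1 ?mulr0 ?addr0 ?add0r ?expr1.
  by field; rewrite gt_eqF.
have cF : continuous F.
  move=> x; apply: differentiable_continuous; apply/derivable1_diffP.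
  by have [] := dF x.
have dFE (x : R) : derive1 F x = x * expR (- (c * x ^+ 2 / 2)) by rewrite derive1E; have [_ ->] := dF x.
rewrite (@ge0_continuous_FTC2y R _ F a 0).
- by rewrite sub0e /F EFinN oppeK.
- by move=> x ax; rewrite mulr_ge0 ?expR_ge0// (le_trans a0).
- apply: continuous_subspaceT => x.
  by apply: differentiable_continuous; apply/derivable1_diffP; apply: ex_derive.
- rewrite -[X in _ --> X]oppr0; apply: cvgN; rewrite -[X in _ --> X](mulr0 c^-1); apply: cvgMr.
  apply: (@cvg_comp _ _ _ (fun x : R => c * x ^+ 2 / 2) (fun x => expR (- x)) _ +oo); last exact: cvgr_expR.
  apply/cvgryPge => A.
  near=> x.
  have x1 : 1 <= x by near: x; exact: nbhs_pinfty_ge.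
  have Ax : `|A| * 2 / c <= x by near: x; apply: nbhs_pinfty_ge; exact: num_real.
  apply: (le_trans (ler_norm A)); rewrite ler_pdivlMr// mulrC -ler_pdivrMl//.
  apply: (le_trans _ (_ : x <= x ^+ 2)); last by rewrite expr2 ler_peMl// (le_trans _ x1).
  suff -> : c^-1 * (2 * `|A|) = `|A| * 2 / c by []. by ring.
- by move=> x _; have [] := dF x.
- by apply: cvg_at_right_filter; exact: cF.
- by move=> x _; exact: dFE.
Unshelve. all: by end_near. Qed.

Lemma integral_inv_oneDsqr :
  (\int[mu]_(x in `]0%R, +oo[) ((1 + x ^+ 2)^-1)%:E = (pi / 2)%:E)%E.
Proof.
rewrite integral_itv_obnd_cbnd; last first.
  by apply/measurable_EFinP; apply: measurable_funTS; mfun.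
rewrite (@ge0_continuous_FTC2y R _ atan 0 (pi / 2)).
- by rewrite atan0 sube0.
- by move=> x _; rewrite invr_ge0 addr_ge0// sqr_ge0.
- apply: continuous_subspaceT => x.
  have c2 : {for (x : R), continuous (fun x : R => 1 + x ^+ 2)}.
    by apply: differentiable_continuous; apply/derivable1_diffP; apply: ex_derive.
  by apply: cvgV; [rewrite gt_eqF// ltr_pwDl// sqr_ge0|exact: c2].
- exact: cvgy_atan.
- by move=> x _; exact: derivable_atan.
- by apply: cvg_at_right_filter; exact: continuous_atan.
- by move=> x _; exact: derive1_atan.
Qed.

End Integrals.

(** * The endpoint of the meander *)

Section PolarLaw.
Context {R : realType} {d : measure_display} {Om : measurableType d}.
Variables (P : probability Om R) (B : R -> {RV P >-> R}).
Hypothesis hB : brownian_motion P B.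
Notation N := (@normal_prob R 0 1).
Notation mu := (@lebesgue_measure R).
Local Notation g t w := (last_zero_upto t (B ^~ w)).

Lemma gauss_pdf_mul (x v : R) :
  gauss_pdf x * gauss_pdf (x * v) = (2 * pi)^-1 * expR (- (x ^+ 2 * (1 + v ^+ 2) / 2)).
Proof.
rewrite /gauss_pdf mulrACA -invfM -expr2 sqr_sqrtr ?mulr_ge0 ?pi_ge0// -expRD.
by congr (_ * expR _); field.
Qed.

(* The variable v stands for the slope |Y / X| of the Gaussian pair of abs_last_zero_law. *)
Lemma abs_last_zero_polar t T (G : R -> R -> R) : 0 < t -> t <= T ->
  measurable_fun setT (fun z : R * R => G z.1 z.2) -> (forall x s, 0 <= G x s) ->
  (\int[P]_w (G `|B t w| (g t w) * \1_[set w | no_zero t T (B ^~ w)] w)%:E =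
   \int[mu]_(v in `]0%R, +oo[) \int[mu]_(x in `]0%R, +oo[)
     (G (Num.sqrt t * x) (t * (v ^+ 2 / (1 + v ^+ 2))) * gband (Num.sqrt (T - t)) (Num.sqrt t * x)
       * (2 / pi * (x * expR (- (x ^+ 2 * (1 + v ^+ 2) / 2)))))%:E)%E.
Proof.
move=> t0 tT mG G0.
pose K (x y : R) : R := G (Num.sqrt t * x) (t * (y ^+ 2 / (x ^+ 2 + y ^+ 2))) * gband (Num.sqrt (T - t)) (Num.sqrt t * x).
have K0 x y : 0 <= K x y by rewrite mulr_ge0// gband_ge0.
have mK : measurable_fun setT (fun z : R * R => K z.1 z.2).
  apply: measurable_funM.
    by apply: (measurable_fun_comp2 mG); mfun.
  by apply: (measurable_fun_comp2 measurable_gband); mfun.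
have mgp := @measurable_gauss_pdf R.
pose h (x : R) : \bar R := (\int[mu]_(y in `]0%R, +oo[) (K x y * (2 * gauss_pdf y))%:E)%E.
have mh : measurable_fun setT h.
  apply: (measurable_integral_param (f := fun x y => (K x y * (2 * gauss_pdf y))%:E)) => //.
    apply/measurable_EFinP; apply: measurable_funM => //; apply: measurable_funM => //.
    by apply: (measurableT_comp mgp); mfun.
  by move=> x y; rewrite lee_fin mulr_ge0// mulr_ge0// ltW// gauss_pdf_gt0.
have h0 x : (0 <= h x)%E.
  by apply: integral_ge0 => y _; rewrite lee_fin mulr_ge0// mulr_ge0// ltW// gauss_pdf_gt0.
transitivity (\int[P]_w ((G `|B t w| (g t w))%:E * (\1_[set w | no_zero t T (B ^~ w)] w)%:E))%E.
  by apply: eq_integral => w _; rewrite EFinM.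
rewrite (abs_last_zero_law hB (F := fun x s => (G x s)%:E) t0 tT)//; last exact/measurable_EFinP.
transitivity (\int[N]_x h (`|x|)%R)%E.
  apply: eq_integral => x _.
  transitivity (\int[N]_y (K `|x|%R (`|y|%R))%:E)%E.
    apply: eq_integral => y _.
    by rewrite -gbandE /K !real_normK ?num_real// EFinM.
  rewrite (@integral_gauss_abs R (fun y => (K `|x|%R y)%:E)).
  - by apply: eq_integral => y _; rewrite -EFinM.
  - by apply/measurable_EFinP; exact: (measurableT_comp mK (measurable_pair1 `|x|%R)).
  - by move=> y; rewrite lee_fin.
rewrite integral_gauss_abs//.
rewrite [RHS]integral_swap//; first last.
- move=> v x v0; rewrite /= in_itv/= andbT => x0.
  by rewrite lee_fin !mulr_ge0 ?gband_ge0 ?invr_ge0 ?pi_ge0 ?expR_ge0 ?(ltW x0).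
- apply/measurable_EFinP; apply: measurable_funM; last by mfun.
  apply: measurable_funM; first by apply: (measurable_fun_comp2 mG); mfun.
  by apply: (measurable_fun_comp2 measurable_gband); mfun.
apply: eq_integral => x; rewrite inE/= in_itv/= andbT => x0.
have mKx : measurable_fun setT (fun y => K x y) by exact: (measurableT_comp mK (measurable_pair1 x)).
have mf : measurable_fun setT (fun y => (K x y * (2 * gauss_pdf y))%:E).
  by apply/measurable_EFinP; apply: measurable_funM => //; apply: measurable_funM.
have f0 y : (0 <= (K x y * (2 * gauss_pdf y))%:E)%E.
  by rewrite lee_fin mulr_ge0// mulr_ge0// ltW// gauss_pdf_gt0.
(* With y = x v the ratio y^2 / (x^2 + y^2) becomes v^2 / (1 + v^2), free of x. *)
rewrite /h (@ge0_integral_scale R x (fun y => (K x y * (2 * gauss_pdf y))%:E) x0 mf f0).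
have mxf : measurable_fun setT (fun v => (K x (x * v) * (2 * gauss_pdf (x * v)))%:E).
  by apply: (measurableT_comp mf (g := fun v => x * v)); mfun.
have v1 (v : R) : 0 < 1 + v ^+ 2 by rewrite ltr_pwDl// sqr_ge0.
have x2 : 0 < x ^+ 2 by rewrite exprn_gt0.
rewrite -ge0_integralZr; first last.
- by rewrite lee_fin mulr_ge0// ltW// gauss_pdf_gt0.
- by move=> v _; apply: mule_ge0; [exact: f0|rewrite lee_fin ltW].
- apply: emeasurable_funM; last exact: measurable_cst.
  exact: measurable_funTS.
- exact: measurable_itv.
apply: eq_integral => v; rewrite inE/= in_itv/= andbT => v0; rewrite -!EFinM; congr EFin.
have -> : K x (x * v) = G (Num.sqrt t * x) (t * (v ^+ 2 / (1 + v ^+ 2))) * gband (Num.sqrt (T - t)) (Num.sqrt t * x).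
  rewrite /K; congr (G _ (t * _) * _); field.
  by rewrite !gt_eqF// ltr_pwDl// sqr_ge0.
set c := G _ _ * gband _ _.
(* Folding each Gaussian onto the half-line gives a factor 2, and x is the Jacobian. With the 1 / (2
   pi) of [gauss_pdf_mul] the constant becomes 2 / pi. *)
transitivity (c * (4 * x * (gauss_pdf x * gauss_pdf (x * v)))); first by ring.
congr (_ * _); rewrite gauss_pdf_mul; have := @pi_gt0 R.
by generalize (@pi R) => q q0; field; rewrite gt_eqF.
Qed.

(** At t = T = 1 the band is 1 and 1 - g = 1 / (1 + v^2). Substituting y = sqrt (1 + v^2) x
    separates the variables: v keeps the density 1 / (1 + v^2), whose mass pi / 2 cancels 2 / pi and
    leaves the Rayleigh density in y. *)
Lemma meander_endpoint_law (A : set R) : measurable A ->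
  P [set w | A (`|B 1 w| / Num.sqrt (1 - g 1 w))] =
  (\int[mu]_(x in A) (rayleigh_pdf x)%:E)%E.
Proof.
move=> mA.
pose G (x s : R) : R := \1_A (x / Num.sqrt (1 - s)).
have m1A : measurable_fun setT (\1_A : R -> R) by exact: measurable_indic.
have mG : measurable_fun setT (fun z : R * R => G z.1 z.2).
  by apply: (measurableT_comp m1A); mfun.
have mev : measurable [set w | A (`|B 1 w| / Num.sqrt (1 - g 1 w))].
  have mB1 : measurable_fun setT (B 1 : Om -> R) by exact: measurable_funPT.
  have mg1 : measurable_fun setT (fun w => g 1 w) by exact: (measurable_last_zero hB ler01).
  have mX : measurable_fun setT (fun w => `|B 1 w| / Num.sqrt (1 - g 1 w)) by mfun.
  by rewrite -[X in measurable X]setTI; exact: (mX measurableT _ mA).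
have nz : P (~` [set w | no_zero 1 1 (B ^~ w)]) = 0%E.
  rewrite (_ : ~` _ = [set w | B 1 w = 0]); first exact: (brownian_atomless hB 0 ltr01).
  apply/seteqP; split => w /=.
    by move=> H; apply/eqP/negPn/negP => B0; apply: H => r /le_anti <-.
  by move=> B0 /(_ 1); rewrite lexx B0 eqxx => /(_ isT).
have mnz : measurable [set w | no_zero 1 1 (B ^~ w)].
  exact: (measurable_no_zero_le hB ltr01 (lexx 1)).
(* Absence of zeros on [1, 1] means that B_1 is not 0, which is almost sure. *)
transitivity (\int[P]_w (G `|B 1 w| (g 1 w) * \1_[set w | no_zero 1 1 (B ^~ w)] w)%:E)%E.
  rewrite (measure_integral_indic _ mev).
  apply: ae_eq_integral => //.
  - by apply/measurable_EFinP; exact: measurable_indic.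
  - apply/measurable_EFinP; apply: measurable_funM; last exact: measurable_indic.
    have mB1 : measurable_fun setT (B 1 : Om -> R) by exact: measurable_funPT.
    apply: (measurable_fun_comp2 mG); last exact: (measurable_last_zero hB ler01).
    by mfun.
  - exists (~` [set w | no_zero 1 1 (B ^~ w)]); split => //; first exact: measurableC.
    move=> w /= H nzw; apply: H => _.
    by rewrite (@indicE _ R [set w | no_zero 1 1 (B ^~ w)] w) mem_set// mulr1 /G !indicE.
rewrite (abs_last_zero_polar ltr01 (lexx 1) mG)//.
have pi0 := @pi_gt0 R.
(* The absolute value makes [k] non-negative on the whole line, as [ge0_integral_scale] requires. *)
pose k (y : R) : R := \1_A y * (2 / pi * (`|y| * expR (- (y ^+ 2 / 2)))).
have k0 y : 0 <= k y by rewrite !mulr_ge0 ?expR_ge0 ?invr_ge0 ?(ltW pi0).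
have mk : measurable_fun setT k by apply: measurable_funM => //; mfun.
pose K := (\int[mu]_(y in `]0%R, +oo[) (k y)%:E)%E.
have K0 : (0 <= K)%E by apply: integral_ge0 => y _; rewrite lee_fin.
transitivity (\int[mu]_(v in `]0%R, +oo[) (((1 + v ^+ 2)^-1)%:E * K))%E.
  apply: eq_integral => v; rewrite inE/= in_itv/= andbT => v0.
  have v1 : 0 < 1 + v ^+ 2 by rewrite ltr_pwDl// sqr_ge0.
  pose r := Num.sqrt (1 + v ^+ 2).
  have r0 : 0 < r by rewrite sqrtr_gt0.
  have r2 : r ^+ 2 = 1 + v ^+ 2 by rewrite sqr_sqrtr// ltW.
  have sv : Num.sqrt (1 - 1 * (v ^+ 2 / (1 + v ^+ 2))) = r^-1.
    rewrite (_ : 1 - _ = (1 + v ^+ 2)^-1); first by rewrite sqrtrV// ltW.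
    by field; rewrite gt_eqF.
  rewrite /K -ge0_integralZl//; first last.
  - by rewrite lee_fin invr_ge0 ltW.
  - by move=> y _; rewrite lee_fin.
  - by apply: measurable_funTS; exact/measurable_EFinP.
  rewrite [RHS](@ge0_integral_scale R r (fun y => ((1 + v ^+ 2)^-1)%:E * (k y)%:E)%E)//; last 2 first.
  - by apply: emeasurable_funM => //; exact/measurable_EFinP.
  - by move=> y; rewrite mule_ge0// lee_fin// invr_ge0 ltW.
  apply: eq_integral => x; rewrite inE/= in_itv/= andbT => x0.
  rewrite -!EFinM; congr EFin.
  rewrite subrr sqrtr0 sqrtr1 !mul1r (gband0 x0) /G -[X in 1 - X]mul1r sv invrK /k (mulrC x r) normrM (gtr0_norm r0) (gtr0_norm x0).
  rewrite exprMn r2 (mulrC (x ^+ 2)) mulr1.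
  rewrite -r2; move: pi0; generalize (@pi R) => q q0; field.
  by rewrite (gt_eqF r0) (gt_eqF q0).
rewrite ge0_integralZr//; first last.
- by move=> v _; rewrite lee_fin invr_ge0 addr_ge0// sqr_ge0.
- by apply/measurable_EFinP; apply: measurable_funTS; mfun.
rewrite integral_inv_oneDsqr /K -ge0_integralZl//; first last.
- by rewrite lee_fin divr_ge0// ltW.
- by move=> y _; rewrite lee_fin.
- by apply: measurable_funTS; exact/measurable_EFinP.
rewrite [LHS]integral_mkcond [RHS]integral_mkcond; apply: eq_integral => x _.
rewrite !epatch_indic -!EFinM; congr EFin.
have rE : rayleigh_pdf x = if 0 <= x then x * expR (- (x ^+ 2 / 2)) else 0.
  rewrite /rayleigh_pdf patchE mulNr.
  by have -> : (x \in (`[0, +oo[%classic : set R)) = (0 <= x) by rewrite mem_setE in_itv/= andbT.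
rewrite rE /k !indicE mem_setE !in_itv/= andbT.
have [x0|x0] := ltP 0 x.
  rewrite (ltW x0) (gtr0_norm x0).
  have [_|_] := boolP (x \in A); rewrite ?mul0r ?mulr0 ?mul0r// !mulr1 mul1r.
  by move: pi0; generalize (@pi R) => q q0; field; rewrite gt_eqF.
rewrite mulr0; case: ifPn => [x0'|_]; last by rewrite mul0r.
have -> : x = 0 by apply/le_anti; rewrite x0 x0'.
by rewrite mul0r mul0r.
Qed.

End PolarLaw.

(** * The meander at a uniform time *)

Section OneTimeLaw.
Context {R : realType}.
Notation N := (@normal_prob R 0 1).
Notation mu := (@lebesgue_measure R).

(** Up to the factor 2 / pi * y, the density in slope v and level y that the Brownian time t
    contributes to the occupation of the meander; see [time_law]. *)
Definition time_kernel (t v y : R) : R :=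
  t^-1 * expR (- (y ^+ 2 * (1 + v ^+ 2 * (1 - t)) / (2 * t)))
    * gband (Num.sqrt (1 - t)) (Num.sqrt (1 - t * (v ^+ 2 / (1 + v ^+ 2))) * y).

(** What remains of [time_kernel] when time is replaced by the parameter p of
    [integral_time_kernel], apart from a rational factor: the slope has disappeared. *)
Definition level_kernel (y p : R) : R := expR (- (p ^+ 2 / 2)) * gband (Num.sqrt (p ^+ 2 - y ^+ 2)) (y * p).

Lemma level_kernel_ge0 y p : 0 <= level_kernel y p.
Proof. by rewrite mulr_ge0 ?expR_ge0 ?gband_ge0. Qed.

Lemma measurable_level_kernel : measurable_fun setT (fun z : R * R => level_kernel z.1 z.2).
Proof.
apply: measurable_funM; first by mfun.
by apply: (measurable_fun_comp2 measurable_gband); mfun.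
Qed.

Lemma time_kernel_ge0 t v y : 0 <= t -> 0 <= time_kernel t v y.
Proof. by move=> t0; rewrite !mulr_ge0 ?expR_ge0 ?invr_ge0 ?gband_ge0. Qed.

Lemma measurable_time_kernel : measurable_fun setT (fun z : (R * R) * R => time_kernel z.1.1 z.1.2 z.2).
Proof.
apply: measurable_funM; first by mfun.
by apply: (measurable_fun_comp2 measurable_gband); mfun.
Qed.

(** Requiring the exponent to become p^2 / 2 forces t = y^2 (1 + v^2) / (p^2 + y^2 v^2), which maps
    p > y decreasingly onto 0 < t < 1. After rescaling, the arguments of [gband] are free of v
    too. *)
Lemma integral_time_kernel (v y : R) : 0 < v -> 0 < y ->
  (\int[mu]_(t in `]0%R, 1%R[) (time_kernel t v y)%:E =
   \int[mu]_(p in `]y, +oo[) (2 * p / (p ^+ 2 + y ^+ 2 * v ^+ 2) * level_kernel y p)%:E)%E.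
Proof.
move=> v0 y0.
pose F (p : R) := y ^+ 2 * (1 + v ^+ 2) / (p ^+ 2 + y ^+ 2 * v ^+ 2).
pose F' (p : R) := - (y ^+ 2 * (1 + v ^+ 2) * (2 * p) / (p ^+ 2 + y ^+ 2 * v ^+ 2) ^+ 2).
have y2 : 0 < y ^+ 2 by rewrite exprn_gt0.
have v2 : 0 < v ^+ 2 by rewrite exprn_gt0.
have v1 : 0 < 1 + v ^+ 2 by rewrite addr_gt0.
have D0 (p : R) : 0 < p ^+ 2 + y ^+ 2 * v ^+ 2 by rewrite ltr_wpDl ?sqr_ge0// mulr_gt0.
have F0 p : 0 < F p by rewrite divr_gt0// mulr_gt0.
have FE : F @` `]y, +oo[%classic = `]0, 1[%classic.
  apply/seteqP; split => [_ [p /=] + <-|t /=]; rewrite !in_itv/= ?andbT.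
    move=> yp; rewrite F0/= ltr_pdivrMr// mul1r mulrDr mulr1 ltrD2r.
    by rewrite ltr_pXn2r ?nnegrE ?ltW// (lt_trans y0).
  move=> /andP[t0 t1].
  pose q := y ^+ 2 * ((1 + v ^+ 2) / t - v ^+ 2).
  have yq : y ^+ 2 < q.
    rewrite /q ltr_pMr// ltrBrDr addrC -[X in X < _]mul1r mul1r [X in X < _]addrC ltr_pdivlMr//.
    by rewrite [ltRHS]addrC gtr_pMr.
  exists (Num.sqrt q); first by rewrite in_itv/= andbT -(gtr0_norm y0) -sqrtr_sqr ltr_sqrt// (lt_trans y2).
  rewrite /F sqr_sqrtr; last by rewrite ltW// (lt_trans y2).
  have -> : q + y ^+ 2 * v ^+ 2 = y ^+ 2 * (1 + v ^+ 2) / t by rewrite /q; field; rewrite gt_eqF.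
  by field; rewrite !gt_eqF.
(* [time_kernel] with |t| in its prefactor, to be non-negative on the whole line. *)
pose f (t : R) := (`|t|^-1 * expR (- (y ^+ 2 * (1 + v ^+ 2 * (1 - t)) / (2 * t)))
    * gband (Num.sqrt (1 - t)) (Num.sqrt (1 - t * (v ^+ 2 / (1 + v ^+ 2))) * y))%:E.
transitivity (\int[mu]_(t in `]0%R, 1%R[) f t)%E.
  by apply: eq_integral => t; rewrite inE/= in_itv/= => /andP[t0 _]; rewrite /f gtr0_norm.
have dF (p : R) : `]y, +oo[%classic p -> is_derive p 1 F (F' p).
  move=> _; have dD : is_derive p 1 (fun p : R => p ^+ 2 + y ^+ 2 * v ^+ 2) (2 * p).
    by apply: is_derive_eq; rewrite /GRing.scale/= ?mulr1 ?addr0 ?expr1; ring.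
  have D0' : p ^+ 2 + y ^+ 2 * v ^+ 2 != 0 by rewrite gt_eqF.
  have := is_deriveZ (y ^+ 2 * (1 + v ^+ 2)) (@is_deriveV R _ p _ 1 D0' dD).
  rewrite (_ : _ \*: _ = F)// (_ : _ *: _ = F' p)//.
  rewrite -[LHS]/(y ^+ 2 * (1 + v ^+ 2) * (- (p ^+ 2 + y ^+ 2 * v ^+ 2) ^- 2 * (2 * p))) /F'.
  by rewrite mulNr mulrN; congr (- _); rewrite -mulrA [_ * (2 * p)]mulrC.
have cF' (p : R) : `]y, +oo[%classic p -> {for p, continuous F'}.
  move=> _; have cD : {for p, continuous (fun p : R => (p ^+ 2 + y ^+ 2 * v ^+ 2) ^+ 2)}.
    by apply: differentiable_continuous; apply/derivable1_diffP; apply: ex_derive.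
  apply: cvgN; apply: cvgM; last by apply: cvgV; [rewrite gt_eqF// exprn_gt0|exact: cD].
  have c1 : {for p, continuous (fun p : R => y ^+ 2 * (1 + v ^+ 2) * (2 * p))}.
    by apply: differentiable_continuous; apply/derivable1_diffP; apply: ex_derive.
  exact: c1.
have F'0 (p : R) : `]y, +oo[%classic p -> F' p < 0.
  rewrite /= in_itv/= andbT => yp; rewrite oppr_lt0 divr_gt0 ?exprn_gt0// !mulr_gt0//.
  exact: lt_trans yp.
have mFE : measurable (F @` `]y, +oo[%classic : set (measurableTypeR R)).
  by rewrite FE; exact: measurable_itv.
have mf : measurable_fun setT f.
  apply/measurable_EFinP; apply: measurable_funM; first by mfun.
  by apply: (measurable_fun_comp2 measurable_gband); mfun.
have f0 t : (0 <= f t)%E by rewrite lee_fin !mulr_ge0 ?expR_ge0 ?invr_ge0 ?gband_ge0.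
have oy : open (`]y, +oo[%classic : set R) by exact: interval_open.
have iy : is_interval (`]y, +oo[%classic : set R) by exact: interval_is_interval.
have := ge0_integral_image_decreasing oy iy dF cF' F'0 mFE mf f0.
rewrite FE => ->.
have key (p : R) : y < p -> f (F p) = ((F p)^-1 * level_kernel y p)%:E /\ (F p)^-1 * - F' p = 2 * p / (p ^+ 2 + y ^+ 2 * v ^+ 2).
  move=> yp; have p0 : 0 < p by exact: lt_trans yp.
  have Dp := D0 p; have Fp := F0 p; have Dp' : 0 < p ^+ 2 + (y * v) ^+ 2 by rewrite exprMn.
  have py : y ^+ 2 < p ^+ 2 by rewrite ltr_pXn2r ?nnegrE ?ltW.
  split; last by rewrite /F' /F opprK; field; rewrite !gt_eqF.
  rewrite /f; congr EFin; rewrite (gtr0_norm Fp).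
  set c := Num.sqrt (p ^+ 2 + y ^+ 2 * v ^+ 2).
  have c0 : 0 < c by rewrite sqrtr_gt0.
  have s1 : Num.sqrt (1 - F p) = c^-1 * Num.sqrt (p ^+ 2 - y ^+ 2).
    have -> : 1 - F p = (p ^+ 2 + y ^+ 2 * v ^+ 2)^-1 * (p ^+ 2 - y ^+ 2).
      by rewrite /F; field; rewrite gt_eqF.
    by rewrite sqrtrM ?invr_ge0 ?(ltW Dp)// sqrtrV ?(ltW Dp).
  have s2 : Num.sqrt (1 - F p * (v ^+ 2 / (1 + v ^+ 2))) * y = c^-1 * (y * p).
    have -> : 1 - F p * (v ^+ 2 / (1 + v ^+ 2)) = (p ^+ 2 + y ^+ 2 * v ^+ 2)^-1 * p ^+ 2.
      by rewrite /F; field; rewrite !gt_eqF.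
    rewrite sqrtrM ?invr_ge0 ?(ltW Dp)// sqrtrV ?(ltW Dp)// sqrtr_sqr (gtr0_norm p0) -/c.
    by rewrite -mulrA (mulrC p).
  rewrite s1 s2 gband_scale ?invr_gt0// /level_kernel.
  have -> : y ^+ 2 * (1 + v ^+ 2 * (1 - F p)) / (2 * F p) = p ^+ 2 / 2.
    by rewrite /F; field; rewrite !gt_eqF.
  by rewrite mulrA.
apply: eq_integral => p; rewrite inE/= in_itv/= andbT => yp.
have [-> <-] := key p yp.
by rewrite -!EFinM mulrAC.
Qed.

(** After the exchange of integrals, v = (p / y) w isolates the factor 1 / (1 + w^2), whose integral
    pi / 2 produces pi / y. *)
Lemma integral_level_kernel_v (y : R) : 0 < y ->
  (\int[mu]_(v in `]0%R, +oo[) \int[mu]_(t in `]0%R, 1%R[) (time_kernel t v y)%:E =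
   (pi / y)%:E * \int[mu]_(p in `]y, +oo[) (level_kernel y p)%:E)%E.
Proof.
move=> y0.
have pi0 := @pi_gt0 R.
have D0 (p v : R) : 0 < p -> 0 < p ^+ 2 + y ^+ 2 * v ^+ 2.
  by move=> p0; rewrite ltr_pwDl ?exprn_gt0// mulr_ge0 ?sqr_ge0.
have mlk (p : R) : measurable_fun setT (fun z : R => (level_kernel y z)).
  exact: (measurableT_comp measurable_level_kernel (measurable_pair1 y)).
transitivity (\int[mu]_(v in `]0%R, +oo[) \int[mu]_(p in `]y, +oo[)
   (2 * p / (p ^+ 2 + y ^+ 2 * v ^+ 2) * level_kernel y p)%:E)%E.
  by apply: eq_integral => v; rewrite inE/= in_itv/= andbT => v0; exact: integral_time_kernel.
rewrite integral_swap//; first last.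
- move=> v p; rewrite /= !in_itv/= !andbT => v0 yp.
  by rewrite lee_fin mulr_ge0 ?level_kernel_ge0// divr_ge0 ?mulr_ge0 ?ltW ?D0// (lt_trans y0).
- apply/measurable_EFinP; apply: measurable_funM; first by mfun.
  by apply: (measurable_fun_comp2 measurable_level_kernel); mfun.
rewrite -ge0_integralZl//; first last.
- by rewrite lee_fin divr_ge0// ltW.
- by move=> p _; rewrite lee_fin level_kernel_ge0.
- by apply: measurable_funTS; apply/measurable_EFinP; exact: mlk.
have key (p w : R) : 0 < p -> 2 * p / (p ^+ 2 + y ^+ 2 * (p / y * w) ^+ 2) * level_kernel y p * (p / y) =
    (1 + w ^+ 2)^-1 * (2 / y * level_kernel y p).
  move=> p0; have w1 : 0 < 1 + w ^+ 2 by rewrite ltr_pwDl// sqr_ge0.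
  have := D0 p (p / y * w) p0.
  rewrite (_ : p ^+ 2 + _ = p ^+ 2 * (1 + w ^+ 2)); last by field; rewrite gt_eqF.
  by generalize (level_kernel y p) => c D1; field; rewrite !gt_eqF.
apply: eq_integral => p; rewrite inE/= in_itv/= andbT => yp.
have p0 : 0 < p := lt_trans y0 yp.
have k0 : 0 < p / y by rewrite divr_gt0.
rewrite (@ge0_integral_scale R (p / y) (fun v => (2 * p / (p ^+ 2 + y ^+ 2 * v ^+ 2) * level_kernel y p)%:E) k0); last 2 first.
- by apply/measurable_EFinP; mfun.
- by move=> v; rewrite lee_fin mulr_ge0 ?level_kernel_ge0// divr_ge0 ?mulr_ge0 ?ltW ?D0.
transitivity (\int[mu]_(w in `]0%R, +oo[) (((1 + w ^+ 2)^-1)%:E * (2 / y * level_kernel y p)%:E))%E.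
  by apply: eq_integral => w _; rewrite -!EFinM (key p w p0).
rewrite ge0_integralZr//; first last.
- by rewrite lee_fin mulr_ge0 ?level_kernel_ge0// divr_ge0// ltW.
- by move=> v _; rewrite lee_fin invr_ge0 addr_ge0// sqr_ge0.
- by apply/measurable_EFinP; apply: measurable_funTS; mfun.
rewrite integral_inv_oneDsqr -!EFinM; congr EFin.
move: pi0 p0 yp k0; generalize (@pi R) => q q0 p0 yp k0; rewrite mulrA; congr (_ * _).
by field; rewrite gt_eqF.
Qed.

Lemma integral_gauss_pdf : (\int[mu]_x (gauss_pdf x)%:E = 1)%E.
Proof.
have m1 : measurable_fun setT (fun _ : R => 1%E : \bar R) by exact: measurable_cst.
have e1 : (\int[N]_(x in setT) cst 1%E x = 1)%E.
  by rewrite integral_cst// mul1e; exact: (probability_setT N).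
rewrite -e1 (integral_gauss m1 (fun _ => lee01)).
by apply: eq_integral => x _; rewrite mul1e.
Qed.

Lemma integral_exp_sqr (z : R) : 0 < z ->
  (\int[mu]_w (expR (- (z ^+ 2 * w ^+ 2 / 2)))%:E = (Num.sqrt (2 * pi) / z)%:E)%E.
Proof.
move=> z0; set c := Num.sqrt (2 * pi).
have c0 : 0 < c by rewrite sqrtr_gt0 mulr_gt0// pi_gt0.
have mg := @measurable_gauss_pdf R.
transitivity (\int[mu]_w ((c / z)%:E * ((gauss_pdf (z * w + 0))%:E * `|z|%:E)))%E.
  apply: eq_integral => w _; rewrite -!EFinM; congr EFin.
  rewrite /gauss_pdf -/c (gtr0_norm z0) addr0 exprMn mulNr; field.
  by rewrite !gt_eqF.
rewrite ge0_integralZl//; first last.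
- by rewrite lee_fin divr_ge0// ltW.
- by move=> w _; rewrite -EFinM lee_fin mulr_ge0// ltW// gauss_pdf_gt0.
- apply: emeasurable_funM => //; apply/measurable_EFinP.
  by apply: (measurableT_comp mg (g := fun w => z * w + 0)); mfun.
have z1 : z != 0 by rewrite gt_eqF.
have mgE : measurable_fun setT (fun x : R => (gauss_pdf x)%:E) by exact/measurable_EFinP.
have g0 (x : R) : (0 <= (gauss_pdf x)%:E)%E by rewrite lee_fin ltW// gauss_pdf_gt0.
have <- := @ge0_integral_affine R z 0 (fun x => (gauss_pdf x)%:E) z1 mgE g0.
by rewrite integral_gauss_pdf mule1.
Qed.

(** Substitute w = v - 1 / v, which maps the half-line onto the line with derivative 1 + v^(-2), and
    use (v + 1 / v)^2 = w^2 + 4. *)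
Lemma integral_exp_hyperbolic (z : R) : 0 < z ->
  (\int[mu]_(v in `]0%R, +oo[) ((1 + v ^- 2) * expR (- (((1 + v ^+ 2) / v) ^+ 2 * z ^+ 2 / 2)))%:E =
   (Num.sqrt (2 * pi) / z * expR (- (2 * z ^+ 2)))%:E)%E.
Proof.
move=> z0.
pose F (v : R) := v - v^-1; pose F' (v : R) := 1 + v ^- 2.
have FT : F @` `]0, +oo[%classic = setT.
  rewrite -subTset => w _ /=.
  have s0 : 0 < Num.sqrt (w ^+ 2 + 4) + w.
    rewrite -ltrBlDr sub0r; apply: (le_lt_trans (ler_norm _)).
    rewrite normrN -sqrtr_sqr ltr_sqrt ?ltr_pwDr//.
    by rewrite sqr_ge0.
  have s2 : Num.sqrt (w ^+ 2 + 4) ^+ 2 = w ^+ 2 + 4 by rewrite sqr_sqrtr// addr_ge0 ?sqr_ge0.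
  (* The positive root of v^2 - w v - 1 = 0. *)
  exists ((Num.sqrt (w ^+ 2 + 4) + w) / 2); first by rewrite in_itv/= andbT divr_gt0.
  move: s0 s2; rewrite /F; generalize (Num.sqrt (w ^+ 2 + 4)) => s s0 s2.
  rewrite (_ : (s + w) / 2 - _ = (s ^+ 2 + 2 * s * w + w ^+ 2 - 4) / (2 * (s + w))).
    by rewrite s2; field; rewrite gt_eqF.
  by field; rewrite gt_eqF.
have o0 : open (`]0, +oo[%classic : set R) by exact: interval_open.
have i0 : is_interval (`]0, +oo[%classic : set R) by exact: interval_is_interval.
have dF (v : R) : `]0, +oo[%classic v -> is_derive v 1 F (F' v).
  rewrite /= in_itv/= andbT => v0.
  have v1 : v != 0 by rewrite gt_eqF.
  have dV := @is_deriveV R id v 1 1 v1 (@is_derive_id _ _ v 1).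
  have := is_deriveB (@is_derive_id _ _ v 1) dV.
  rewrite (_ : id - _ = F)// (_ : 1 - _ = F' v)//.
  by rewrite /F' scaleNr opprK /GRing.scale/= mulr1.
have cF' (v : R) : `]0, +oo[%classic v -> {for v, continuous F'}.
  rewrite /= in_itv/= andbT => v0.
  apply: cvgD; first exact: cvg_cst.
  have cD : {for v, continuous (fun v : R => v ^+ 2)} by exact: exprn_continuous.
  by apply: cvgV; [rewrite gt_eqF// exprn_gt0|exact: cD].
have F'0 (v : R) : `]0, +oo[%classic v -> 0 < F' v.
  by rewrite /= in_itv/= andbT => v0; rewrite ltr_pwDl// invr_ge0 exprn_ge0// ltW.
pose f (w : R) := (expR (- (z ^+ 2 * w ^+ 2 / 2)) * expR (- (2 * z ^+ 2)))%:E.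
have mf : measurable_fun setT f by apply/measurable_EFinP; mfun.
have f0 w : (0 <= f w)%E by rewrite lee_fin mulr_ge0 ?expR_ge0.
have := ge0_integral_image_increasing o0 i0 dF cF' F'0 mf f0.
rewrite FT => H.
transitivity (\int[mu]_w f w)%E.
  rewrite H; apply: eq_integral => v; rewrite inE/= in_itv/= andbT => v0.
  rewrite /f -EFinM mulrC; congr (_ * _)%:E.
  by rewrite -expRD /F; congr expR; field; rewrite gt_eqF.
rewrite /f; under eq_integral do rewrite EFinM.
rewrite ge0_integralZr//; first last.
- by apply/measurable_EFinP; mfun.
by rewrite integral_exp_sqr// -EFinM.
Qed.

(** The complement of the band is a p <= b |Z|; writing |Z| = p v removes the factor p from the
    condition and moves it to the density. *)
Lemma gband_compl (b a p : R) : 0 <= b -> 0 < p ->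
  ((1 - gband b (a * p))%:E =
   \int[mu]_(v in `]0%R, +oo[) (\1_[set v | a <= b * v] v * (2 * gauss_pdf (p * v) * p))%:E)%E.
Proof.
move=> b0 p0.
have mband := measurable_band b (a * p).
have mg := @measurable_gauss_pdf R.
pose C := [set x : R | a * p <= `|b * x|].
have CE : C = ~` [set y | `|b * y| < a * p].
  by apply/seteqP; split => x; rewrite /C/= leNgt => /negP.
have mC : measurable (C : set (measurableTypeR R)) by rewrite CE; exact: measurableC.
have mC' : measurable (C : set R) by exact: mC.
have m1C : measurable_fun setT (fun x : R => (\1_C x : R)%:E).
  by apply/measurable_EFinP; exact: measurable_indic.
have C0 (x : R) : (0 <= (\1_C x : R)%:E)%E by rewrite lee_fin.
transitivity (\int[N]_x (\1_C (`|x|) : R)%:E)%E.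
  rewrite EFinB gbandE /gauss_band -(probability_setC N mband) -CE.
  rewrite (measure_integral_indic N mC).
  apply: eq_integral => x _; rewrite !indicE; congr ((nat_of_bool _)%:R%:E).
  by apply/idP/idP => /set_mem H; apply/mem_set; move: H; rewrite /C/= !normrM normr_id.
rewrite (integral_gauss_abs m1C C0).
have mf : measurable_fun setT (fun x : R => (\1_C x : R)%:E * (2 * gauss_pdf x)%:E)%E.
  by apply: emeasurable_funM => //; apply/measurable_EFinP; exact: measurable_funM.
have f0 (x : R) : (0 <= (\1_C x : R)%:E * (2 * gauss_pdf x)%:E)%E.
  by rewrite mule_ge0// lee_fin mulr_ge0// ltW// gauss_pdf_gt0.
rewrite (ge0_integral_scale p0 mf f0).
apply: eq_integral => v; rewrite inE/= in_itv/= andbT => v0.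
rewrite -!EFinM -mulrA; congr (_ * _)%:E; rewrite !indicE; congr ((nat_of_bool _)%:R).
have bE : (a * p <= `|b * (p * v)|) = (a <= b * v).
  rewrite ger0_norm; last by apply: mulr_ge0 => //; apply: mulr_ge0; exact: ltW.
  by rewrite mulrCA mulrC ler_pM2l.
by apply/idP/idP => /set_mem H; apply/mem_set; move: H; rewrite /C/= bE.
Qed.

(** Both sides amount to y^2 (1 + v^2) <= p^2 v^2, which forces y < p. The slice at fixed v is thus
    a half-line in p. *)
Lemma level_slice (y v p : R) : 0 < y -> 0 < v -> 0 < p ->
  (y < p) && (y - Num.sqrt (p ^+ 2 - y ^+ 2) * v <= 0) = (y * Num.sqrt (1 + v ^+ 2) / v <= p).
Proof.
move=> y0 v0 p0.
have v1 : 0 < 1 + v ^+ 2 by rewrite ltr_pwDl// sqr_ge0.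
set a := y * _ / v.
have a0 : 0 < a by rewrite divr_gt0// mulr_gt0// sqrtr_gt0.
have a2 : a ^+ 2 = y ^+ 2 * (1 + v ^+ 2) / v ^+ 2.
  by rewrite /a expr_div_n exprMn sqr_sqrtr// ltW.
have -> : (a <= p) = (y ^+ 2 * (1 + v ^+ 2) <= p ^+ 2 * v ^+ 2).
  by rewrite -(@ler_pXn2r R 2 isT a p (ltW a0) (ltW p0)) a2 ler_pdivrMr// exprn_gt0.
rewrite subr_le0; apply/andP/idP => [[yp]|H].
  have py : 0 < p ^+ 2 - y ^+ 2 by rewrite subr_gt0 ltr_pXn2r ?nnegrE ?ltW.
  have s0 : 0 <= Num.sqrt (p ^+ 2 - y ^+ 2) * v by rewrite mulr_ge0// ltW.
  have <- := @ler_pXn2r R 2 isT _ _ (ltW y0) s0.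
  by rewrite exprMn sqr_sqrtr ?(ltW py)// mulrBl mulrDr mulr1 lerBrDr.
have yp : y < p.
  rewrite -(@ltr_pXn2r R 2 isT _ _ (ltW y0) (ltW p0)).
  rewrite -(ltr_pM2r (exprn_gt0 2 v0)); apply: lt_le_trans H.
  by rewrite mulrDr mulr1 ltrDr exprn_gt0.
have py : 0 < p ^+ 2 - y ^+ 2 by rewrite subr_gt0 ltr_pXn2r ?nnegrE ?ltW.
have s0 : 0 <= Num.sqrt (p ^+ 2 - y ^+ 2) * v by rewrite mulr_ge0// ltW.
split => //; have <- := @ler_pXn2r R 2 isT _ _ (ltW y0) s0.
by rewrite exprMn sqr_sqrtr ?(ltW py)// mulrBl lerBrDr -[X in X + _]mulr1 -mulrDr.
Qed.

(** Write the complement of the band as an integral over v and integrate p first: the tail from y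
    sqrt (1 + v^2) / v is exp (- (v + 1 / v)^2 y^2 / 2) / (1 + v^2), up to a constant. Read as a
    tail integral over z > y, it brings the v-integral to the form of [integral_exp_hyperbolic],
    leaving 2 exp (- 2 z^2). The final substitution u = 2 z is the origin of the bound 2 y. *)
Lemma integral_level_kernel_compl (y : R) : 0 < y ->
  (\int[mu]_(p in `]y, +oo[) (expR (- (p ^+ 2 / 2)) - level_kernel y p)%:E =
   \int[mu]_(u in `](2 * y)%R, +oo[) (expR (- (u ^+ 2 / 2)))%:E)%E.
Proof.
move=> y0; have pi0 := @pi_gt0 R.
pose c := Num.sqrt (2 * pi) : R.
have c0 : 0 < c by rewrite sqrtr_gt0 mulr_gt0.
have y2 : 0 < y ^+ 2 by rewrite exprn_gt0.
have mg := @measurable_gauss_pdf R.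
have v1 (v : R) : 0 < 1 + v ^+ 2 by rewrite ltr_pwDl// sqr_ge0.
pose I : set (R * R) := [set z | y - Num.sqrt (z.1 ^+ 2 - y ^+ 2) * z.2 <= 0].
have mI : measurable I by apply: measurable_set_le; mfun.
have m1I : measurable_fun setT (\1_I : R * R -> R) by exact: measurable_indic.
pose f (p v : R) : R := expR (- (p ^+ 2 / 2)) * (\1_I (p, v) * (2 * gauss_pdf (p * v) * p)).
have f0 p v : 0 <= p -> 0 <= f p v.
  by move=> p0; rewrite !mulr_ge0 ?expR_ge0// ltW// gauss_pdf_gt0.
have mf : measurable_fun setT (fun z : R * R => f z.1 z.2).
  apply: measurable_funM; first by mfun.
  apply: measurable_funM.
    by apply: (measurableT_comp m1I (g := fun z : R * R => (z.1, z.2))); apply/measurable_fun_pair.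
  apply: measurable_funM => //; apply: measurable_funM => //.
  by apply: (measurableT_comp mg); mfun.
transitivity (\int[mu]_(p in `]y, +oo[) \int[mu]_(v in `]0%R, +oo[) (f p v)%:E)%E.
  apply: eq_integral => p; rewrite inE/= in_itv/= andbT => yp.
  have p0 : 0 < p := lt_trans y0 yp.
  transitivity ((expR (- (p ^+ 2 / 2)))%:E * (1 - gband (Num.sqrt (p ^+ 2 - y ^+ 2)) (y * p))%:E)%E.
    by rewrite -EFinM mulrBr mulr1.
  rewrite gband_compl// -ge0_integralZl//; first last.
  - by move=> v _; rewrite lee_fin !mulr_ge0 ?(ltW p0)// ltW// gauss_pdf_gt0.
  - apply: measurable_funTS; apply/measurable_EFinP; apply: measurable_funM.
      have mv : measurable [set v : R | y <= Num.sqrt (p ^+ 2 - y ^+ 2) * v].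
        rewrite (_ : [set v | _] = [set v : R | y - Num.sqrt (p ^+ 2 - y ^+ 2) * v <= 0]).
          by apply: measurable_set_le; mfun.
        by apply/seteqP; split => v /=; rewrite subr_le0.
      exact: measurable_indic mv.
    apply: measurable_funM => //; apply: measurable_funM => //.
    by apply: (measurableT_comp mg); mfun.
  apply: eq_integral => v _; rewrite -EFinM /f; congr (_ * (_ * _))%:E.
  rewrite !indicE; congr ((nat_of_bool _)%:R).
  by apply/idP/idP => /set_mem H; apply/mem_set; move: H; rewrite /I/= subr_le0.
rewrite integral_swap//; first last.
- by move=> p v; rewrite /= !in_itv/= !andbT => yp _; rewrite lee_fin f0// ltW// (lt_trans y0).
- exact/measurable_EFinP.
pose m (v : R) : R := (1 + v ^+ 2) / v.
have mE (v : R) : 0 < v -> (1 + v ^+ 2)^-1 = (1 + v ^- 2) * m v ^- 2.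
  by move=> v0; have v1' := v1 v; rewrite /m; field; rewrite !gt_eqF.
(* The new tail starts at y for every v, unlike the tail in p, so v can be integrated next. *)
transitivity (\int[mu]_(v in `]0%R, +oo[) \int[mu]_(z in `]y, +oo[)
   (2 / c * z * ((1 + v ^- 2) * expR (- (m v ^+ 2 * z ^+ 2 / 2))))%:E)%E.
  apply: eq_integral => v; rewrite inE/= in_itv/= andbT => v0.
  pose a := y * Num.sqrt (1 + v ^+ 2) / v.
  have a0 : 0 < a by rewrite divr_gt0// mulr_gt0// sqrtr_gt0.
  have a2 : a ^+ 2 = y ^+ 2 * (1 + v ^+ 2) / v ^+ 2.
    by rewrite /a expr_div_n exprMn sqr_sqrtr// ltW.
  have m0 : 0 < m v by rewrite divr_gt0.
  transitivity (\int[mu]_(p in `[a, +oo[) ((2 / c)%:E * (p * expR (- ((1 + v ^+ 2) * p ^+ 2 / 2)))%:E))%E.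
    have ap (p : R) (p0 : 0 < p) := level_slice y0 v0 p0; rewrite -/a in ap.
    rewrite [LHS]integral_mkcond [RHS]integral_mkcond; apply: eq_integral => p _.
    rewrite !patchE !mem_setE !in_itv/= !andbT.
    have [p0|p0] := ltP 0 p; last first.
      by rewrite !ifF//; apply/negbTE; rewrite -?leNgt -?ltNge ?(le_trans p0) ?(le_lt_trans p0)// ltW.
    rewrite -ap//; case: ltP => //= yp.
    rewrite /f /gauss_pdf -/c indicE; have -> : ((p, v) \in I) = (y - Num.sqrt (p ^+ 2 - y ^+ 2) * v <= 0).
      by apply/idP/idP => [/set_mem|H]; [|apply/mem_set].
    case: ifP => _; last by rewrite mul0r mulr0.
    rewrite -EFinM; congr EFin; rewrite mul1r.
    rewrite (_ : - ((1 + v ^+ 2) * p ^+ 2 / 2) = - (p ^+ 2 / 2) + - (p * v) ^+ 2 / 2); last by field.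
    by rewrite expRD; field; rewrite gt_eqF.
  rewrite ge0_integralZl//; first last.
  - by rewrite lee_fin divr_ge0// ltW.
  - move=> p; rewrite /= in_itv/= andbT => ap; rewrite lee_fin mulr_ge0 ?expR_ge0//.
    by rewrite (le_trans (ltW a0)).
  - by apply: measurable_funTS; apply/measurable_EFinP; mfun.
  rewrite -integral_itv_obnd_cbnd; last by apply: measurable_funTS; apply/measurable_EFinP; mfun.
  rewrite (integral_exp_tail (ltW a0) (v1 v)).
  transitivity (\int[mu]_(z in `]y, +oo[) ((2 / c * (1 + v ^- 2))%:E * (z * expR (- (m v ^+ 2 * z ^+ 2 / 2)))%:E))%E; last first.
    by apply: eq_integral => z _; rewrite -EFinM; congr EFin; ring.
  have v2 : 0 < v ^- 2 by rewrite invr_gt0 exprn_gt0.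
  rewrite ge0_integralZl//; first last.
  - by rewrite lee_fin mulr_ge0 ?divr_ge0 ?addr_ge0 ?(ltW v2) ?(ltW c0).
  - move=> z; rewrite /= in_itv/= andbT => yz; rewrite lee_fin mulr_ge0 ?expR_ge0//.
    by rewrite ltW// (lt_trans y0).
  - by apply: measurable_funTS; apply/measurable_EFinP; mfun.
  rewrite (integral_exp_tail (ltW y0) (exprn_gt0 2 m0)) -!EFinM; congr EFin.
  rewrite (_ : (1 + v ^+ 2) * a ^+ 2 = m v ^+ 2 * y ^+ 2); last first.
    by rewrite a2 /m; field; rewrite gt_eqF.
  by rewrite -(mulrA (2 / c)) (mulrA (1 + v ^- 2)) -(mE v v0).
rewrite integral_swap//; first last.
- move=> v z; rewrite /= !in_itv/= !andbT => v0 yz.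
  have v2 : 0 < v ^- 2 by rewrite invr_gt0 exprn_gt0.
  have z0 : 0 < z := lt_trans y0 yz.
  rewrite lee_fin; apply: mulr_ge0; first by rewrite ltW// mulr_gt0// divr_gt0.
  by rewrite mulr_ge0 ?expR_ge0// addr_ge0// ltW.
- by apply/measurable_EFinP; rewrite /m; mfun.
have mh (z : R) : measurable_fun setT (fun v : R => ((1 + v ^- 2) * expR (- (m v ^+ 2 * z ^+ 2 / 2)))%:E).
  by apply/measurable_EFinP; rewrite /m; mfun.
transitivity (\int[mu]_(z in `]y, +oo[) (2 * expR (- (2 * z ^+ 2)))%:E)%E.
  apply: eq_integral => z; rewrite inE/= in_itv/= andbT => yz.
  have z0 : 0 < z := lt_trans y0 yz.
  under eq_integral do rewrite EFinM.
  rewrite ge0_integralZl//; first last.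
  - by rewrite lee_fin ltW// mulr_gt0// divr_gt0.
  - move=> v; rewrite /= in_itv/= andbT => v0; have v2 : 0 < v ^- 2 by rewrite invr_gt0 exprn_gt0.
    by rewrite lee_fin mulr_ge0 ?expR_ge0// addr_ge0// ltW.
  - exact: measurable_funTS (mh z).
  rewrite /m integral_exp_hyperbolic// -EFinM; congr EFin; rewrite -/c.
  by generalize (expR (- (2 * z ^+ 2))) => e; field; rewrite !gt_eqF.
pose g (u : R) : R := \1_`]2 * y, +oo[%classic u * expR (- (u ^+ 2 / 2)).
have mg' : measurable_fun setT (fun u => (g u)%:E).
  apply/measurable_EFinP; apply: measurable_funM; last by mfun.
  by apply: measurable_indic; exact: measurable_itv.
have g0 u : (0 <= (g u)%:E)%E by rewrite lee_fin mulr_ge0 ?expR_ge0.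
have gE (h : R -> R) (b : R) : 0 < b -> (\int[mu]_(z in `]b, +oo[) (h z)%:E = \int[mu]_(z in `]0%R, +oo[) (\1_`]b, +oo[%classic z * h z)%:E)%E.
  move=> b0; rewrite [LHS]integral_mkcond [RHS]integral_mkcond; apply: eq_integral => z _.
  rewrite !patchE indicE !mem_setE !in_itv/= !andbT.
  have [bz|_] := ltP b z; first by rewrite (lt_trans b0 bz) mul1r.
  by rewrite mul0r if_same.
rewrite [RHS]gE ?mulr_gt0// [LHS]gE// (ge0_integral_scale (ltr0n _ 2 : 0 < 2 :> R) mg' g0).
apply: eq_integral => z _; rewrite -EFinM /g; congr EFin.
rewrite !indicE !mem_setE !in_itv/= !andbT ltr_pM2l// -mulrA (mulrC 2).
by congr (_ * (expR _ * _)); field.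
Qed.

(** By [integral_level_kernel_compl] the Gaussian tail from y is this integral plus the tail from 2
    y. The tails are finite, and subtracting them leaves the segment from y to 2 y. *)
Lemma integral_level_kernel (y : R) : 0 < y ->
  (\int[mu]_(p in `]y, +oo[) (level_kernel y p)%:E =
   \int[mu]_(z in `[y, (2 * y)%R]) (expR (- z ^+ 2 / 2))%:E)%E.
Proof.
move=> y0.
pose e (z : R) : R := expR (- (z ^+ 2 / 2)).
have me : measurable_fun setT (fun z => (e z)%:E) by apply/measurable_EFinP; rewrite /e; mfun.
have e0 z : (0 <= (e z)%:E)%E by rewrite lee_fin expR_ge0.
have Tfin (a : R) : (\int[mu]_(z in `]a, +oo[) (e z)%:E)%E \is a fin_num.
  rewrite ge0_fin_numE; last by apply: integral_ge0.
  apply: (@le_lt_trans _ _ (\int[mu]_z (e z)%:E)%E).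
    by apply: ge0_subset_integral => //; exact: measurable_itv.
  have := integral_exp_sqr ltr01.
  under eq_integral do rewrite expr1n mul1r.
  by rewrite /e => ->; exact: ltry.
have y2 : y <= 2 * y by rewrite ler_peMl ?ltW// ltr1n.
have mlk : measurable_fun setT (fun z : R => (level_kernel y z)%:E).
  by apply/measurable_EFinP; exact: (measurableT_comp measurable_level_kernel (measurable_pair1 y)).
have mB : measurable_fun setT (fun z : R => (e z - level_kernel y z)%:E).
  by apply/measurable_EFinP; apply: measurable_funB; exact/measurable_EFinP.
have E1 : (\int[mu]_(p in `]y, +oo[) (e p)%:E = \int[mu]_(p in `]y, +oo[) (level_kernel y p)%:E +
     \int[mu]_(u in `](2 * y)%R, +oo[) (e u)%:E)%E.
  rewrite -integral_level_kernel_compl// -ge0_integralD//.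
  - by apply: eq_integral => p _; rewrite -EFinD addrC subrK.
  - by move=> p _; rewrite lee_fin level_kernel_ge0.
  - exact: measurable_funTS.
  - by move=> p _; rewrite lee_fin subr_ge0 /level_kernel ler_piMr ?expR_ge0 ?gband_le1.
  - exact: (measurable_funTS mB).
have E2 : (\int[mu]_(p in `]y, +oo[) (e p)%:E = \int[mu]_(z in `]y, (2 * y)%R]) (e z)%:E +
     \int[mu]_(u in `](2 * y)%R, +oo[) (e u)%:E)%E.
  rewrite -ge0_integral_setU//.
  - congr (integral _ _ _); apply/seteqP; split => z; rewrite /setU/= !in_itv/= !andbT.
      by move=> yz; have [z2|z2] := leP z (2 * y); [left; rewrite yz|right].
    by move=> [/andP[]//|]; exact: le_lt_trans.
  - exact: measurable_funTS.
  - rewrite disj_set2E; apply/eqP/seteqP; split => // z [] /=; rewrite !in_itv/= andbT => /andP[_ z2].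
    by rewrite ltNge z2.
have E3 : (\int[mu]_(p in `]y, +oo[) (level_kernel y p)%:E = \int[mu]_(z in `]y, (2 * y)%R]) (e z)%:E)%E.
  have f2 := Tfin (2 * y); move: E1; rewrite E2 => /(congr1 (fun x => x - \int[mu]_(u in `](2 * y)%R, +oo[) (e u)%:E)%E).
  by rewrite !addeK.
rewrite E3 integral_itv_obnd_cbnd; last exact: measurable_funTS.
by apply: eq_integral => z _; rewrite /e mulNr.
Qed.

End OneTimeLaw.

Section OccupationLaw.
Context {R : realType} {d : measure_display} {Om : measurableType d}.
Variables (P : probability Om R) (B : R -> {RV P >-> R}).
Hypothesis hB : brownian_motion P B.
Notation mu := (@lebesgue_measure R).
Local Notation g t w := (last_zero_upto t (B ^~ w)).

Let pi0 : 0 < pi :> R. Proof. exact: pi_gt0. Qed.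

(** [k] is chosen so that at the polar variable x = k y the meander value |B_t| / sqrt (1 - g_t) is
    y. The last identity collects the weight 1 / (1 - g_t), the polar density and the Jacobian k. *)
Lemma time_substitution (t v y : R) : 0 < t -> t < 1 ->
  let s := t * (v ^+ 2 / (1 + v ^+ 2)) in let k := Num.sqrt (1 - s) / Num.sqrt t in
  [/\ 0 < 1 - s, 0 < k, Num.sqrt t * (k * y) = Num.sqrt (1 - s) * y &
   (1 - s)^-1 * (k * y * expR (- ((k * y) ^+ 2 * (1 + v ^+ 2) / 2))) * k =
   y * (t^-1 * expR (- (y ^+ 2 * (1 + v ^+ 2 * (1 - t)) / (2 * t))))].
Proof.
move=> t0 t1 s k.
have v1 : 0 < 1 + v ^+ 2 by rewrite ltr_pwDl// sqr_ge0.
have sE : 1 - s = (1 + v ^+ 2 * (1 - t)) / (1 + v ^+ 2) by rewrite /s; field; rewrite gt_eqF.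
have s1 : 0 < 1 - s.
  by rewrite sE divr_gt0// ltr_pwDl// mulr_ge0 ?sqr_ge0// subr_ge0 ltW.
have rt0 : 0 < Num.sqrt t by rewrite sqrtr_gt0.
have k0 : 0 < k by rewrite divr_gt0// sqrtr_gt0.
have k2 : k ^+ 2 = (1 - s) / t by rewrite expr_div_n !sqr_sqrtr ?ltW.
split => //; first by rewrite /k; field; rewrite gt_eqF.
have E : (k * y) ^+ 2 * (1 + v ^+ 2) / 2 = y ^+ 2 * (1 + v ^+ 2 * (1 - t)) / (2 * t).
  by rewrite exprMn k2 sE; field; rewrite !gt_eqF.
have kk : (1 - s)^-1 * k ^+ 2 = t^-1.
  by rewrite k2; move: s1; generalize (1 - s) => r r0; field; rewrite !gt_eqF.
transitivity ((1 - s)^-1 * k ^+ 2 * (y * expR (- ((k * y) ^+ 2 * (1 + v ^+ 2) / 2)))); first by ring.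
by rewrite kk E mulrCA.
Qed.

Lemma time_law (phi : R -> R) (t : R) : measurable_fun setT phi -> (forall y, 0 <= phi y) ->
  0 < t -> t < 1 ->
  (\int[P]_w (phi (`|B t w| / Num.sqrt (1 - g t w)) / (1 - g t w) * \1_[set w | no_zero t 1 (B ^~ w)] w)%:E =
   \int[mu]_(v in `]0%R, +oo[) \int[mu]_(y in `]0%R, +oo[)
     (phi y * (2 / pi * y) * time_kernel t v y)%:E)%E.
Proof.
move=> mphi phi0 t0 t1.
(* The absolute value serves non-negativity for all arguments; in the integral g_t <= t < 1. *)
pose G (x s : R) : R := phi (x / Num.sqrt (1 - s)) * `|1 - s|^-1.
have mG : measurable_fun setT (fun z : R * R => G z.1 z.2).
  by apply: measurable_funM; [apply: (measurableT_comp mphi)|]; mfun.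
have G0 x s : 0 <= G x s by rewrite mulr_ge0// invr_ge0.
transitivity (\int[P]_w (G `|B t w| (g t w) * \1_[set w | no_zero t 1 (B ^~ w)] w)%:E)%E.
  apply: eq_integral => w _; have [_ gt _] := last_zero_uptoP hB w (ltW t0).
  have g1 : 0 <= 1 - g t w by rewrite subr_ge0 (le_trans gt (ltW t1)).
  by rewrite /G (ger0_norm g1).
rewrite (abs_last_zero_polar hB t0 (ltW t1) mG G0).
apply: eq_integral => v; rewrite inE/= in_itv/= andbT => v0.
set s := t * (v ^+ 2 / (1 + v ^+ 2)).
pose k := Num.sqrt (1 - s) / Num.sqrt t.
have sub y := time_substitution v y t0 t1.
have [s1 k0 _ _] := sub 0; rewrite -/s -/k in s1 k0.
pose f (x : R) : R := G (Num.sqrt t * x) s * gband (Num.sqrt (1 - t)) (Num.sqrt t * x) *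
   (2 / pi * (`|x| * expR (- (x ^+ 2 * (1 + v ^+ 2) / 2)))).
have mf : measurable_fun setT (fun x => (f x)%:E).
  apply/measurable_EFinP; apply: measurable_funM; last by mfun.
  apply: measurable_funM; first by apply: (measurable_fun_comp2 mG); mfun.
  by apply: (measurable_fun_comp2 measurable_gband); mfun.
have f0 x : (0 <= (f x)%:E)%E.
  by rewrite lee_fin !mulr_ge0 ?gband_ge0 ?expR_ge0 ?invr_ge0 ?(ltW pi0).
transitivity (\int[mu]_(x in `]0%R, +oo[) (f x)%:E)%E.
  by apply: eq_integral => x; rewrite inE/= in_itv/= andbT => x0; rewrite /f (gtr0_norm x0).
rewrite (ge0_integral_scale k0 mf f0).
have key (y : R) : 0 < y -> f (k * y) * k = phi y * (2 / pi * y) * time_kernel t v y.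
  move=> y0; have [_ _ E1 E2] := sub y; rewrite -/s -/k in E1 E2.
  rewrite /f E1 /G (gtr0_norm s1) (gtr0_norm (mulr_gt0 k0 y0)).
  have -> : Num.sqrt (1 - s) * y / Num.sqrt (1 - s) = y.
    by rewrite mulrAC divff ?mul1r// gt_eqF// sqrtr_gt0.
  transitivity (phi y * (2 / pi) * gband (Num.sqrt (1 - t)) (Num.sqrt (1 - s) * y) *
    ((1 - s)^-1 * (k * y * expR (- ((k * y) ^+ 2 * (1 + v ^+ 2) / 2))) * k)); first by ring.
  by rewrite E2 /time_kernel -/s; ring.
by apply: eq_integral => y; rewrite inE/= in_itv/= andbT => y0; rewrite -EFinM key.
Qed.

(** The level is brought outermost, then time and slope are integrated out by the kernel lemmas; pi
    / y against 2 / pi * y leaves the factor 2. *)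
Lemma occupation_law (phi : R -> R) : measurable_fun setT phi -> (forall y, 0 <= phi y) ->
  (\int[mu]_(t in `]0%R, 1%R[)
     \int[P]_w (phi (`|B t w| / Num.sqrt (1 - g t w)) / (1 - g t w) * \1_[set w | no_zero t 1 (B ^~ w)] w)%:E =
   \int[mu]_(y in `]0%R, +oo[) ((phi y)%:E *
      (2%:E * \int[mu]_(z in `[y, (2 * y)%R]) (expR (- z ^+ 2 / 2))%:E)))%E.
Proof.
move=> mphi phi0.
pose c (y : R) : R := phi y * (2 / pi * y).
have mc : measurable_fun setT c by apply: measurable_funM => //; mfun.
have c0 y : 0 < y -> 0 <= c y by move=> y0; rewrite mulr_ge0// mulr_ge0 ?divr_ge0 ?ltW.
have mtk := @measurable_time_kernel R.
have k0 t v y : 0 < t -> 0 < y -> (0 <= (c y * time_kernel t v y)%:E)%E.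
  by move=> t0 y0; rewrite lee_fin mulr_ge0 ?c0 ?time_kernel_ge0 ?ltW.
pose D : set R := `]0%R, +oo[%classic; pose J : set R := `]0%R, 1%R[%classic.
have mD : measurable D by exact: measurable_itv.
have mJ : measurable J by exact: measurable_itv.
have DE y : D y = (0 < y) :> Prop by rewrite /D/= in_itv/= andbT.
have J0 t : J t -> 0 < t by rewrite /J/= in_itv/= => /andP[].
pose K (t v y : R) : \bar R := (`|c y| * `|time_kernel t v y|)%:E.
have K0 t v y : (0 <= K t v y)%E by rewrite lee_fin mulr_ge0.
have mK : measurable_fun setT (fun z : (R * R) * R => K z.1.1 z.1.2 z.2).
  apply/measurable_EFinP; apply: measurable_funM; last exact: (measurableT_comp (@normr_measurable _ setT)).
  by apply: (measurableT_comp (@normr_measurable _ setT)); apply: (measurableT_comp mc); mfun.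
have mKh d' (X : measurableType d') (h : X -> (R * R) * R) : measurable_fun setT h ->
    measurable_fun setT (fun z => K (h z).1.1 (h z).1.2 (h z).2).
  by move=> mh; exact: (measurableT_comp mK mh).
transitivity (\int[mu]_(t in J) \int[mu]_(v in D) \int[mu]_(y in D) (K t v y))%E.
  apply: eq_integral => t /set_mem Jt; have t0 := J0 _ Jt.
  have t1 : t < 1 by move: Jt; rewrite /J/= in_itv/= => /andP[].
  rewrite (time_law mphi phi0 t0 t1); apply: eq_integral => v _; apply: eq_integral => y.
  by rewrite inE/= in_itv/= andbT => y0; rewrite /K !ger0_norm ?time_kernel_ge0 ?c0 ?ltW.
transitivity (\int[mu]_(t in J) \int[mu]_(y in D) \int[mu]_(v in D) (K t v y))%E.
  apply: eq_integral => t _; apply: integral_swap => //.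
  by apply: (mKh _ _ (fun z : R * R => ((t, z.1), z.2))); do !(apply/measurable_fun_pair => //).
transitivity (\int[mu]_(y in D) \int[mu]_(t in J) \int[mu]_(v in D) (K t v y))%E.
  apply: integral_swap => //; last by move=> t y _ _; apply: integral_ge0.
  apply: (measurable_integral_param (f := fun z v => K z.1 v z.2)) => //.
  by apply: (mKh _ _ (fun z : (R * R) * R => ((z.1.1, z.2), z.1.2))); do !(apply/measurable_fun_pair => //); mfun.
apply: eq_integral => y /set_mem; rewrite DE => y0.
transitivity (\int[mu]_(v in D) \int[mu]_(t in J) (K t v y))%E.
  apply: integral_swap => //.
  by apply: (mKh _ _ (fun z : R * R => ((z.1, z.2), y))); do !(apply/measurable_fun_pair => //).
have mtv v : measurable_fun setT (fun t => (`|time_kernel t v y|)%:E).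
  apply/measurable_EFinP; apply: (measurableT_comp (@normr_measurable _ setT)).
  by apply: (measurableT_comp mtk (g := fun t : R => ((t, v), y))); do !(apply/measurable_fun_pair => //).
transitivity (\int[mu]_(v in D) ((c y)%:E * \int[mu]_(t in J) (time_kernel t v y)%:E))%E.
  apply: eq_integral => v _; rewrite -ge0_integralZl//.
  - by apply: eq_integral => t /set_mem /J0 t0; rewrite -EFinM /K !ger0_norm ?time_kernel_ge0 ?c0 ?ltW.
  - apply: eq_measurable_fun (measurable_funTS (mtv v)).
    by move=> t /set_mem /J0 t0; rewrite ger0_norm// time_kernel_ge0// ltW.
  - by move=> t /J0 t0; rewrite lee_fin time_kernel_ge0// ltW.
  - by rewrite lee_fin c0.
rewrite ge0_integralZl//; first last.
- by rewrite lee_fin c0.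
- by move=> v _; apply: integral_ge0 => t /J0 t0; rewrite lee_fin time_kernel_ge0// ltW.
- apply: measurable_funTS.
  rewrite (_ : (fun v => _) = (fun v => \int[mu]_(t in J) (`|time_kernel t v y|)%:E)%E); last first.
    apply/funext => v; apply: eq_integral => t /set_mem /J0 t0.
    by rewrite ger0_norm// time_kernel_ge0// ltW.
  apply: (measurable_integral_param (f := fun v t => (`|time_kernel t v y|)%:E)) => //.
  apply/measurable_EFinP; apply: (measurableT_comp (@normr_measurable _ setT)).
  by apply: (measurableT_comp mtk (g := fun z : R * R => ((z.2, z.1), y))); do !(apply/measurable_fun_pair => //).
rewrite integral_level_kernel_v// integral_level_kernel// muleA -EFinM muleA -EFinM.
congr (_%:E * _)%E; rewrite /c; generalize (phi y) => a.
by move: pi0; generalize (@pi R) => q q0; field; rewrite !gt_eqF.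
Qed.

Lemma gband_le (b a a' : R) : a <= a' -> gband b a <= gband b a'.
Proof.
move=> aa'; rewrite -lee_fin !gbandE; apply: le_measure; rewrite ?inE; [exact: measurable_band|exact: measurable_band|].
by move=> z /= /lt_le_trans; exact.
Qed.

(** B_t is almost surely not 0. Inserting the indicator brings an expectation at time t into the
    form of [abs_last_zero_polar] with T = t. *)
Lemma integral_no_zero_tt (t : R) (f : Om -> R) : 0 < t ->
  measurable_fun setT f ->
  (\int[P]_w (f w)%:E = \int[P]_w (f w * \1_[set w | no_zero t t (B ^~ w)] w)%:E)%E.
Proof.
move=> t0 mf.
have mnz : measurable [set w | no_zero t t (B ^~ w)] by exact: (measurable_no_zero_le hB t0 (lexx t)).
have nz : P (~` [set w | no_zero t t (B ^~ w)]) = 0%E.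
  rewrite (_ : ~` _ = [set w | B t w = 0]); first exact: (brownian_atomless hB 0 t0).
  apply/seteqP; split => w /=.
    by move=> H; apply/eqP/negPn/negP => B0; apply: H => r /le_anti <-.
  by move=> B0 /(_ t); rewrite lexx B0 eqxx => /(_ isT).
apply: ae_eq_integral => //; first exact/measurable_EFinP.
  by apply/measurable_EFinP; apply: measurable_funM => //; exact: measurable_indic.
exists (~` [set w | no_zero t t (B ^~ w)]); split => //; first exact: measurableC.
move=> w /= H nzw; apply: H => _.
by rewrite (@indicE _ R [set w | no_zero t t (B ^~ w)] w) mem_set// mulr1.
Qed.

(* Given the past of t, the path has no zero on [t, 1] with probability at least gband 1 y as
   soon as |B_t| >= y sqrt (1 - t). *)
Lemma occupation_le (y t : R) (G : R -> R -> R) : 0 < y -> 0 < t -> t < 1 ->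
  measurable_fun setT (fun z : R * R => G z.1 z.2) -> (forall x s, 0 <= G x s) ->
  (forall x s, G x s != 0 -> s <= t -> y * Num.sqrt (1 - s) <= x) ->
  ((gband 1 y)%:E * \int[P]_w (G `|B t w| (g t w))%:E <=
   \int[P]_w (G `|B t w| (g t w) * \1_[set w | no_zero t 1 (B ^~ w)] w)%:E)%E.
Proof.
move=> y0 t0 t1 mG G0 Gy.
have mBt : measurable_fun setT (fun w => `|B t w|).
  by apply: measurableT_comp => //; exact: measurable_funPT.
have mgt : measurable_fun setT (fun w => g t w) by exact: (measurable_last_zero hB (ltW t0)).
pose G' (x s : R) : R := G x s * gband (Num.sqrt (1 - t)) x.
have mG' : measurable_fun setT (fun z : R * R => G' z.1 z.2).
  by apply: measurable_funM => //; apply: (measurable_fun_comp2 measurable_gband); mfun.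
have G'0 x s : 0 <= G' x s by rewrite mulr_ge0// gband_ge0.
have mGw : measurable_fun setT (fun w => G `|B t w| (g t w)) by exact: (measurable_fun_comp2 mG).
have mG'w : measurable_fun setT (fun w => G' `|B t w| (g t w)) by exact: (measurable_fun_comp2 mG').
(* The absence of zeros enters the polar formula as a factor [gband]. Moved into [G'], it gives the
   polar formula for T = t, whose own band is 1. *)
have -> : (\int[P]_w (G `|B t w| (g t w) * \1_[set w | no_zero t 1 (B ^~ w)] w)%:E =
           \int[P]_w (G' `|B t w| (g t w))%:E)%E.
  rewrite (integral_no_zero_tt t0 mG'w) (abs_last_zero_polar hB t0 (ltW t1) mG G0) (abs_last_zero_polar hB t0 (lexx t) mG' G'0).
  apply: eq_integral => v _; apply: eq_integral => x; rewrite inE/= in_itv/= andbT => x0.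
  by rewrite subrr sqrtr0 gband0 ?mulr1// mulr_gt0// sqrtr_gt0.
rewrite -ge0_integralZl//; first last.
- by rewrite lee_fin gband_ge0.
- by move=> w _; rewrite lee_fin.
- exact/measurable_EFinP.
apply: ge0_le_integral => //.
- by move=> w _; rewrite -EFinM lee_fin mulr_ge0// gband_ge0.
- by apply: emeasurable_funM => //; exact/measurable_EFinP.
- exact/measurable_EFinP.
move=> w _; rewrite -EFinM lee_fin mulrC /G'.
have [->|Gn0] := eqVneq (G `|B t w| (g t w)) 0; first by rewrite !mul0r.
apply: ler_wpM2l => //.
have [_ gt _] := last_zero_uptoP hB w (ltW t0).
have st0 : 0 < Num.sqrt (1 - t) by rewrite sqrtr_gt0 subr_gt0.
have -> : gband 1 y = gband (Num.sqrt (1 - t)) (Num.sqrt (1 - t) * y).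
  by rewrite -[X in gband X (_ * y)]mulr1 gband_scale.
apply: gband_le; apply: le_trans (Gy _ _ Gn0 gt).
rewrite mulrC ler_pM2l// ler_sqrt; first by rewrite lerD2l lerN2.
by rewrite subr_ge0 (le_trans gt)// ltW.
Qed.

End OccupationLaw.

(** * Processes at a random time *)

(* Paths are only controlled on [0, 1]; clipping the time extends them to all of R. *)
Definition clip01 {R : realType} (t : R) : R := Num.max 0 (Num.min t 1).

Section ContinuousProcess.
Context {R : realType}.

Lemma clip01_itv (t : R) : 0 <= clip01 t <= 1.
Proof. by rewrite /clip01 le_max lexx /= ge_max ler01/= ge_min lexx orbT. Qed.

Lemma clip01_id (t : R) : 0 <= t <= 1 -> clip01 t = t.
Proof. by move=> /andP[t0 t1]; rewrite /clip01 min_l// max_r. Qed.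

Lemma measurable_clip01 : measurable_fun setT (@clip01 R).
Proof. by apply: measurable_maxr => //; apply: measurable_minr. Qed.

Definition continuous01 (f : R -> R) := forall c e : R, 0 <= c <= 1 -> 0 < e ->
  exists2 eta, 0 < eta & forall x, 0 <= x <= 1 -> `|x - c| < eta -> `|f x - f c| < e.

Lemma within_continuous01 (f : R -> R) : {within `[0, 1], continuous f} -> continuous01 f.
Proof.
move=> /subspace_continuousP cf c e c01 e0.
have /cvgrPdist_lt /(_ e e0) := cf c c01.
move=> [eta /= eta0 H]; exists eta => // x x01 xc.
by rewrite distrC; apply: H => //=; rewrite distrC.
Qed.

Lemma truncn_cvg (f : R -> R) (c : R) : continuous01 f -> 0 <= c <= 1 ->
  f ((Num.truncn (n.+1%:R * c))%:R / n.+1%:R) @[n --> \oo] --> f c.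
Proof.
move=> cf c01; have /andP[c0 c1] := c01; apply/cvgrPdist_lt => e e0.
have [eta eta0 H] := cf c e c01 e0.
near=> n.
have n0 : 0 < n.+1%:R :> R by rewrite ltr0n.
have /andP[t1 t2] : (Num.truncn (n.+1%:R * c))%:R <= n.+1%:R * c < (Num.truncn (n.+1%:R * c)).+1%:R.
  by apply: truncn_itv; rewrite mulr_ge0// ltW.
set q := (Num.truncn _)%:R / _.
have qc : q <= c by rewrite /q ler_pdivrMr// [leRHS]mulrC.
have cq : c - q < n.+1%:R^-1.
  rewrite ltrBlDl -[X in _ + X]mul1r -mulrDl ltr_pdivlMr// mulrC.
  by apply: (lt_le_trans t2); rewrite -natr1.
have q0 : 0 <= q by rewrite divr_ge0 // ltW.
rewrite distrC; apply: H; first by rewrite q0 (le_trans qc).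
rewrite distrC ger0_norm ?subr_ge0//; apply: lt_trans cq _.
near: n; exact: (near_infty_natSinv_lt (PosNum eta0)).
Unshelve. all: by end_near. Qed.

(** The process is the limit of its values at the times floor ((n + 1) t) / (n + 1), and each
    approximation is measurable on the countably many cells where that time is constant. *)
Lemma measurable_continuous_process d (Om : measurableType d) (X : R -> Om -> R) :
  (forall t, 0 <= t <= 1 -> measurable_fun setT (X t)) ->
  (forall w, continuous01 (X ^~ w)) ->
  measurable_fun setT (fun z : R * Om => X (clip01 z.1) z.2).
Proof.
move=> mX cX.
pose Xn n (z : R * Om) := X ((Num.truncn (n.+1%:R * clip01 z.1))%:R / n.+1%:R) z.2.
apply: (@measurable_fun_cvg _ _ R setT Xn); last first.
  by move=> z _; apply: truncn_cvg (cX z.2) (clip01_itv _).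
move=> n; have n0 : 0 < n.+1%:R :> R by rewrite ltr0n.
have mcl : measurable_fun setT (fun z : R * Om => n.+1%:R * clip01 z.1).
  apply: measurable_funM => //; apply: (measurableT_comp measurable_clip01).
  exact: measurable_fst.
pose E (k : nat) : set (R * Om) := [set z | k%:R <= n.+1%:R * clip01 z.1 < k.+1%:R].
have mE k : measurable (E k).
  rewrite (_ : E k = (fun z : R * Om => n.+1%:R * clip01 z.1) @^-1` `[k%:R, k.+1%:R[%classic).
    by rewrite -[X in measurable X]setTI; apply: mcl => //; exact: measurable_itv.
  by apply/seteqP; split => z; rewrite /E/= in_itv.
have c0 (z : R * Om) : 0 <= n.+1%:R * clip01 z.1.
  by have /andP[? _] := clip01_itv z.1; rewrite mulr_ge0// ltW.
have UE : \bigcup_k E k = setT.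
  rewrite -subTset => z _; exists (Num.truncn (n.+1%:R * clip01 z.1)) => //.
  exact: truncn_itv.
rewrite -UE; apply/(measurable_fun_bigcup _ mE) => k.
have [[z0 Ez0]|nE] := pselect (exists z, E k z); last first.
  rewrite (_ : E k = set0); first exact: measurable_fun_set0.
  by apply/seteqP; split => // z Ez; apply: nE; exists z.
have tE z : E k z -> Num.truncn (n.+1%:R * clip01 z.1) = k.
  by rewrite /E/= => /truncn_def.
have k01 : 0 <= (k%:R / n.+1%:R : R) <= 1.
  rewrite divr_ge0 ?(ltW n0)//= ler_pdivrMr// mul1r.
  have /andP[h _] := Ez0; apply: (le_trans h); have /andP[_ h1] := clip01_itv z0.1.
  by rewrite ger_pMr.
apply: (@eq_measurable_fun _ _ _ _ (E k) (fun z => X (k%:R / n.+1%:R) z.2)).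
  by move=> z /set_mem /tE ez; rewrite /Xn ez.
by apply: measurable_funTS; apply: (measurableT_comp (mX _ k01)); exact: measurable_snd.
Qed.

End ContinuousProcess.

Lemma integral_uniformly_distributed {R : realType} {d : measure_display} {Om : measurableType d}
    (P : probability Om R) (X : {RV P >-> R}) (a b : R) (f : R -> \bar R) :
  uniformly_distributed P a b X -> measurable_fun setT f -> (forall x, 0 <= f x)%E ->
  (\int[distribution P X]_x f x = \int[@lebesgue_measure R]_(x in `[a, b]) (f x * ((b - a)^-1)%:E))%E.
Proof.
move=> [ab hX] mf f0.
rewrite (@ge0_integral_image_density R _ _ (measurableTypeR R) R (@lebesgue_measure R) id (uniform_pdf a b)).
- rewrite [RHS]integral_mkcond; apply: eq_integral => x _.
  rewrite patchE mem_setE in_itv/= /uniform_pdf; case: ifP => // _.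
  by rewrite mule0.
- exact: measurable_id.
- exact: measurable_uniform_pdf.
- by move=> x; exact: uniform_pdf_ge0.
- by move=> A mA; exact: (hX A mA).
- exact: mf.
- exact: f0.
Qed.

Section RandomTime.
Context {R : realType} {d : measure_display} {Om : measurableType d}.
Variables (P : probability Om R) (X : R -> {RV P >-> R}) (U : {RV P >-> R}).
Hypothesis cX : forall w, {within `[0, 1], continuous (fun u => X u w)}.
Notation mu := (@lebesgue_measure R).

Let E : set (set Om) := [set S | exists t, exists A : set R, [/\ `[0, 1]%classic t, measurable A & S = X t @^-1` A]].

Let mX t : measurable_fun setT (X t : Om -> R). Proof. exact: measurable_funPT. Qed.

Let cX01 w : continuous01 (X ^~ w). Proof. by apply: within_continuous01; exact: cX. Qed.

(** Events generated by the X t are preimages of path events, and independence of U is stated for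
    the latter. *)
Let E_path S : <<s E >> S -> exists2 C, path_events `[0, 1]%classic C & S = [set w | C (X ^~ w)].
Proof.
pose H : set (set Om) := preimage_set_system setT (fun w => X ^~ w) (path_events `[0, 1]%classic).
have HS : <<s E >> `<=` H.
  apply: smallest_sub.
    by apply: sigma_algebra_preimage; exact: smallest_sigma_algebra.
  move=> _ [t [A [t01 mA ->]]]; exists [set x : R -> R | A (x t)].
    by apply: sub_sigma_algebra; exists t, A.
  by rewrite setTI.
by move=> /HS [C pC <-]; exists C => //; rewrite setTI.
Qed.

Let E_measurable S : <<s E >> S -> measurable S.
Proof.
have H : <<s E >> `<=` measurable.
  apply: smallest_sub; first exact: sigma_algebra_measurable.
  by move=> _ [t [A [_ mA ->]]]; rewrite -[X in measurable X]setTI; exact: mX.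
exact: H.
Qed.

Lemma random_time_measurable : (forall w, 0 <= U w <= 1) ->
  measurable_fun setT (fun w => X (U w) w).
Proof.
move=> U01.
have mXc := @measurable_continuous_process R d Om X (fun t _ => mX t) cX01.
rewrite (_ : (fun w => _) = (fun w => X (clip01 (U w)) w)); last by apply/funext => w; rewrite clip01_id.
apply: (measurableT_comp mXc (g := fun w => (U w, w))).
by apply/measurable_fun_pair => //; exact: measurable_funPT.
Qed.

(* U is only independent of the process, so the product measure is taken on the sigma-algebra
   generated by the X t. *)
Lemma random_time_law (A : set R) :
  (forall w, 0 <= U w <= 1) -> uniformly_distributed P 0 1 U ->
  independent_of_process P `[0, 1]%classic U X -> measurable A ->
  P ((fun w => X (U w) w) @^-1` A) = (\int[mu]_(u in `[0%R, 1%R]) P (X u @^-1` A))%E.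
Proof.
move=> U01 hU hUm mA.
pose Om' := g_sigma_algebraType E.
have mX' t : 0 <= t <= 1 -> measurable_fun setT (X t : Om' -> R).
  move=> t01 _ B mB; rewrite setTI; apply: sub_sigma_algebra.
  by exists t, B; split.
have mXc := @measurable_continuous_process R _ Om' X mX' cX01.
have mid : measurable_fun setT (fun w : Om => w : Om').
  by move=> _ B mB; rewrite setTI; exact: E_measurable.
have mUid : measurable_fun setT (fun w : Om => (U w, w : Om') : R * Om').
  by apply/measurable_fun_pair => //; exact: measurable_funPT.
pose S : set (R * Om') := [set z | A (X (clip01 z.1) z.2)].
have mS : measurable S by rewrite -[X in measurable X]setTI; exact: (mXc measurableT _ mA).
pose idm : {mfun Om >-> Om'} := HB.pack (fun w : Om => w : Om') (isMeasurableFun.Build _ _ _ _ (fun w : Om => w : Om') mid).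
pose m' : {measure set (R * Om') -> \bar R} := pushforward P (fun w : Om => (U w, w : Om')).
have rect (C : set R) (D : set Om') : measurable C -> measurable D ->
    m' mUid (C `*` D) = (distribution P U C * distribution P idm D)%E.
  move=> mC mD; rewrite /m'/= /distribution /pushforward.
  have [F pF ->] := E_path mD.
  exact: hUm.
have HS := @product_measure_unique _ _ R Om' R (distribution P U) (distribution P idm) (m' mUid) rect S mS.
transitivity (m' mUid S).
  rewrite /m'/= /pushforward; congr (P _).
  by apply/seteqP; split => w; rewrite /S/= clip01_id.
rewrite -HS.
transitivity (\int[distribution P U]_u P (X (clip01 u) @^-1` A))%E.
  by apply: eq_integral => u _; rewrite /= /distribution/= /pushforward/= xsectionE.
have mPX : measurable_fun setT (fun u => P (X (clip01 u) @^-1` A)).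
  have := @measurable_fun_xsection _ _ R Om' R (distribution P idm) S mS.
  apply: eq_measurable_fun => u _.
  by rewrite /= /distribution/= /pushforward/= xsectionE.
rewrite (integral_uniformly_distributed hU mPX)//.
apply: eq_integral => u; rewrite inE/= in_itv/= => u01.
by rewrite subr0 invr1 mule1 clip01_id.
Qed.

End RandomTime.

(** * Occupation times of the meander *)

Lemma unit_affine {R : realType} (c u : R) : c < 1 -> (c <= (1 - c) * u + c <= 1) = (0 <= u <= 1).
Proof.
move=> c1; have k0 : 0 < 1 - c by rewrite subr_gt0.
rewrite lerDr pmulr_rge0//; congr (_ && _).
by rewrite -lerBrDr -{2}[1 - c]mulr1 ler_pM2l.
Qed.

Section MeanderOccupation.
Context {R : realType} {d : measure_display} {Om : measurableType d}.
Variables (P : probability Om R) (B : R -> {RV P >-> R}).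
Hypothesis hB : brownian_motion P B.
Notation mu := (@lebesgue_measure R).
Local Notation g t w := (last_zero_upto t (B ^~ w)).

Let mB t : measurable_fun setT (B t : Om -> R). Proof. exact: measurable_funPT. Qed.

Lemma integral_swap_prob (D : set R) (f : R -> Om -> \bar R) : measurable D ->
  measurable_fun setT (fun z : R * Om => f z.1 z.2) -> (forall t w, (0 <= f t w)%E) ->
  (\int[mu]_(t in D) \int[P]_w f t w = \int[P]_w \int[mu]_(t in D) f t w)%E.
Proof.
move=> mD mf f0.
have mfx t : measurable_fun setT (f t) by exact: (measurableT_comp mf (measurable_pair1 t)).
transitivity (\int[mu]_t \int[P]_w ((\1_D t)%:E * f t w))%E.
  rewrite integral_mkcond; apply: eq_integral => t _.
  by rewrite epatch_indic muleC -ge0_integralZl// lee_fin.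
rewrite (@fubini_tonelli _ _ (measurableTypeR R) Om R mu P (fun z => (\1_D z.1)%:E * f z.1 z.2)%E).
- by apply: eq_integral => w _; rewrite [RHS]integral_mkcond; apply: eq_integral => t _; rewrite epatch_indic muleC.
- apply: emeasurable_funM => //; apply/measurable_EFinP.
  exact: (measurableT_comp (measurable_indic mD) measurable_fst).
- by move=> z; rewrite mule_ge0// lee_fin.
Qed.

Lemma brownian_continuous01 w : continuous01 (B ^~ w).
Proof.
move=> c e /andP[c0 _] e0; have [eta eta0 H] := brownian_continuous hB w c0 e0.
by exists eta => // x /andP[x0 _]; exact: H.
Qed.

Let mBc : measurable_fun setT (fun z : R * Om => B (clip01 z.1) z.2 : R).
Proof. exact: (measurable_continuous_process (X := fun t w => B t w) (fun t _ => mB t) brownian_continuous01). Qed.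

Let mg : measurable_fun setT (fun w => g 1 w). Proof. exact: (measurable_last_zero hB ler01). Qed.

Lemma meander_path_clip w u : g 1 w < 1 ->
  meander_path (B ^~ w) (clip01 u) = `|B (clip01 (g 1 w + clip01 u * (1 - g 1 w))) w| / Num.sqrt (1 - g 1 w).
Proof.
move=> g1; have [g0 _ _] := last_zero_uptoP hB w ler01.
have /andP[u0 u1] := clip01_itv u.
have g1' : 0 <= 1 - g 1 w by rewrite subr_ge0 ltW.
have H : 0 <= g 1 w + clip01 u * (1 - g 1 w) <= 1.
  by rewrite addr_ge0 ?mulr_ge0//= -lerBrDl ler_piMl.
by rewrite (clip01_id H).
Qed.

Lemma measurable_meander_path : measurable_fun setT (fun z : R * Om => meander_path (B ^~ z.2) (clip01 z.1)).
Proof.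
have mg2 : measurable_fun setT (fun z : R * Om => g 1 z.2) by exact: (measurableT_comp mg measurable_snd).
have mc1 : measurable_fun setT (fun z : R * Om => clip01 z.1) by exact: (measurableT_comp (@measurable_clip01 R) measurable_fst).
have -> : (fun z : R * Om => meander_path (B ^~ z.2) (clip01 z.1)) =
   (fun z => `|B (clip01 (g 1 z.2 + clip01 z.1 * (1 - g 1 z.2))) z.2| / Num.sqrt (1 - g 1 z.2)).
  apply/funext => z; have [_ + _] := last_zero_uptoP hB z.2 ler01.
  rewrite le_eqVlt => /predU1P[g1|]; last exact: meander_path_clip.
  have hE : last_zero (B ^~ z.2) = 1 by exact: g1.
  by rewrite /meander_path hE g1 subrr sqrtr0 invr0 !mulr0.
apply: measurable_funM; last by mfun.
apply: (measurableT_comp (@normr_measurable _ setT)).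
apply: (measurableT_comp mBc (g := fun z : R * Om => (g 1 z.2 + clip01 z.1 * (1 - g 1 z.2), z.2))).
by apply/measurable_fun_pair; [mfun|exact: measurable_snd].
Qed.

Variable A : set R.
Hypothesis mA : measurable A.

Let m1A : measurable_fun setT (\1_A : R -> R). Proof. exact: measurable_indic. Qed.

(* The integrand of the occupation time of A after the substitution t = g + u (1 - g), where g
   is the last zero before 1. *)
Definition occ_density (t : R) (w : Om) : R :=
  \1_[set z : R * Om | 0 < z.1 - g 1 z.2] (t, w) *
    (\1_A (`|B (clip01 t) w| / Num.sqrt (1 - g 1 w)) * `|1 - g 1 w|^-1).

Lemma occ_density_ge0 t w : 0 <= occ_density t w.
Proof. by rewrite !mulr_ge0. Qed.

Lemma measurable_occ_density : measurable_fun setT (fun z : R * Om => occ_density z.1 z.2).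
Proof.
have mg2 : measurable_fun setT (fun z : R * Om => g 1 z.2) by exact: (measurableT_comp mg measurable_snd).
apply: measurable_funM.
  apply: (measurableT_comp (f := (\1_[set z : R * Om | 0 < z.1 - g 1 z.2] : R * Om -> R)) (g := fun z => (z.1, z.2))).
    by apply: measurable_indic; apply: measurable_set_gt; mfun.
  by apply/measurable_fun_pair.
apply: measurable_funM; last by mfun.
apply: (measurableT_comp m1A); apply: measurable_funM; last by mfun.
by apply: (measurableT_comp (@normr_measurable _ setT)).
Qed.

(* When B has no zero on [t, 1], its last zero before 1 is the one before t. *)
Lemma occ_densityE t w : 0 < t -> t < 1 ->
  occ_density t w = \1_A (`|B t w| / Num.sqrt (1 - g t w)) / (1 - g t w) * \1_[set w | no_zero t 1 (B ^~ w)] w.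
Proof.
move=> t0 t1; have [g0 g1 Bg] := last_zero_uptoP hB w ler01.
have t01 : 0 <= t <= 1 by rewrite !ltW.
rewrite /occ_density clip01_id// (@indicE _ R [set w | no_zero t 1 (B ^~ w)]).
rewrite (@indicE _ R [set z : R * Om | 0 < z.1 - g 1 z.2]).
have nzE := last_zero_upto_lt hB w (ltW t0) (ltW t1).
have [gt|tg] := ltP (g 1 w) t; last first.
  rewrite memNset/=; last by apply/negP; rewrite subr_gt0 -leNgt.
  by rewrite memNset ?mul0r ?mulr0// => /nzE; rewrite ltNge tg.
have gE : g t w = g 1 w.
  apply/le_anti/andP; split.
    have [h0 h1 hB0] := last_zero_uptoP hB w (ltW t0).
    by apply: (last_zero_upto_ge _ hB0); rewrite h0 (le_trans h1)// ltW.
  by apply: last_zero_upto_ge => //; rewrite g0 ltW.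
rewrite mem_set/= ?subr_gt0// mem_set; last exact/nzE.
have h1 : 0 <= 1 - g 1 w by rewrite subr_ge0.
by rewrite gE mul1r mulr1 (ger0_norm h1).
Qed.

Lemma meander_occupation w : g 1 w < 1 ->
  (\int[mu]_(u in `[0%R, 1%R]) (\1_A (meander_path (B ^~ w) u))%:E =
   \int[mu]_(t in `]0%R, 1%R[) (occ_density t w)%:E)%E.
Proof.
move=> g1; have [g0 _ _] := last_zero_uptoP hB w ler01.
have k0 : 0 < 1 - g 1 w by rewrite subr_gt0.
have mBw : measurable_fun setT (fun t => B (clip01 t) w : R).
  by apply: (measurableT_comp mBc (g := fun t : R => (t, w))); apply/measurable_fun_pair.
pose h (t : R) : R := \1_A (`|B (clip01 t) w| / Num.sqrt (1 - g 1 w)) * (1 - g 1 w)^-1.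
have mh : measurable_fun setT h.
  by apply: measurable_funM => //; apply: (measurableT_comp m1A); mfun.
have h0 t : 0 <= h t by rewrite mulr_ge0// invr_ge0 ltW.
pose f (t : R) : \bar R := (\1_`[g 1 w, 1]%classic t * h t)%:E.
have mf : measurable_fun setT f.
  apply/measurable_EFinP; apply: measurable_funM; last exact: mh.
  by apply: measurable_indic; exact: measurable_itv.
have f0 t : (0 <= f t)%E by rewrite lee_fin mulr_ge0.
have kn0 : 1 - g 1 w != 0 by rewrite gt_eqF.
transitivity (\int[mu]_t f t)%E.
  rewrite (ge0_integral_affine (g 1 w) kn0 mf f0) integral_mkcond; apply: eq_integral => u _.
  rewrite patchE mem_setE in_itv/= /f -EFinM (gtr0_norm k0) (@indicE _ R (`[g 1 w, 1]%classic)) mem_setE in_itv/=.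
  have -> : (g 1 w <= (1 - g 1 w) * u + g 1 w <= 1) = (0 <= u <= 1).
    exact: unit_affine.
  case: ifP => u01; last by rewrite mul0r mul0r.
  rewrite mul1r /h -mulrA mulVf// mulr1.
  by rewrite -[in LHS](clip01_id u01) meander_path_clip// (clip01_id u01) addrC (mulrC u).
transitivity (\int[mu]_(t in `[g 1 w, 1%R]) (h t)%:E)%E.
  by rewrite [RHS]integral_mkcond; apply: eq_integral => t _; rewrite epatch_indic /f EFinM muleC.
rewrite -integral_itv_bndo_bndc; last by apply: measurable_funTS; exact/measurable_EFinP.
rewrite -integral_itv_obnd_cbnd; last by apply: measurable_funTS; exact/measurable_EFinP.
rewrite [LHS]integral_mkcond [RHS]integral_mkcond; apply: eq_integral => t _.
rewrite !patchE !mem_setE !in_itv/= /occ_density (@indicE _ R [set z : R * Om | 0 < z.1 - g 1 z.2]).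
have [gt|tg] := ltP (g 1 w) t.
  rewrite (le_lt_trans g0 gt)/=; case: ifP => // _.
  by rewrite mem_set/= ?subr_gt0// mul1r (gtr0_norm k0).
rewrite /=; case: ifP => // _; rewrite memNset ?mul0r//=.
by apply/negP; rewrite subr_gt0 -leNgt.
Qed.

(** The last zero is itself a zero, so g = 1 forces B_1 = 0. *)
Lemma last_zero_lt1 : P [set w | ~ (g 1 w < 1)] = 0%E.
Proof.
apply/eqP; rewrite eq_le measure_ge0 andbT -(brownian_atomless hB 0 ltr01).
apply: le_measure; rewrite ?inE.
- by apply: measurableC; exact: (measurable_last_zero_lt hB 1 ler01).
- by rewrite -[X in measurable X]setTI; exact: (mB 1 measurableT (measurable_set1 0)).
move=> w /= /negP; rewrite -leNgt => g1; have [_ g1' Bg] := last_zero_uptoP hB w ler01.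
by have <- : g 1 w = 1 by apply/le_anti; rewrite g1 g1'.
Qed.

Let mind : measurable_fun setT (fun z : R * Om => (\1_A (meander_path (B ^~ z.2) (clip01 z.1)) : R)%:E).
Proof. by apply/measurable_EFinP; exact: (measurableT_comp m1A measurable_meander_path). Qed.

Lemma measurable_meander_time : measurable_fun setT
  (fun w => \int[mu]_(u in `[0%R, 1%R]) (\1_A (meander_path (B ^~ w) u))%:E)%E.
Proof.
rewrite (_ : (fun w => _) = (fun w => \int[mu]_(u in `[0%R, 1%R]) (\1_A (meander_path (B ^~ w) (clip01 u)))%:E)%E).
  apply: (measurable_integral_param (f := fun w u => (\1_A (meander_path (B ^~ w) (clip01 u)) : R)%:E)) => //.
    apply: (measurableT_comp mind (g := fun z : Om * R => (z.2, z.1))).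
    by apply/measurable_fun_pair => //.
by apply/funext => w; apply: eq_integral => u; rewrite inE/= in_itv/= => u01; rewrite clip01_id.
Qed.

Lemma measurable_occ_time (D : set R) : measurable D -> measurable_fun setT
  (fun w => \int[mu]_(t in D) (occ_density t w)%:E)%E.
Proof.
move=> mD; apply: (measurable_integral_param (f := fun w t => (occ_density t w)%:E)) => //.
  apply/measurable_EFinP; apply: (measurableT_comp measurable_occ_density (g := fun z : Om * R => (z.2, z.1))).
  by apply/measurable_fun_pair => //.
by move=> w t; rewrite lee_fin occ_density_ge0.
Qed.

Lemma meander_occupation_ae : ae_eq P setT
  (fun w => \int[mu]_(u in `[0%R, 1%R]) (\1_A (meander_path (B ^~ w) u))%:E)%E
  (fun w => \int[mu]_(t in `]0%R, 1%R[) (occ_density t w)%:E)%E.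
Proof.
exists [set w | ~ (g 1 w < 1)]; split; last first.
- by move=> w /= H g1; apply: H => _; exact: meander_occupation.
- exact: last_zero_lt1.
- by apply: measurableC; exact: (measurable_last_zero_lt hB 1 ler01).
Qed.

Lemma meander_time_law :
  (\int[mu]_(u in `[0%R, 1%R]) P [set w | A (meander_path (B ^~ w) u)] =
   \int[mu]_(y in `]0%R, +oo[) ((\1_A y)%:E *
      (2%:E * \int[mu]_(z in `[y, (2 * y)%R]) (expR (- z ^+ 2 / 2))%:E)))%E.
Proof.
rewrite -(@occupation_law _ _ _ _ _ hB (\1_A))//.
transitivity (\int[mu]_(u in `[0%R, 1%R]) \int[P]_w (\1_A (meander_path (B ^~ w) (clip01 u)))%:E)%E.
  apply: eq_integral => u; rewrite inE/= in_itv/= => u01; rewrite clip01_id//.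
  have mMu : measurable_fun setT (fun w => meander_path (B ^~ w) u).
    rewrite (_ : (fun w => _) = (fun w => meander_path (B ^~ w) (clip01 u))); last by rewrite clip01_id.
    by apply: (measurableT_comp measurable_meander_path (g := fun w : Om => (u, w))); apply/measurable_fun_pair.
  have mMA : measurable [set w | A (meander_path (B ^~ w) u)].
    by rewrite -[X in measurable X]setTI; exact: (mMu measurableT _ mA).
  by rewrite (measure_integral_indic P mMA); apply: eq_integral => w _; rewrite !indicE.
rewrite (integral_swap_prob (f := fun u w => (\1_A (meander_path (B ^~ w) (clip01 u)) : R)%:E));
  [|exact: measurable_itv|exact: mind|by move=> u w; rewrite lee_fin].
transitivity (\int[P]_w \int[mu]_(t in `]0%R, 1%R[) (occ_density t w)%:E)%E.
  apply: ae_eq_integral => //.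
  - have := measurable_meander_time; apply: eq_measurable_fun => w _.
    by apply: eq_integral => u; rewrite inE/= in_itv/= => u01; rewrite clip01_id.
  - exact: measurable_occ_time.
  - apply: filterS meander_occupation_ae => w + _ => /(_ I) <-.
    by apply: eq_integral => u; rewrite inE/= in_itv/= => u01; rewrite clip01_id.
rewrite -(integral_swap_prob (f := fun t w => (occ_density t w)%:E))//; last 2 first.
- by apply/measurable_EFinP; exact: measurable_occ_density.
- by move=> t w; rewrite lee_fin occ_density_ge0.
apply: eq_integral => t; rewrite inE/= in_itv/= => /andP[t0 t1].
by apply: eq_integral => w _; rewrite occ_densityE.
Qed.

End MeanderOccupation.

(** * Second moment of the occupation times *)

Section FutureIncrements.
Context {R : realType} {d : measure_display} {Om : measurableType d}.
Variables (P : probability Om R) (B : R -> {RV P >-> R}).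
Hypothesis hB : brownian_motion P B.
Notation mu := (@lebesgue_measure R).
Notation N := (@normal_prob R 0 1).
Local Notation g t w := (last_zero_upto t (B ^~ w)).

Let mB t : measurable_fun setT (B t : Om -> R). Proof. exact: measurable_funPT. Qed.

Variables (t t' : R).
Hypotheses (t0 : 0 < t) (tt' : t <= t').

Let mgt : measurable_fun setT (fun w => g t w). Proof. exact: (measurable_last_zero hB (ltW t0)). Qed.

(* The exponentials turn the pair into a point of the positive quadrant, where quadrants determine a finite measure. *)
Lemma last_zero_increment_independent (S : set (R * R)) (A : set R) : measurable S -> measurable A ->
  P ([set w | S (B t w, g t w)] `&` [set w | A (B t' w - B t w)]) =
  (P [set w | S (B t w, g t w)] * P [set w | A (B t' w - B t w)%R])%E.
Proof.
move=> mS mA; set F := [set w | A (B t' w - B t w)].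
have mF : measurable F.
  have mincr : measurable_fun setT (fun w => B t' w - B t w) by exact: measurable_funB.
  by rewrite -[X in measurable X]setTI; exact: mincr.
have fF : P F \is a fin_num by exact: fin_num_measure.
have [p pE] : exists p : {nonneg R}, p%:num%:E = P F.
  by exists (NngNum (fine_ge0 (measure_ge0 P F))); rewrite /= fineK.
pose phi w : R * R := (expR (B t w), expR (- g t w)).
have mphi : measurable_fun setT phi by apply/measurable_fun_pair; mfun.
pose m1 : {measure set (R * R) -> \bar R} := pushforward (mrestr P mF) phi.
pose m2 : {measure set (R * R) -> \bar R} := mscale p (pushforward P phi).
have m1E X : m1 mphi X = P (phi @^-1` X `&` F) by [].
have m2E X : m2 mphi X = (P (phi @^-1` X) * P F)%E by rewrite /m2/= /mscale/= /pushforward/= pE muleC.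
have mpre X : measurable X -> measurable (phi @^-1` X).
  by move=> mX; rewrite -[Y in measurable Y]setTI; exact: (mphi measurableT _ mX).
have nul X : measurable X -> P (phi @^-1` X) = 0%E -> m1 mphi X = 0%E /\ m2 mphi X = 0%E.
  move=> mX X0; rewrite m2E X0 mul0e m1E; split => //.
  exact: (subset_measure0 (measurableI _ _ (mpre _ mX) mF) (mpre _ mX) (@subIsetl _ _ _) X0).
have mlow (a : R) : measurable (`]-oo, a]%classic : set R) by exact: measurable_itv.
have n1 : P (phi @^-1` (`]-oo, 0]%classic `*` setT)) = 0%E.
  rewrite (_ : _ @^-1` _ = set0) ?measure0//.
  by apply/seteqP; split => // w [/=]; rewrite in_itv/= leNgt expR_gt0.
have n2 : P (phi @^-1` (setT `*` `]-oo, expR (- t)]%classic)) = 0%E.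
  apply/eqP; rewrite eq_le measure_ge0 andbT -(brownian_atomless hB 0 t0).
  apply: le_measure; rewrite ?inE.
  - by apply: mpre; exact: measurableX.
  - by rewrite -[X in measurable X]setTI; exact: (mB t measurableT (measurable_set1 0)).
  move=> w [_ /=]; rewrite in_itv/= ler_expR lerN2 => tg.
  have [_ gt Bg] := last_zero_uptoP hB w (ltW t0).
  by have <- : g t w = t by apply/le_anti/andP.
have [n11 n12] := nul _ (measurableX (mlow 0) measurableT) n1.
have [n21 n22] := nul _ (measurableX measurableT (mlow (expR (- t)))) n2.
have m12 : forall C, measurable C -> m1 mphi C = m2 mphi C.
  apply: (@finite_measure_quadrants_unique R 0 (expR (- t))) => //.
    by rewrite m1E (le_lt_trans (probability_le1 P _))// ?ltry// preimage_setT setTI.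
  move=> a b a0 tb.
  have b0 : 0 < b by exact: lt_trans (expR_gt0 _) tb.
  rewrite m1E m2E; pose s := - ln b.
  have st : s < t by rewrite /s ltrNl -ltr_expR lnK ?posrE.
  have preE : phi @^-1` (`]a, +oo[ `*` `]b, +oo[) = [set w | g t w < s /\ ln a < B t w].
    have Ea x : (a < expR x) = (ln a < x) by rewrite -[in RHS]ltr_expR lnK.
    have Eb x : (b < expR (- x)) = (x < s) by rewrite /s ltrNr -[in RHS]ltr_expR lnK.
    by apply/seteqP; split => w /=; rewrite !in_itv/= !andbT Ea Eb => -[].
  have [s0|s0] := leP s 0.
    rewrite preE (_ : [set w | _] = set0) ?set0I ?measure0 ?mul0e//.
    apply/seteqP; split => // w /= [gs _].
    have [g0 _ _] := last_zero_uptoP hB w (ltW t0).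
    by have := lt_le_trans gs s0; rewrite ltNge g0.
  have -> : phi @^-1` (`]a, +oo[ `*` `]b, +oo[) = [set w | no_zero s t (B ^~ w) /\ ln a < B t w].
    rewrite preE; apply/seteqP; split => w /= [H1 H2]; split => //.
      exact/(last_zero_upto_lt hB w (ltW s0) (ltW st)).
    exact/(last_zero_upto_lt hB w (ltW s0) (ltW st)).
  exact: (no_zero_increment_independent hB s0 st (lexx t)).
pose psi (z : R * R) : R * R := (ln z.1, - ln z.2).
have mpsi : measurable_fun setT psi.
  by apply/measurable_fun_pair; [|apply: measurable_funN]; apply: (measurableT_comp (@measurable_ln R)).
have mpS : measurable (psi @^-1` S) by rewrite -[X in measurable X]setTI; exact: mpsi.
have := m12 _ mpS; rewrite m1E m2E.
suff -> : phi @^-1` (psi @^-1` S) = [set w | S (B t w, g t w)] by [].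
by apply/seteqP; split => w; rewrite /psi /phi/= !expRK opprK.
Qed.

Lemma last_zero_increment_integral (f : (R * R) -> R -> \bar R) :
  measurable_fun setT (fun z : (R * R) * R => f z.1 z.2) -> (forall x z, (0 <= f x z)%E) ->
  (\int[P]_w f (B t w, g t w) (B t' w - B t w)%R =
   \int[P]_w \int[N]_z f (B t w, g t w) (Num.sqrt (t' - t) * z)%R)%E.
Proof.
move=> mf f0.
pose u w : R * R := (B t w, g t w).
have mu' : measurable_fun setT u by apply/measurable_fun_pair => //; exact: mB.
have mv : measurable_fun setT (fun w => (u w, B t' w - B t w)).
  by apply/measurable_fun_pair => //; apply: measurable_funB; exact: mB.
have mk : measurable_fun setT (fun z : R => Num.sqrt (t' - t) * z) by mfun.
pose U : {mfun Om >-> (R * R)%type} := HB.pack u (isMeasurableFun.Build _ _ _ _ u mu').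
pose K : {mfun R >-> R} := HB.pack (fun z : R => Num.sqrt (t' - t) * z) (isMeasurableFun.Build _ _ _ _ (fun z : R => Num.sqrt (t' - t) * z) mk).
pose m' : {measure set ((R * R) * R) -> \bar R} := pushforward P (fun w => (u w, B t' w - B t w)).
have rect (C : set (R * R)) (D : set R) : measurable C -> measurable D ->
    m' mv (C `*` D) = (distribution P U C * distribution gaussian K D)%E.
  move=> mC mD; rewrite /m'/= /distribution /pushforward.
  transitivity (P [set w | C (B t w, g t w)] * P [set w | D (B t' w - B t w)%R])%E.
    exact: last_zero_increment_independent.
  by rewrite (increment_law hB (ltW t0) tt' mD).
have HS := @product_measure_unique _ _ (R * R)%type R R (distribution P U) (distribution gaussian K) (m' mv) rect.
transitivity (\int[m' mv]_z f z.1 z.2)%E.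
  by rewrite (@ge0_integral_pushforward _ _ _ _ R _ mv P setT _ measurableT mf (fun y _ => f0 _ _)).
transitivity (\int[(distribution P U \x distribution gaussian K)%E]_z f z.1 z.2)%E.
  by apply: eq_measure_integral => C mC _; exact/esym/HS.
rewrite (fubini_tonelli1 (fun z => f z.1 z.2))//.
have mfx x : measurable_fun setT (f x) by exact: (measurableT_comp mf (measurable_pair1 x)).
rewrite /fubini_F.
transitivity (\int[distribution P U]_x \int[N]_z f x (Num.sqrt (t' - t) * z)%R)%E.
  apply: eq_integral => x _.
  rewrite (@ge0_integral_pushforward _ _ _ _ R _ mk gaussian setT _ measurableT (mfx x) (fun y _ => f0 _ _)).
  rewrite preimage_setT integral_gaussian//.
    exact: measurableT_comp (mfx x) mk.
  by move=> z; exact: f0.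
have mI : measurable_fun setT (fun x : R * R => \int[N]_z f x (Num.sqrt (t' - t) * z)%R)%E.
  apply: (measurable_integral_gauss (f := fun x z => f x (Num.sqrt (t' - t) * z))) => //.
  by apply: (measurable_fun_comp2 mf (u := fun z : (R * R) * R => z.1) (v := fun z => Num.sqrt (t' - t) * z.2)); mfun.
have I0 (x : R * R) : (0 <= \int[N]_z f x (Num.sqrt (t' - t) * z)%R)%E by exact: integral_ge0.
exact: (@ge0_integral_pushforward _ _ _ _ R _ mu' P setT _ measurableT mI (fun y _ => I0 y)).
Qed.

End FutureIncrements.

Section SmallBall.
Context {R : realType}.
Notation mu := (@lebesgue_measure R).
Notation N := (@normal_prob R 0 1).

Lemma gauss_pdf_le (x : R) : gauss_pdf x <= (Num.sqrt (2 * pi))^-1.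
Proof.
rewrite /gauss_pdf ler_piMr ?invr_ge0//.
by rewrite -expR0 ler_expR mulNr oppr_le0 divr_ge0 ?sqr_ge0.
Qed.

Lemma gauss_itv_le (a b x k : R) : a <= b -> 0 < k ->
  (N [set z | a <= x + k * z <= b]%R <= ((b - a) / k / Num.sqrt (2 * pi))%:E)%E.
Proof.
move=> ab k0.
have -> : [set z | a <= x + k * z <= b] = `[(a - x) / k, (b - x) / k]%classic.
  by apply/seteqP; split => z; rewrite /= in_itv/= ler_pdivrMr// ler_pdivlMr// lerBlDl lerBrDl (mulrC z).
have ab' : (a - x) / k <= (b - x) / k by rewrite ler_pM2r ?invr_gt0// lerD2r.
have mi : measurable (`[(a - x) / k, (b - x) / k]%classic : set (measurableTypeR R)) by exact: measurable_itv.
rewrite /normal_prob normal_pdf01.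
apply: (@le_trans _ _ (\int[mu]_(z in `[((a - x) / k)%R, ((b - x) / k)%R]) ((Num.sqrt (2 * pi))^-1)%:E)%E).
  apply: ge0_le_integral => //.
  - by move=> z _; rewrite lee_fin ltW// gauss_pdf_gt0.
  - by apply/measurable_EFinP; apply: measurable_funTS; exact: measurable_gauss_pdf.
  - by move=> z _; rewrite lee_fin gauss_pdf_le.
rewrite integral_cst//.
have muE : mu `[(a - x) / k, (b - x) / k]%classic = if (a - x) / k < (b - x) / k then ((b - x) / k - (a - x) / k)%:E else 0%E.
  by rewrite lebesgue_measure_itv/= lte_fin EFinB.
rewrite [X in (_ * X)%E]muE.
case: ifP => _; last by rewrite mule0 lee_fin !divr_ge0 ?subr_ge0// ltW.
rewrite -EFinM lee_fin mulrC -mulrBl.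
by rewrite (_ : b - x - (a - x) = b - a)//; ring.
Qed.

(** The value lies in [a, b] or in [- b, - a], hence twice the bound that [gauss_itv_le] draws from
    the maximum of the density. *)
Lemma gauss_abs_itv_le (a b x k : R) : a <= b -> 0 < k ->
  (N [set z | a <= `|x + k * z| <= b]%R <= (2 * ((b - a) / k / Num.sqrt (2 * pi)))%:E)%E.
Proof.
move=> ab k0.
have mset (c e : R) : measurable ([set z : R | c <= x + k * z <= e] : set (measurableTypeR R)).
  rewrite (_ : [set z | _] = (fun z : R => x + k * z) @^-1` `[c, e]%classic).
    rewrite -[X in measurable X]setTI.
    have mm : measurable_fun setT (fun z : R => x + k * z) by mfun.
    exact: (mm measurableT _ (measurable_itv _)).
  by apply/seteqP; split => z /=; rewrite in_itv.
have mabs : measurable ([set z : R | a <= `|x + k * z| <= b] : set (measurableTypeR R)).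
  rewrite (_ : [set z | _] = (fun z : R => `|x + k * z|) @^-1` `[a, b]%classic).
    rewrite -[X in measurable X]setTI.
    have mm : measurable_fun setT (fun z : R => `|x + k * z|) by mfun.
    exact: (mm measurableT _ (measurable_itv _)).
  by apply/seteqP; split => z /=; rewrite in_itv.
apply: (@le_trans _ _ (N ([set z | a <= x + k * z <= b]%R `|` [set z | - b <= x + k * z <= - a]%R))).
  apply: le_measure; rewrite ?inE//; first exact: measurableU.
  move=> z /=; have [xz|xz] := ler0P (x + k * z); last by left.
  by move=> /andP[h1 h2]; right; rewrite /= lerNl h2/= lerNr.
apply: (le_trans (measureU2 _ _ _)) => //.
rewrite mulr_natl mulr2n EFinD; apply: leeD; first exact: gauss_itv_le.
apply: (le_trans (gauss_itv_le x _ k0)); first by rewrite lerN2.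
by rewrite opprK addrC.
Qed.

End SmallBall.

Section SecondMoment.
Context {R : realType} {d : measure_display} {Om : measurableType d}.
Variables (P : probability Om R) (B : R -> {RV P >-> R}).
Hypothesis hB : brownian_motion P B.
Notation mu := (@lebesgue_measure R).
Notation N := (@normal_prob R 0 1).
Local Notation g t w := (last_zero_upto t (B ^~ w)).

Lemma integral_inv_sqrt (t : R) : 0 <= t -> t < 1 ->
  (\int[mu]_(u in `]t, 1%R[) ((Num.sqrt (u - t))^-1)%:E = (2 * Num.sqrt (1 - t))%:E)%E.
Proof.
move=> t0 t1.
have t1' : 0 < 1 - t by rewrite subr_gt0.
have s0 : 0 < Num.sqrt (1 - t) by rewrite sqrtr_gt0.
pose F (r : R) := t + r ^+ 2; pose F' (r : R) := 2 * r.
have FE : F @` `]0, Num.sqrt (1 - t)[%classic = `]t, 1[%classic.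
  apply/seteqP; split => [_ [r /=] + <-|u /=]; rewrite !in_itv/=.
    move=> /andP[r0 r1]; rewrite /F ltrDl exprn_gt0//= -ltrBrDl -[ltRHS](sqr_sqrtr (ltW t1')).
    by rewrite ltr_pXn2r ?nnegrE ?ltW.
  move=> /andP[tu u1]; have ut : 0 < u - t by rewrite subr_gt0.
  exists (Num.sqrt (u - t)); last by rewrite /F sqr_sqrtr ?ltW// addrC subrK.
  by rewrite in_itv/= sqrtr_gt0 ut/= ltr_sqrt// ltrD2r.
have oD : open (`]0, Num.sqrt (1 - t)[%classic : set R) by exact: interval_open.
have iD : is_interval (`]0, Num.sqrt (1 - t)[%classic : set R) by exact: interval_is_interval.
have dF (r : R) : `]0, Num.sqrt (1 - t)[%classic r -> is_derive r 1 F (F' r).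
  by move=> _; apply: is_derive_eq; rewrite /GRing.scale/= /F' ?mulr1 ?add0r ?expr1; ring.
have cF' (r : R) : `]0, Num.sqrt (1 - t)[%classic r -> {for r, continuous F'}.
  by move=> _; apply: differentiable_continuous; apply/derivable1_diffP; apply: ex_derive.
have F'0 (r : R) : `]0, Num.sqrt (1 - t)[%classic r -> 0 < F' r.
  by rewrite /= in_itv/= => /andP[r0 _]; rewrite mulr_gt0.
have mf : measurable_fun setT (fun u : R => ((Num.sqrt (u - t))^-1)%:E) by apply/measurable_EFinP; mfun.
have f0 (u : R) : (0 <= ((Num.sqrt (u - t))^-1)%:E)%E by rewrite lee_fin invr_ge0.
have := ge0_integral_image_increasing oD iD dF cF' F'0 mf f0; rewrite FE => ->.
transitivity (\int[mu]_(r in `]0%R, Num.sqrt (1 - t)[) 2%:E)%E.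
  apply: eq_integral => r; rewrite inE/= in_itv/= => /andP[r0 _].
  rewrite -EFinM /F /F' [t + _]addrC addrK sqrtr_sqr (gtr0_norm r0); congr EFin.
  by rewrite mulrCA mulVf ?mulr1// gt_eqF.
rewrite integral_cst//.
have muE : mu `]0, Num.sqrt (1 - t)[%classic = (Num.sqrt (1 - t))%:E.
  by rewrite lebesgue_measure_itv/= lte_fin s0 oppr0 adde0.
by rewrite [X in (_ * X)%E]muE -EFinM.
Qed.

Variables (y delta : R).
Hypotheses (y0 : 0 < y) (d0 : 0 < delta).

Let A : set R := `[y, y + delta]%classic.
Let mA : measurable A. Proof. exact: measurable_itv. Qed.
Let m1A : measurable_fun setT (\1_A : R -> R). Proof. exact: measurable_indic. Qed.
Let a t w := occ_density B A t w.
(** The bound of [gauss_abs_itv_le] for a window of width [delta] and unit deviation. *)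
Let c : R := 2 * (delta / Num.sqrt (2 * pi)).
(** [occ_density] without its indicator, the last zero being a free variable. *)
Let G (x s : R) : R := \1_A (x / Num.sqrt (1 - s)) * `|1 - s|^-1.

Let c0 : 0 <= c. Proof. by rewrite mulr_ge0// divr_ge0// ltW. Qed.

Let G0 x s : 0 <= G x s. Proof. by rewrite mulr_ge0// invr_ge0. Qed.

Let mG : measurable_fun setT (fun z : R * R => G z.1 z.2).
Proof. by apply: measurable_funM; [apply: (measurableT_comp m1A)|]; mfun. Qed.

Let a0 t w : 0 <= a t w. Proof. exact: occ_density_ge0. Qed.

Let ma : measurable_fun setT (fun z : R * Om => a z.1 z.2).
Proof. exact: (measurable_occ_density hB mA). Qed.

Let mB t : measurable_fun setT (B t : Om -> R). Proof. exact: measurable_funPT. Qed.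

Let aG t w : 0 < t -> t < 1 -> a t w != 0 -> g 1 w < t /\ g t w = g 1 w /\ a t w = G `|B t w| (g 1 w).
Proof.
move=> t0 t1; have [g0 g1 Bg] := last_zero_uptoP hB w ler01.
have t01 : 0 <= t <= 1 by rewrite !ltW.
rewrite /a /occ_density clip01_id// (@indicE _ R [set z : R * Om | 0 < z.1 - g 1 z.2]).
have [gt|tg] := ltP (g 1 w) t; last first.
  by rewrite memNset/= ?mul0r ?eqxx//; apply/negP; rewrite subr_gt0 -leNgt.
rewrite mem_set/= ?subr_gt0// mul1r => _; split => //; split => //.
apply/le_anti/andP; split.
  have [h0 h1 hB0] := last_zero_uptoP hB w (ltW t0).
  by apply: (last_zero_upto_ge _ hB0); rewrite h0 (le_trans h1)// ltW.
by apply: last_zero_upto_ge => //; rewrite g0 ltW.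
Qed.

Let mgt t : 0 < t -> measurable_fun setT (fun w => g t w).
Proof. by move=> t0; exact: (measurable_last_zero hB (ltW t0)). Qed.

Let mGt t : 0 < t -> measurable_fun setT (fun w => G `|B t w| (g t w)).
Proof. by move=> t0; have := mgt t0 => h; apply: (measurable_fun_comp2 mG) => //; mfun. Qed.

(** If both densities are non-zero, the last zero before 1 is g_t. Given (B_t, g_t), the increment
    has to bring |B_t'| into a window of width delta r with r = sqrt (1 - g_t), which has
    probability at most c r / sqrt (t' - t). The weight 1 / r^2 of time t' reduces this to 1 / r. *)
Lemma occ_pair_bound t t' : 0 < t -> t < t' -> t' < 1 ->
  (\int[P]_w (a t w * a t' w)%:E <=
   (c / Num.sqrt (t' - t))%:E * \int[P]_w (G `|B t w| (g t w) * (Num.sqrt (1 - g t w))^-1)%:E)%E.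
Proof.
move=> t0 tt' t1'; have t1 : t < 1 := lt_trans tt' t1'; have t'0 := lt_trans t0 tt'.
have h0 : 0 < Num.sqrt (t' - t) by rewrite sqrtr_gt0 subr_gt0.
pose S : set ((R * R) * R) := [set z | y * Num.sqrt (1 - z.1.2) - `|z.1.1 + z.2| <= 0] `&`
   [set z | `|z.1.1 + z.2| - (y + delta) * Num.sqrt (1 - z.1.2) <= 0].
have mS : measurable S by apply: measurableI; apply: measurable_set_le; mfun.
have SE x s z : S ((x, s), z) <-> (y * Num.sqrt (1 - s) <= `|x + z| <= (y + delta) * Num.sqrt (1 - s)).
  by rewrite /S/= !subr_le0; split => [[-> ->]//|/andP[]].
have m1S : measurable_fun setT (\1_S : (R * R) * R -> R) by exact: measurable_indic.
pose f (p : R * R) (z : R) : \bar R := (G `|p.1| p.2 * (`|1 - p.2|^-1 * \1_S (p, z)))%:E.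
have mf : measurable_fun setT (fun z : (R * R) * R => f z.1 z.2).
  apply/measurable_EFinP; apply: measurable_funM; first by apply: (measurable_fun_comp2 mG); mfun.
  apply: measurable_funM; first by mfun.
  by apply: (measurableT_comp m1S (g := fun z : (R * R) * R => (z.1, z.2))); apply/measurable_fun_pair.
have f0 p z : (0 <= f p z)%E by rewrite lee_fin !mulr_ge0.
have mat u : measurable_fun setT (fun w => a u w) by exact: (measurableT_comp ma (measurable_pair1 u)).
have mfw : measurable_fun setT (fun w => f (B t w, g t w) (B t' w - B t w)).
  apply: (measurable_fun_comp2 mf (u := fun w => (B t w, g t w)) (v := fun w => B t' w - B t w)).
    by apply/measurable_fun_pair; [exact: mB|exact: mgt].
  by apply: measurable_funB; exact: mB.
apply: (@le_trans _ _ (\int[P]_w f (B t w, g t w) (B t' w - B t w)%R)%E).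
  apply: ge0_le_integral => //.
  - by move=> w _; rewrite lee_fin mulr_ge0.
  - by apply/measurable_EFinP; exact: measurable_funM.
  move=> w _; have [az|an0] := eqVneq (a t w) 0; first by rewrite az mul0r.
  have [az'|an0'] := eqVneq (a t' w) 0; first by rewrite az' mulr0.
  have [gt [gE ->]] := aG t0 t1 an0; have [_ [_ aE]] := aG t'0 t1' an0'.
  rewrite aE /f/= gE lee_fin; apply: ler_wpM2l => //.
  have g1 : 0 < 1 - g 1 w by rewrite subr_gt0 (lt_trans gt).
  have r0 : 0 < Num.sqrt (1 - g 1 w) by rewrite sqrtr_gt0.
  rewrite /G mulrC; apply: ler_wpM2l; first by rewrite invr_ge0.
  rewrite !indicE; have [inA|_] := boolP (_ \in A) => //.
  have inS : S ((B t w, g 1 w), B t' w - B t w).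
    apply/SE; rewrite [B t w + _]addrC subrK.
    by move/set_mem: inA; rewrite /A/= in_itv/= ler_pdivlMr// ler_pdivrMr.
  by rewrite (mem_set inS).
rewrite (last_zero_increment_integral hB t0 (ltW tt') mf f0).
have mGr : measurable_fun setT (fun w => G `|B t w| (g t w) * (Num.sqrt (1 - g t w))^-1).
  by have := mgt t0 => h; apply: measurable_funM; [exact: mGt|mfun].
rewrite -ge0_integralZl//; first last.
- by rewrite lee_fin divr_ge0.
- by move=> w _; rewrite lee_fin mulr_ge0// invr_ge0.
- exact/measurable_EFinP.
apply: ge0_le_integral => //.
- by move=> w _; exact: integral_ge0.
- apply: (measurable_integral_gauss (f := fun w z => f (B t w, g t w) (Num.sqrt (t' - t) * z))) => //.
  apply: (measurable_fun_comp2 mf (u := fun z : Om * R => (B t z.1, g t z.1)) (v := fun z => Num.sqrt (t' - t) * z.2)); last by mfun.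
  by apply/measurable_fun_pair; [exact: (measurableT_comp (mB t) measurable_fst)|exact: (measurableT_comp (mgt t0) measurable_fst)].
- by apply: emeasurable_funM => //; exact/measurable_EFinP.
move=> w _; have [_ gt _] := last_zero_uptoP hB w (ltW t0).
have g1 : 0 < 1 - g t w by rewrite subr_gt0 (le_lt_trans gt).
set r := Num.sqrt (1 - g t w); have r0 : 0 < r by rewrite sqrtr_gt0.
have r2 : r ^+ 2 = 1 - g t w by rewrite sqr_sqrtr// ltW.
pose k := G `|B t w| (g t w) * `|1 - g t w|^-1.
have k0 : 0 <= k by rewrite mulr_ge0// invr_ge0.
pose band : set R := [set z | (y * r <= `|B t w + Num.sqrt (t' - t) * z| <= (y + delta) * r)%R].
have mband : measurable band.
  rewrite (_ : band = (fun z : R => `|B t w + Num.sqrt (t' - t) * z|) @^-1` `[y * r, (y + delta) * r]%classic).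
    rewrite -[X in measurable X]setTI.
    have mm : measurable_fun setT (fun z : R => `|B t w + Num.sqrt (t' - t) * z|) by mfun.
    exact: (mm measurableT _ (measurable_itv _)).
  by apply/seteqP; split => z /=; rewrite in_itv.
have -> : (\int[N]_z f (B t w, g t w) (Num.sqrt (t' - t) * z)%R = k%:E * N band)%E.
  rewrite (measure_integral_indic N (mband : measurable (band : set (measurableTypeR R)))) -ge0_integralZl//; first last.
  - by apply/measurable_EFinP; exact: measurable_indic.
  apply: eq_integral => z _; rewrite /f/= mulrA -EFinM; congr (_ * _)%:E.
  rewrite !indicE; congr ((nat_of_bool _)%:R).
  by apply/idP/idP => /set_mem H; apply/mem_set; [move/SE: H|apply/SE].
have yr : y * r <= (y + delta) * r by rewrite ler_pM2r// lerDl ltW.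
apply: (@le_trans _ _ (k%:E * (2 * (((y + delta) * r - y * r) / Num.sqrt (t' - t) / Num.sqrt (2 * pi)))%:E)%E).
  by apply: lee_wpmul2l; [rewrite lee_fin|exact: gauss_abs_itv_le].
rewrite -!EFinM lee_fin /k /c (gtr0_norm g1) -r2.
have p0 : 0 < Num.sqrt (2 * pi) :> R by rewrite sqrtr_gt0 mulr_gt0// pi_gt0.
move: p0; generalize (Num.sqrt (2 * pi) : R) => q q0.
move: h0; generalize (Num.sqrt (t' - t)) => h h0.
rewrite le_eqVlt; apply/orP; left; apply/eqP.
by generalize (G `|B t w| (g t w)) => e; field; rewrite !gt_eqF.
Qed.

(** Integrating 1 / sqrt (t' - t) up to 1 gives 2 sqrt (1 - t), at most 2 sqrt (1 - g_t), which
    absorbs the factor 1 / sqrt (1 - g_t) of [occ_pair_bound]. *)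
Lemma occ_inner_bound t : 0 < t -> t < 1 ->
  (\int[mu]_(t' in `]t, 1%R[) \int[P]_w (a t w * a t' w)%:E <=
   (2 * c)%:E * \int[P]_w (G `|B t w| (g t w))%:E)%E.
Proof.
move=> t0 t1; have t1' : 0 < 1 - t by rewrite subr_gt0.
pose K := (\int[P]_w (G `|B t w| (g t w) * (Num.sqrt (1 - g t w))^-1)%:E)%E.
have K0 : (0 <= K)%E by apply: integral_ge0 => w _; rewrite lee_fin mulr_ge0// invr_ge0.
have mat u : measurable_fun setT (fun w => a u w) by exact: (measurableT_comp ma (measurable_pair1 u)).
have mG' : measurable_fun setT (fun w => G `|B t w| (g t w)) by exact: mGt.
have mGr : measurable_fun setT (fun w => G `|B t w| (g t w) * (Num.sqrt (1 - g t w))^-1).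
  by have := mgt t0 => h; apply: measurable_funM => //; mfun.
have mPa : measurable_fun setT (fun t' => \int[P]_w (a t w * a t' w)%:E)%E.
  apply: (@measurable_fun_fubini_tonelli_F _ _ (measurableTypeR R) Om R P (fun z => (a t z.2 * a z.1 z.2)%:E)).
    apply/measurable_EFinP; apply: measurable_funM => //.
    exact: (measurableT_comp (mat t) measurable_snd).
  by move=> z; rewrite lee_fin mulr_ge0.
have ms : measurable_fun setT (fun t' : R => ((Num.sqrt (t' - t))^-1)%:E) by apply/measurable_EFinP; mfun.
apply: (@le_trans _ _ (\int[mu]_(t' in `]t, 1%R[) (((Num.sqrt (t' - t))^-1)%:E * (c%:E * K)))%E).
  apply: ge0_le_integral => //.
  - by move=> t' _; apply: integral_ge0 => w _; rewrite lee_fin mulr_ge0.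
  - exact: measurable_funTS.
  - by apply: measurable_funTS; exact: emeasurable_funM.
  move=> t'; rewrite /= in_itv/= => /andP[tt' t'1].
  by rewrite muleA -EFinM mulrC; exact: occ_pair_bound.
rewrite ge0_integralZr//; first last.
- by rewrite mule_ge0.
- exact: measurable_funTS.
rewrite integral_inv_sqrt ?(ltW t0)//.
rewrite muleA -EFinM (_ : 2 * Num.sqrt (1 - t) * c = (2 * c) * Num.sqrt (1 - t)); last by ring.
rewrite EFinM -muleA; apply: lee_wpmul2l; first by rewrite lee_fin mulr_ge0.
rewrite /K -ge0_integralZl//; first last.
- by move=> w _; rewrite lee_fin mulr_ge0// invr_ge0.
- exact/measurable_EFinP.
apply: ge0_le_integral => //.
- by move=> w _; rewrite -EFinM lee_fin !mulr_ge0 ?invr_ge0.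
- by apply: emeasurable_funM => //; exact/measurable_EFinP.
- exact/measurable_EFinP.
move=> w _; have [_ gt _] := last_zero_uptoP hB w (ltW t0).
have g1 : 0 < 1 - g t w by rewrite subr_gt0 (le_lt_trans gt).
rewrite -EFinM lee_fin mulrCA ler_piMr//.
by rewrite ler_pdivrMr ?sqrtr_gt0// mul1r; apply: ler_wsqrtr; rewrite lerD2l lerN2.
Qed.

(** The square is twice the integral over t < t', bounded by [occ_inner_bound]. That bound has lost
    the event of no zero on [t, 1]; [occupation_le] restores it at the cost of [gband 1 y], since
    the window lies above y. The constant is 2 times 2 c. *)
Lemma occupation_second_moment :
  ((gband 1 y)%:E * \int[P]_w ((\int[mu]_(t in `]0%R, 1%R[) (a t w)%:E) * (\int[mu]_(t in `]0%R, 1%R[) (a t w)%:E)) <=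
   (4 * c)%:E * \int[mu]_(t in `]0%R, 1%R[) \int[P]_w (a t w)%:E)%E.
Proof.
pose J : set R := `]0%R, 1%R[%classic; have mJ : measurable J by exact: measurable_itv.
have JE t : J t -> 0 < t /\ t < 1 by rewrite /J/= in_itv/= => /andP[].
have mat u : measurable_fun setT (fun w => a u w) by exact: (measurableT_comp ma (measurable_pair1 u)).
have maw w : measurable_fun setT (fun t => a t w) by exact: (measurableT_comp ma (measurable_pair2 w)).
pose T : set (R * R) := [set z | 0 < z.2 - z.1].
have mT : measurable T by apply: measurable_set_gt; mfun.
have TE (u v : R) : ((u, v) \in T) = (u < v).
  by apply/idP/idP => [/set_mem|uv]; [|apply/mem_set]; rewrite /T/= subr_gt0.
have m1T : measurable_fun setT (\1_T : R * R -> R) by exact: measurable_indic.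
pose q (t t' : R) (w : Om) : \bar R := (a t w * a t' w * \1_T (t, t'))%:E.
have q0 t t' w : (0 <= q t t' w)%E by rewrite lee_fin !mulr_ge0.
have mq d' (X : measurableType d') (u v : X -> R) (e : X -> Om) :
    measurable_fun setT u -> measurable_fun setT v -> measurable_fun setT e ->
    measurable_fun setT (fun x => q (u x) (v x) (e x)).
  move=> mu' mv me; apply/measurable_EFinP; apply: measurable_funM.
    by apply: measurable_funM; exact: (measurable_fun_comp2 ma).
  by apply: (measurableT_comp m1T (g := fun x => (u x, v x))); apply/measurable_fun_pair.
have split2 w : ((\int[mu]_(t in J) (a t w)%:E) * (\int[mu]_(t in J) (a t w)%:E) =
    \int[mu]_(t in J) \int[mu]_(t' in J) q t t' w + \int[mu]_(t in J) \int[mu]_(t' in J) q t t' w)%E.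
  pose Z := (\int[mu]_(t in J) (a t w)%:E)%E; rewrite -/Z.
  have maE : measurable_fun J (fun t => (a t w)%:E) by apply: measurable_funTS; exact/measurable_EFinP.
  have Z0 : (0 <= Z)%E by apply: integral_ge0 => t _; rewrite lee_fin.
  rewrite {1}/Z -ge0_integralZr//; last by move=> t _; rewrite lee_fin.
  have swapq : (\int[mu]_(t in J) \int[mu]_(t' in J) q t' t w = \int[mu]_(t in J) \int[mu]_(t' in J) q t t' w)%E.
    apply: integral_swap => //.
    by apply: (mq _ _ (fun z : R * R => z.2) (fun z => z.1) (fun=> w)); mfun.
  pose f1 t := (\int[mu]_(t' in J) q t t' w)%E; pose f2 t := (\int[mu]_(t' in J) q t' t w)%E.
  have f10 t : J t -> (0 <= f1 t)%E by move=> _; exact: integral_ge0.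
  have f20 t : J t -> (0 <= f2 t)%E by move=> _; exact: integral_ge0.
  have mf1 : measurable_fun J f1.
    apply: measurable_funTS; apply: (measurable_integral_param (f := fun t t' => q t t' w)) => //.
    by apply: (mq _ _ (fun z : R * R => z.1) (fun z => z.2) (fun=> w)); mfun.
  have mf2 : measurable_fun J f2.
    apply: measurable_funTS; apply: (measurable_integral_param (f := fun t t' => q t' t w)) => //.
    by apply: (mq _ _ (fun z : R * R => z.2) (fun z => z.1) (fun=> w)); mfun.
  transitivity (\int[mu]_(t in J) f1 t + \int[mu]_(t in J) f2 t)%E; last by congr (_ + _)%E.
  have <- := ge0_integralD mu mJ f10 mf1 f20 mf2.
  apply: eq_integral => t _.
  have m1 : measurable_fun setT (fun t' => q t t' w) by apply: (mq _ _ (fun=> t) (fun z => z) (fun=> w)); mfun.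
  have m2 : measurable_fun setT (fun t' => q t' t w) by apply: (mq _ _ (fun z => z) (fun=> t) (fun=> w)); mfun.
  have m1J : measurable_fun J (fun t' => q t t' w) by exact: measurable_funTS.
  have m2J : measurable_fun J (fun t' => q t' t w) by exact: measurable_funTS.
  have E12 := ge0_integralD mu mJ (fun t' _ => q0 t t' w) m1J (fun t' _ => q0 t' t w) m2J.
  rewrite /f1 /f2; apply: etrans E12.
  rewrite /Z -ge0_integralZl; [|exact: mJ|exact: maE|by move=> t' _; rewrite lee_fin|by rewrite lee_fin].
  (* The triangles t < t' and t' < t miss only the diagonal, a null set in t'. *)
  apply: ae_eq_integral; [exact: mJ|exact: emeasurable_funM|exact: emeasurable_funD|].
  exists [set t]; split.
  - exact: measurable_set1.
  - exact: lebesgue_measure_set1.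
  move=> t' /= H; apply: contrapT => tn; apply: H => _.
  rewrite /q -EFinM -EFinD !indicE !TE; congr EFin.
  have [tt'|tt'|tE] := ltgtP t t'; last by case: tn.
    by rewrite mulr1 mulr0 addr0.
  by rewrite mulr0 mulr1 add0r mulrC.
pose Q := (\int[mu]_(t in J) \int[mu]_(t' in J) \int[P]_w q t t' w)%E.
have EQ : (\int[P]_w ((\int[mu]_(t in J) (a t w)%:E) * (\int[mu]_(t in J) (a t w)%:E)) = Q + Q)%E.
  under eq_integral do rewrite split2.
  have mqt : measurable_fun setT (fun w => \int[mu]_(t in J) \int[mu]_(t' in J) q t t' w)%E.
    apply: (measurable_integral_param (f := fun w t => \int[mu]_(t' in J) q t t' w)%E) => //; last by move=> w t; exact: integral_ge0.
    apply: (measurable_integral_param (f := fun z t' => q z.2 t' z.1)) => //.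
    by apply: mq; mfun.
  have QE : (\int[P]_w \int[mu]_(t in J) \int[mu]_(t' in J) q t t' w = Q)%E.
    rewrite -(integral_swap_prob P (f := fun t w => \int[mu]_(t' in J) q t t' w)%E)//.
    - apply: eq_integral => t _; rewrite -(integral_swap_prob P (f := fun t' w => q t t' w))//.
      by apply: (mq _ _ (fun=> t) (fun z : R * Om => z.1) (fun z => z.2)); mfun.
    - apply: (measurable_integral_param (f := fun z t' => q z.1 t' z.2)) => //.
      by apply: mq; mfun.
    - by move=> t w; exact: integral_ge0.
  have Q0w w : setT w -> (0 <= \int[mu]_(t in J) \int[mu]_(t' in J) q t t' w)%E.
    by move=> _; apply: integral_ge0 => t _; apply: integral_ge0.
  have := ge0_integralD P measurableT Q0w mqt Q0w mqt.
  by rewrite QE.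
rewrite EQ.
pose H (t : R) : \bar R := (\int[P]_w (G `|B t w| (g t w))%:E)%E.
pose I (t : R) : \bar R := (\int[P]_w (a t w)%:E)%E.
have I0 t : (0 <= I t)%E by apply: integral_ge0 => w _; rewrite lee_fin.
have mI : measurable_fun setT I.
  apply: (@measurable_fun_fubini_tonelli_F _ _ (measurableTypeR R) Om R P (fun z => (a z.1 z.2)%:E)).
    exact/measurable_EFinP.
  by move=> z; rewrite lee_fin.
have gQ : ((gband 1 y)%:E * Q <= (2 * c)%:E * \int[mu]_(t in J) I t)%E.
  have mQt : measurable_fun setT (fun t => \int[mu]_(t' in J) \int[P]_w q t t' w)%E.
    apply: (measurable_integral_param (f := fun t t' => \int[P]_w q t t' w)%E) => //; last by move=> t t'; exact: integral_ge0.
    apply: (@measurable_fun_fubini_tonelli_F _ _ (R * R)%type Om R P (fun z => q z.1.1 z.1.2 z.2)); last by move=> z.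
    by apply: mq; mfun.
  rewrite /Q -ge0_integralZl//; first last.
  - by rewrite lee_fin gband_ge0.
  - by move=> t _; apply: integral_ge0 => t' _; apply: integral_ge0.
  - exact: measurable_funTS.
  rewrite -ge0_integralZl//; first last.
  - by rewrite lee_fin mulr_ge0.
  - exact: measurable_funTS.
  apply: ge0_le_integral => //.
  - by move=> t _; rewrite mule_ge0 ?lee_fin ?gband_ge0//; apply: integral_ge0 => t' _; apply: integral_ge0.
  - by apply: measurable_funTS; apply: emeasurable_funM.
  - by apply: measurable_funTS; apply: emeasurable_funM.
  move=> t /JE[t0 t1].
  have le1 : (\int[mu]_(t' in J) \int[P]_w q t t' w <= (2 * c)%:E * H t)%E.
    apply: le_trans (occ_inner_bound t0 t1); rewrite le_eqVlt; apply/orP; left; apply/eqP.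
    rewrite [LHS]integral_mkcond [RHS]integral_mkcond; apply: eq_integral => t' _.
    rewrite !patchE !mem_setE !in_itv/=.
    have [tt'|tt'] := ltP t t'.
      rewrite (lt_trans t0 tt')/=; case: ifP => // _; apply: eq_integral => w _.
      by rewrite /q indicE TE tt' mulr1.
    rewrite /=; case: ifP => // _; apply: integral0_eq => w _.
    by rewrite /q indicE TE ltNge tt' mulr0.
  apply: (le_trans (lee_wpmul2l _ le1)); first by rewrite lee_fin gband_ge0.
  rewrite muleCA; apply: lee_wpmul2l; first by rewrite lee_fin mulr_ge0.
  have Gy x s : G x s != 0 -> s <= t -> y * Num.sqrt (1 - s) <= x.
    rewrite /G mulf_eq0 negb_or indicE => /andP[+ _] st.
    have r0 : 0 < Num.sqrt (1 - s) by rewrite sqrtr_gt0 subr_gt0 (le_lt_trans st).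
    have [/set_mem|_] := boolP (_ \in A); last by rewrite eqxx.
    by rewrite /A/= in_itv/= ler_pdivlMr// => /andP[].
  apply: (le_trans (occupation_le hB y0 t0 t1 mG G0 Gy)).
  rewrite le_eqVlt; apply/orP; left; apply/eqP; apply: eq_integral => w _.
  rewrite /a (occ_densityE hB A w t0 t1) /G (@ger0_norm _ (1 - g t w))//.
  by have [_ gt _] := last_zero_uptoP hB w (ltW t0); rewrite subr_ge0 (le_trans gt)// ltW.
have Q0 : (0 <= Q)%E by apply: integral_ge0 => t _; apply: integral_ge0 => t' _; apply: integral_ge0.
rewrite ge0_muleDr// (_ : 4 * c = 2 * c + 2 * c); last by ring.
have c2 : (0 <= (2 * c)%:E)%E by rewrite lee_fin; apply: mulr_ge0 => //; exact: c0.
rewrite EFinD (ge0_muleDl _ c2 c2); exact: leeD.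
Qed.

End SecondMoment.

(** * Mean of the local time *)

Lemma dist_min_le {R : realFieldType} (x y K : R) : `|Num.min x K - Num.min y K| <= `|x - y|.
Proof.
rewrite ler_norml; case: (leP x K) => ?; case: (leP y K) => ?; case: (ger0P (x - y)) => ?; apply/andP; split; lra.
Qed.

(** * Passage to the limit in the means *)

Section TruncatedLimit.
Context {R : realType} {d : measure_display} {Om : measurableType d}.
Variables (P : probability Om R) (r : nat -> Om -> R) (l : Om -> R) (D : R).
Hypotheses (mr : forall n, measurable_fun setT (r n)) (ml : measurable_fun setT l).
Hypotheses (r0 : forall n w, 0 <= r n w).
Hypothesis rl : {ae P, forall w, r n w @[n --> \oo] --> l w}.
Hypothesis rD : (\int[P]_w (r n w)%:E)%E @[n --> \oo] --> D%:E.

Let trunc_cvg (K : R) : 0 <= K ->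
  (\int[P]_w (Num.min `|r n w| K)%:E)%E @[n --> \oo] --> (\int[P]_w (Num.min `|l w| K)%:E)%E.
Proof.
move=> K0.
have mt (f : Om -> R) : measurable_fun setT f -> measurable_fun setT (fun w => (Num.min `|f w| K)%:E).
  by move=> mf; apply/measurable_EFinP; apply: measurable_minr => //; exact: measurableT_comp.
suff [] : [/\ P.-integrable setT (fun w => (Num.min `|l w| K)%:E),
    [sequence \int[P]_w `|(Num.min `|r n w| K)%:E - (Num.min `|l w| K)%:E|]_n @ \oo --> 0 &
    [sequence \int[P]_w (Num.min `|r n w| K)%:E]_n @ \oo --> \int[P]_w (Num.min `|l w| K)%:E]%E by [].
apply: (@dominated_convergence _ Om R P setT measurableT
  (fun n w => (Num.min `|r n w| K)%:E) (fun w => (Num.min `|l w| K)%:E) (cst K%:E)).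
- by move=> n; exact: mt.
- exact: mt.
- apply: filterS rl => w rlw _; apply: cvg_EFin; first by near=> n.
  apply/cvgrPdist_lt => e e0; near=> n.
  have : `|l w - r n w| < e by near: n; move/cvgrPdist_lt: rlw; apply.
  apply: le_lt_trans; apply: (le_trans _ (ler_dist_dist _ _)) => /=.
  exact: dist_min_le.
- exact: finite_measure_integrable_cst.
- apply: aeW => w n _; rewrite /= ger0_norm ?le_min ?normr_ge0 ?K0//.
  by rewrite lee_fin ge_min lexx orbT.
Unshelve. all: by end_near. Qed.

Let lee_cvg (u v : nat -> \bar R) (a b : \bar R) :
  u @ \oo --> a -> v @ \oo --> b -> (forall n, (u n <= v n)%E) -> (a <= b)%E.
Proof.
move=> ua vb uv; rewrite -(cvg_lim _ ua)// -(cvg_lim _ vb)//.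
by apply: lee_lim; [apply/cvg_ex; exists a | apply/cvg_ex; exists b | near=> n].
Unshelve. all: by end_near. Qed.

(** A form of Fatou's lemma: the truncated means converge and stay below the means of [r]; the
    truncation is then removed by monotone convergence. *)
Lemma integral_norm_limit_le : (\int[P]_w `|l w|%:E <= D%:E)%E.
Proof.
pose g (k : nat) w := (Num.min `|l w| k%:R)%:E.
have mg k : measurable_fun setT (g k).
  by apply/measurable_EFinP; apply: measurable_minr => //; exact: measurableT_comp.
have g0 k w : setT w -> (0 <= g k w)%E by move=> _; rewrite lee_fin le_min normr_ge0 ler0n.
have ndg w : setT w -> nondecreasing_seq (g ^~ w).
  by move=> _ a b ab; rewrite lee_fin le_min ge_min lexx/= ge_min ler_nat ab orbT.
have glim w : limn (g ^~ w) = `|l w|%:E.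
  apply/cvg_lim => //; apply: (cvg_near_cst) => //.
  near=> k; rewrite /g min_l//.
  by near: k; exact: nbhs_infty_ger.
have := @cvg_monotone_convergence _ _ _ P _ measurableT g mg g0 ndg.
under [X in _ --> X -> _]eq_integral do rewrite glim.
move=> H; rewrite -(cvg_lim _ H)//; apply: lime_le; first by apply/cvg_ex; eexists; exact: H.
near=> k; apply: (lee_cvg (trunc_cvg (ler0n _ k)) rD) => n.
have mrn : measurable_fun setT (fun w => (r n w)%:E) by exact/measurable_EFinP.
apply: ge0_le_integral => //.
- by apply/measurable_EFinP; apply: measurable_minr => //; exact: measurableT_comp.
- by move=> w _; rewrite lee_fin ger0_norm// ge_min lexx.
Unshelve. all: by end_near. Qed.

(* Since r <= min r K + r^2 / K, bounded second moments keep the mass from escaping. *)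
Lemma integral_norm_limit_ge (M : R) : (forall n, \int[P]_w (r n w * r n w)%:E <= M%:E)%E ->
  (D%:E <= \int[P]_w `|l w|%:E)%E.
Proof.
move=> rM.
have H (K : R) : 0 < K -> (D%:E <= \int[P]_w `|l w|%:E + (K^-1 * M)%:E)%E.
  move=> K0.
  apply: (@le_trans _ _ (\int[P]_w (Num.min `|l w| K)%:E + (K^-1 * M)%:E)%E); last first.
    apply: leeD2r; apply: ge0_le_integral => //.
    - by move=> w _; rewrite lee_fin le_min normr_ge0 ltW.
    - by apply/measurable_EFinP; apply: measurable_minr => //; exact: measurableT_comp.
    - by apply/measurable_EFinP; exact: measurableT_comp.
    - by move=> w _; rewrite lee_fin ge_min lexx.
  have cv : ((\int[P]_w (Num.min `|r n w| K)%:E) + (K^-1 * M)%:E)%E @[n --> \oo] -->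
      ((\int[P]_w (Num.min `|l w| K)%:E) + (K^-1 * M)%:E)%E.
    by apply: cvgeD; [exact: fin_num_adde_defl | exact: trunc_cvg (ltW K0) | exact: cvg_cst].
  apply: (lee_cvg rD cv) => n.
  apply: (@le_trans _ _ (\int[P]_w ((Num.min `|r n w| K)%:E + (K^-1)%:E * (r n w * r n w)%:E))%E).
    apply: ge0_le_integral => //.
    - by move=> w _; rewrite lee_fin.
    - exact/measurable_EFinP.
    - apply: emeasurable_funD.
        by apply/measurable_EFinP; apply: measurable_minr => //; exact: measurableT_comp.
      by apply: emeasurable_funM => //; apply/measurable_EFinP; exact: measurable_funM.
    - move=> w _; rewrite lee_fin ger0_norm//; move: (r0 n w); set x := r n w => x0.
      have [xK|Kx] := leP x K; first by rewrite lerDl mulr_ge0 ?invr_ge0 ?mulr_ge0// ltW.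
      rewrite -[leLHS]add0r lerD ?(ltW K0)// mulrA ler_peMl//.
      by rewrite mulrC ler_pdivlMr// mul1r ltW.
  rewrite ge0_integralD//=; last 4 first.
  - by move=> w _; rewrite lee_fin le_min normr_ge0 ltW.
  - by apply/measurable_EFinP; apply: measurable_minr => //; exact: measurableT_comp.
  - by move=> w _; rewrite lee_fin mulr_ge0 ?invr_ge0 ?mulr_ge0// ltW.
  - by apply: emeasurable_funM => //; apply/measurable_EFinP; exact: measurable_funM.
  rewrite leeD2l// ge0_integralZl//; last 3 first.
  - by apply/measurable_EFinP; exact: measurable_funM.
  - by move=> w _; rewrite lee_fin mulr_ge0.
  - by rewrite lee_fin invr_ge0 ltW.
  by rewrite EFinM lee_pmul2l ?lte_fin ?invr_gt0.
apply/lee_addgt0Pr => e e0.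
have M0 : 0 <= M.
  by rewrite -lee_fin; apply: le_trans (rM 0%N); apply: integral_ge0 => w _; rewrite lee_fin mulr_ge0.
(* M + 1 keeps the truncation level positive when M = 0. *)
apply: (le_trans (H ((M + 1) / e) _)); first by rewrite divr_gt0// ltr_pwDr.
rewrite leeD2l// lee_fin invf_div mulrAC ler_pdivrMr ?ltr_pwDr//.
by rewrite ler_pM2l// lerDl.
Unshelve. all: by end_near. Qed.

End TruncatedLimit.

Section OccupationTime.
Context {R : realType} {d : measure_display} {Om : measurableType d}.
Variables (P : probability Om R) (X : R -> Om -> R).
Hypothesis mX : measurable_fun setT (fun z : R * Om => X (clip01 z.1) z.2).
Variable A : set R.
Hypothesis mA : measurable A.
Notation mu := (@lebesgue_measure R).

Definition occupation_time (w : Om) : \bar R := (\int[mu]_(u in `[0%R, 1%R]) (\1_A (X u w))%:E)%E.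

Let m1A : measurable_fun setT (\1_A : R -> R). Proof. exact: measurable_indic. Qed.

Let mind : measurable_fun setT (fun z : R * Om => (\1_A (X (clip01 z.1) z.2) : R)%:E).
Proof. by apply/measurable_EFinP; exact: (measurableT_comp m1A mX). Qed.

Let occE w : occupation_time w = (\int[mu]_(u in `[0%R, 1%R]) (\1_A (X (clip01 u) w))%:E)%E.
Proof. by apply: eq_integral => u; rewrite inE/= in_itv/= => u01; rewrite clip01_id. Qed.

Let mXu u : 0 <= u <= 1 -> measurable_fun setT (X u).
Proof.
move=> u01; rewrite (_ : X u = (fun w => X (clip01 u) w)); last by rewrite clip01_id.
by apply: (measurableT_comp mX (g := fun w : Om => (u, w))); apply/measurable_fun_pair.
Qed.

Lemma measurable_slice_event u : 0 <= u <= 1 -> measurable [set w | A (X u w)].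
Proof. by move=> u01; rewrite -[Y in measurable Y]setTI; exact: (mXu u01 measurableT mA). Qed.

Lemma measurable_occupation_time : measurable_fun setT occupation_time.
Proof.
rewrite (_ : occupation_time = (fun w => \int[mu]_(u in `[0%R, 1%R]) (\1_A (X (clip01 u) w))%:E)%E); last exact/funext.
apply: (measurable_integral_param (f := fun w u => (\1_A (X (clip01 u) w) : R)%:E)) => //.
by apply: (measurableT_comp mind (g := fun z : Om * R => (z.2, z.1))); apply/measurable_fun_pair.
Qed.

Lemma occupation_time_ge0 w : (0 <= occupation_time w)%E.
Proof. by apply: integral_ge0 => u _; rewrite lee_fin. Qed.

Lemma occupation_time_le1 w : (occupation_time w <= 1)%E.
Proof.
have -> : (1 = \int[mu]_(u in `[0%R, 1%R]) (cst 1%E u) :> \bar R)%E.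
  by rewrite integral_cst//= mul1e lebesgue_measure_itv/= lte_fin ltr01 oppr0 adde0.
rewrite occE; apply: ge0_le_integral => //.
- apply: measurable_funTS; apply: (measurableT_comp mind (g := fun u : R => (u, w))).
  by apply/measurable_fun_pair.
- by move=> u _; rewrite /= lee_fin indicE; case: (_ \in _).
Qed.

Lemma integral_occupation_time :
  (\int[P]_w occupation_time w = \int[mu]_(u in `[0%R, 1%R]) P [set w | A (X u w)])%E.
Proof.
under eq_integral do rewrite occE.
rewrite -(integral_swap_prob P (f := fun u w => (\1_A (X (clip01 u) w) : R)%:E))//.
apply: eq_integral => u; rewrite inE/= in_itv/= => u01.
rewrite (measure_integral_indic P (measurable_slice_event u01)).
by apply: eq_integral => w _; rewrite clip01_id// !indicE.
Qed.

(** The second moment depends only on two-time events, which are path events and hence have the same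
    probability for the meander and for its Brownian construction. *)
Lemma integral_occupation_time_sqr :
  (\int[P]_w (occupation_time w * occupation_time w) =
   \int[mu]_(u in `[0%R, 1%R]) \int[mu]_(v in `[0%R, 1%R]) P ([set w | A (X u w)] `&` [set w | A (X v w)]))%E.
Proof.
have moc2 : measurable_fun setT (fun z : R * Om => occupation_time z.2).
  exact: (measurableT_comp measurable_occupation_time measurable_snd).
transitivity (\int[P]_w \int[mu]_(u in `[0%R, 1%R]) ((\1_A (X (clip01 u) w))%:E * occupation_time w))%E.
  apply: eq_integral => w _; rewrite {1}occE ge0_integralZr//.
  - apply: measurable_funTS; apply: (measurableT_comp mind (g := fun u : R => (u, w))).
    by apply/measurable_fun_pair.
  - exact: occupation_time_ge0.
rewrite -(integral_swap_prob P (f := fun u w => ((\1_A (X (clip01 u) w) : R)%:E * occupation_time w)%E))//; last 2 first.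
- exact: emeasurable_funM.
- by move=> u w; rewrite mule_ge0 ?lee_fin ?occupation_time_ge0.
apply: eq_integral => u; rewrite inE/= in_itv/= => u01.
have mu1 : measurable_fun setT (fun w : Om => (\1_A (X u w) : R)%:E).
  by apply/measurable_EFinP; exact: (measurableT_comp m1A (mXu u01)).
transitivity (\int[P]_w \int[mu]_(v in `[0%R, 1%R]) ((\1_A (X u w))%:E * (\1_A (X (clip01 v) w))%:E))%E.
  apply: eq_integral => w _; rewrite occE clip01_id// ge0_integralZl//.
  apply: measurable_funTS; apply: (measurableT_comp mind (g := fun u : R => (u, w))).
  by apply/measurable_fun_pair.
rewrite -(integral_swap_prob P (f := fun v w => ((\1_A (X u w) : R)%:E * (\1_A (X (clip01 v) w) : R)%:E)%E))//; last first.
  apply: emeasurable_funM => //.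
  exact: (measurableT_comp mu1 measurable_snd).
apply: eq_integral => v; rewrite inE/= in_itv/= => v01.
rewrite (measure_integral_indic P (measurableI _ _ (measurable_slice_event u01) (measurable_slice_event v01))).
apply: eq_integral => w _; rewrite clip01_id// indicI/= EFinM !indicE.
by [].
Qed.

End OccupationTime.
Arguments occupation_time {R d Om} X A w.

Section MeanderCopy.
Context {R : realType} {d d' : measure_display} {Om : measurableType d} {Om' : measurableType d'}.
Variables (P : probability Om R) (m : R -> {RV P >-> R}).
Variables (P' : probability Om' R) (B : R -> {RV P' >-> R}).
Hypothesis cm : forall w, {within `[0, 1], continuous (fun u => m u w)}.
Hypothesis hB : brownian_motion P' B.
Hypothesis hlaw : forall C : set (R -> R), path_events `[0, 1]%classic C ->
  P [set w | C (m ^~ w)] = P' [set w | C (meander_path (B ^~ w))].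
Notation mu := (@lebesgue_measure R).

Definition level_density (y : R) : \bar R := (2%:E * \int[mu]_(z in `[y, (2 * y)%R]) (expR (- z ^+ 2 / 2))%:E)%E.

Let path_eval (A : set R) u : measurable A -> 0 <= u <= 1 -> path_events `[0, 1]%classic [set x : R -> R | A (x u)].
Proof. by move=> mA u01; apply: sub_sigma_algebra; exists u, A; split => //=; rewrite in_itv/=. Qed.

Lemma meander_marginal (A : set R) u : measurable A -> 0 <= u <= 1 ->
  P [set w | A (m u w)] = P' [set w | A (meander_path (B ^~ w) u)].
Proof. by move=> mA u01; exact: (hlaw (path_eval mA u01)). Qed.

Lemma meander_marginal2 (A : set R) u v : measurable A -> 0 <= u <= 1 -> 0 <= v <= 1 ->
  P ([set w | A (m u w)] `&` [set w | A (m v w)]) =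
  P' ([set w | A (meander_path (B ^~ w) u)] `&` [set w | A (meander_path (B ^~ w) v)]).
Proof.
move=> mA u01 v01.
apply: (hlaw (C := [set x : R -> R | A (x u)] `&` [set x : R -> R | A (x v)])).
exact: (@measurableI _ (g_sigma_algebraType [set C | exists t, exists A : set R,
         [/\ `[0, 1]%classic t, measurable A & C = [set x : R -> R | A (x t)]]])
   _ _ (path_eval mA u01) (path_eval mA v01)).
Qed.

Lemma measurable_meander : measurable_fun setT (fun z : R * Om => m (clip01 z.1) z.2).
Proof.
apply: (measurable_continuous_process (X := fun t w => m t w)).
- by move=> t _; exact: measurable_funPT.
- by move=> w; apply: within_continuous01; exact: cm.
Qed.

Section Level.
Variable A : set R.
Hypothesis mA : measurable A.

Lemma meander_occupation_mean :
  (\int[P]_w occupation_time m A w = \int[mu]_(y in `]0%R, +oo[) ((\1_A y)%:E * level_density y))%E.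
Proof.
rewrite (integral_occupation_time P measurable_meander mA) -(meander_time_law hB mA).
by apply: eq_integral => u; rewrite inE/= in_itv/= => u01; exact: meander_marginal.
Qed.

Lemma meander_occupation_sqr :
  (\int[P]_w (occupation_time m A w * occupation_time m A w) =
   \int[P']_w ((\int[mu]_(t in `]0%R, 1%R[) (occ_density B A t w)%:E) *
               (\int[mu]_(t in `]0%R, 1%R[) (occ_density B A t w)%:E)))%E.
Proof.
rewrite (integral_occupation_time_sqr P measurable_meander mA).
transitivity (\int[P']_w (occupation_time (fun u w => meander_path (B ^~ w) u) A w *
                          occupation_time (fun u w => meander_path (B ^~ w) u) A w))%E.
  rewrite (integral_occupation_time_sqr P' (X := fun u w => meander_path (B ^~ w) u) (measurable_meander_path hB) mA).
  apply: eq_integral => u; rewrite inE/= in_itv/= => u01.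
  apply: eq_integral => v; rewrite inE/= in_itv/= => v01.
  exact: meander_marginal2.
have m1 := measurable_occupation_time (X := fun u w => meander_path (B ^~ w) u) (measurable_meander_path hB) mA.
have m2 := measurable_occ_time hB mA (measurable_itv `]0%R, 1%R[).
apply: ae_eq_integral => //; [exact: emeasurable_funM | exact: emeasurable_funM |].
by apply: filterS (meander_occupation_ae hB mA) => w + _ => /(_ I) <-.
Qed.

Lemma occ_density_mean :
  (\int[mu]_(t in `]0%R, 1%R[) \int[P']_w (occ_density B A t w)%:E = \int[P]_w occupation_time m A w)%E.
Proof.
rewrite (integral_swap_prob P' (f := fun t w => (occ_density B A t w)%:E))//; last 2 first.
- by apply/measurable_EFinP; exact: (measurable_occ_density hB).
- by move=> t w; rewrite lee_fin occ_density_ge0.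
rewrite (integral_occupation_time P measurable_meander mA).
transitivity (\int[P']_w occupation_time (fun u w => meander_path (B ^~ w) u) A w)%E.
  apply: ae_eq_integral => //.
  - exact: (measurable_occ_time hB mA).
  - exact: (measurable_occupation_time (X := fun u w => meander_path (B ^~ w) u) (measurable_meander_path hB) mA).
  - by apply: filterS (meander_occupation_ae hB mA) => w + _ => /(_ I) <-.
rewrite (integral_occupation_time P' (X := fun u w => meander_path (B ^~ w) u) (measurable_meander_path hB) mA).
by apply: eq_integral => u; rewrite inE/= in_itv/= => u01; rewrite -meander_marginal.
Qed.

End Level.

(** The mean on the right is itself at most of order delta, so the second moment is at most of order
    delta^2: occupation times divided by delta stay bounded in mean square. *)
Lemma meander_second_moment (y delta : R) : 0 < y -> 0 < delta ->
  ((gband 1 y)%:E * \int[P]_w (occupation_time m `[y, (y + delta)%R]%classic w * occupation_time m `[y, (y + delta)%R]%classic w) <=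
   (4 * (2 * (delta / Num.sqrt (2 * pi))))%:E * \int[P]_w occupation_time m `[y, (y + delta)%R]%classic w)%E.
Proof.
move=> y0 d0.
rewrite meander_occupation_sqr; last exact: measurable_itv.
rewrite -occ_density_mean; last exact: measurable_itv.
exact: (occupation_second_moment hB y0 d0).
Qed.

End MeanderCopy.

(** * Regularity of the level density *)

Section LevelDensity.
Context {R : realType}.
Notation mu := (@lebesgue_measure R).
Notation ld := (@level_density R).

Let e (z : R) : \bar R := (expR (- z ^+ 2 / 2))%:E.

Let e0 z : (0 <= e z)%E. Proof. by rewrite lee_fin expR_ge0. Qed.

Let me : measurable_fun setT e. Proof. by apply/measurable_EFinP; mfun. Qed.

Lemma level_density_ge0 y : (0 <= ld y)%E.
Proof. by rewrite mule_ge0 ?lee_fin//; apply: integral_ge0. Qed.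

Lemma level_density0 : ld 0 = 0%E.
Proof. by rewrite /level_density mulr0 set_itv1 integral_set1 mule0. Qed.

Lemma measurable_level_density : measurable_fun setT ld.
Proof.
apply: emeasurable_funM => //.
pose S : set (R * R) := [set p | p.1 <= p.2] `&` [set p | p.2 <= 2 * p.1].
have mS : measurable S.
  rewrite (_ : S = [set p | p.1 - p.2 <= 0] `&` [set p | p.2 - 2 * p.1 <= 0]).
    by apply: measurableI; apply: measurable_set_le; mfun.
  by apply/seteqP; split => p; rewrite /S/= !subr_le0.
rewrite (_ : (fun y => _) = (fun y => \int[mu]_(z in setT) ((\1_S (y, z) : R)%:E * e z))%E).
  apply: (measurable_integral_param (f := fun y z => (\1_S (y, z) : R)%:E * e z)%E) => //.
  - apply: emeasurable_funM; last exact: (measurableT_comp me measurable_snd).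
    apply/measurable_EFinP; rewrite (_ : (fun z : R * R => _) = \1_S); first exact: measurable_indic.
    by apply/funext => -[].
  - by move=> y z; rewrite mule_ge0// lee_fin.
apply/funext => y; rewrite integral_mkcond; apply: eq_integral => z _.
rewrite patchE mem_setE in_itv/= indicE; case: ifP => H.
  by rewrite mem_set ?mul1e//; have /andP[? ?] := H.
by rewrite memNset ?mul0e//; move=> [/= h1 h2]; rewrite h1 h2 in H.
Qed.

(** The integrand is at most 1, so the part covered by [[c, c']] costs at most its length. *)
Let cover (a b c c' b' a' : R) : c <= c' -> `[a, a']%classic `<=` `[b, b']%classic `|` `[c, c']%classic ->
  (\int[mu]_(z in `[a, a']) e z <= \int[mu]_(z in `[b, b']) e z + (c' - c)%:E)%E.
Proof.
move=> cc' sub.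
have mI x x' : measurable (`[x, x']%classic : set R) by exact: measurable_itv.
have mf D : measurable_fun (D : set R) e by exact: measurable_funTS.
have mC : measurable (`[c, c']%classic `\` `[b, b']%classic : set R) by exact: measurableD.
apply: le_trans (ge0_subset_integral mu (mI a a') (measurableU _ _ (mI b b') mC) (mf _) (fun z _ => e0 z) _) _.
  by move=> z /sub [Bz|Cz]; [left | have [Bz|nBz] := pselect (`[b, b']%classic z); [left | right]].
rewrite ge0_integral_setU//; last 2 first.
- exact: mf.
- by rewrite disj_set2E; apply/eqP/seteqP; split => // z [Bz [_]]; apply.
apply: leeD2l; apply: le_trans (ge0_subset_integral mu mC (mI c c') (mf _) (fun z _ => e0 z) (@subDsetl _ _ _)) _.
have -> : ((c' - c)%:E = \int[mu]_(z in `[c, c']) (cst 1%E z))%E.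
  rewrite integral_cst//= mul1e lebesgue_measure_itv/= lte_fin.
  by case: ltP => // h; have -> : c' = c by [apply/le_anti/andP]; rewrite subrr.
apply: ge0_le_integral => //; first exact: mf.
move=> z _; rewrite lee_fin -expR0 ler_expR mulNr oppr_le0.
by rewrite divr_ge0// sqr_ge0.
Qed.

Let ld_cover (a b k : R) : 0 <= k -> (\int[mu]_(z in `[a, (2 * a)%R]) e z <= \int[mu]_(z in `[b, (2 * b)%R]) e z + (2 * k)%:E)%E ->
  (ld a <= ld b + (4 * k)%:E)%E.
Proof.
move=> k0 h; rewrite /level_density.
apply: (@le_trans _ _ (2%:E * (\int[mu]_(z in `[b, (2 * b)%R]) e z + (2 * k)%:E))%E).
  by rewrite lee_wpmul2l ?lee_fin.
rewrite ge0_muleDr ?integral_ge0 ?lee_fin ?mulr_ge0//.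
by rewrite -EFinM leeD2l// lee_fin; lra.
Qed.

(** [z, 2 z] is covered by [y, 2 y] and [2 y, 2 z]; the latter has length 2 (z - y), doubled by the
    prefactor. *)
Lemma level_density_le y z : 0 <= y -> y <= z -> (ld z <= ld y + (4 * (z - y))%:E)%E.
Proof.
move=> y0 yz; apply: ld_cover; first by rewrite subr_ge0.
rewrite (_ : 2 * (z - y) = 2 * z - 2 * y); last by lra.
apply: cover; first by lra.
move=> x /=; rewrite !in_itv/= => /andP[h1 h2].
by have [h|h] := leP x (2 * y); [left | right]; apply/andP; split; lra.
Qed.

(** [y, 2 y] is covered by [y, z] and [z, 2 z]; the constant 4 is kept to match
    [level_density_le]. *)
Lemma level_density_ge y z : 0 <= y -> y <= z -> (ld y <= ld z + (4 * (z - y))%:E)%E.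
Proof.
move=> y0 yz; apply: ld_cover; first by rewrite subr_ge0.
apply: (@le_trans _ _ (\int[mu]_(x in `[z, (2 * z)%R]) e x + (z - y)%:E)%E); last first.
  by apply: leeD2l; rewrite lee_fin; lra.
apply: cover => // x /=; rewrite !in_itv/= => /andP[h1 h2].
by have [h|h] := leP x z; [right | left]; apply/andP; split; lra.
Qed.

Lemma level_density_fin y : 0 <= y -> ld y \is a fin_num.
Proof.
move=> y0; rewrite ge0_fin_numE ?level_density_ge0//.
by apply: le_lt_trans (level_density_le (lexx 0) y0) _; rewrite level_density0 add0e ltry.
Qed.

Lemma level_density_itv (y delta : R) : 0 <= y -> 0 < delta ->
  let I := (\int[mu]_(x in `]0%R, +oo[) ((\1_`[y, (y + delta)%R]%classic x)%:E * ld x))%E in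
  (I <= (ld y + (4 * delta)%:E) * delta%:E)%E /\ (ld y * delta%:E <= I + (4 * delta * delta)%:E)%E.
Proof.
move=> y0 d0 I; set A := `[y, (y + delta)%R]%classic.
have mA : measurable A by exact: measurable_itv.
have mldA : measurable_fun A ld by apply: measurable_funTS; exact: measurable_level_density.
have muA : mu A = delta%:E.
  by rewrite lebesgue_measure_itv/= lte_fin ltrDl d0 -EFinD addrAC subrr add0r.
have ci (c : \bar R) : (\int[mu]_(x in A) cst c x = c * delta%:E)%E by rewrite -muA; exact: integral_cst.
have IE : I = (\int[mu]_(x in A) ld x)%E.
  rewrite /I [LHS]integral_mkcond [RHS]integral_mkcond; apply: eq_integral => x _.
  rewrite !patchE !mem_setE !in_itv/= andbT indicE -/A mem_setE in_itv/=.
  case: (ltP 0 x) => x0; first by case: ifP => _; rewrite ?mul1e ?mul0e.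
  (* For y = 0 the window contains 0, outside the domain of integration, but the density vanishes
     there. *)
  case: ifP => // /andP[yx _]; have -> : x = 0 by apply/le_anti/andP; split => //; exact: le_trans yx.
  by rewrite level_density0.
have xA x : A x -> y <= x <= y + delta by rewrite /A/= in_itv.
rewrite IE; split.
  apply: (@le_trans _ _ (\int[mu]_(x in A) (cst (ld y + (4 * delta)%:E)%E x))%E); last by rewrite ci.
  apply: ge0_le_integral => //.
  - by move=> x _; exact: level_density_ge0.
  - move=> x /xA /andP[h1 h2]; apply: le_trans (level_density_le y0 h1) _.
    by apply: leeD2l; rewrite lee_fin; lra.
apply: (@le_trans _ _ (\int[mu]_(x in A) (ld x + (4 * delta)%:E))%E); last first.
  rewrite ge0_integralD//; last 2 first.
  - by move=> x _; exact: level_density_ge0.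
  - by move=> x _; rewrite lee_fin mulr_ge0// ltW.
  by rewrite (ci (4 * delta)%:E) -EFinM.
rewrite -ci; apply: ge0_le_integral => //.
- by move=> x _; exact: level_density_ge0.
- by apply: emeasurable_funD.
- move=> x /xA /andP[h1 h2]; apply: le_trans (level_density_ge y0 h1) _.
  by apply: leeD2l; rewrite lee_fin; lra.
Qed.

Lemma gband_gt0 (a : R) : 0 < a -> 0 < gband 1 a.
Proof.
move=> a0; rewrite -lte_fin gbandE /gauss_band.
have mA : measurable (`[0, a / 2]%classic : set R) by exact: measurable_itv.
apply: (@lt_le_trans _ _ (@normal_prob R 0 1 `[0, a / 2]%classic)); last first.
  apply: le_measure; rewrite ?inE//; first exact: measurable_band.
  move=> x /=; rewrite in_itv/= mul1r => /andP[x0 xa].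
  by rewrite ger0_norm//; apply: (le_lt_trans xa); lra.
rewrite /normal_prob normal_pdf01.
apply: (@lt_le_trans _ _ (\int[mu]_(x in `[0%R, (a / 2)%R]) (gauss_pdf a)%:E)%E).
  have muE : mu `[0, a / 2]%classic = (a / 2)%:E.
    by rewrite lebesgue_measure_itv/= lte_fin divr_gt0// oppr0 adde0.
  by rewrite integral_cst// [X in (_ * X)%E]muE -EFinM lte_fin mulr_gt0 ?gauss_pdf_gt0// divr_gt0.
apply: ge0_le_integral => //.
- by move=> x _; rewrite lee_fin ltW// gauss_pdf_gt0.
- by apply: measurable_funTS; apply/measurable_EFinP; exact: measurable_gauss_pdf.
- move=> x /=; rewrite in_itv/= => /andP[x0 xa]; rewrite lee_fin /gauss_pdf ler_pM2l; last first.
    by rewrite invr_gt0 sqrtr_gt0 mulr_gt0 ?pi_gt0.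
  rewrite ler_expR !mulNr lerN2 ler_pM2r ?invr_gt0// ler_sqr ?nnegrE//; last exact: ltW.
  by apply: (le_trans xa); lra.
Qed.

End LevelDensity.

Section LocalTimeMean.
Context {R : realType} {d d' : measure_display} {Om : measurableType d} {Om' : measurableType d'}.
Variables (P : probability Om R) (m L : R -> {RV P >-> R}).
Variables (P' : probability Om' R) (B : R -> {RV P' >-> R}).
Hypothesis cm : forall w, {within `[0, 1], continuous (fun u => m u w)}.
Hypothesis hB : brownian_motion P' B.
Hypothesis hlaw : forall C : set (R -> R), path_events `[0, 1]%classic C ->
  P [set w | C (m ^~ w)] = P' [set w | C (meander_path (B ^~ w))].
Hypothesis hL : local_times P m L.
Notation mu := (@lebesgue_measure R).

Variable y : R.
Hypothesis y0 : 0 <= y.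

Let dl (n : nat) : R := n.+1%:R^-1.

Let dl0 n : 0 < dl n. Proof. by rewrite invr_gt0 ltr0n. Qed.

(** The windows lie to the right of [y] so that [y] = 0 is allowed. *)
Let A (n : nat) : set R := `[y, (y + dl n)%R]%classic.

Let mA n : measurable (A n). Proof. exact: measurable_itv. Qed.

Let Z n w := occupation_time m (A n) w.

Let muA n : mu (A n) = (dl n)%:E.
Proof. by rewrite lebesgue_measure_itv/= lte_fin ltrDl dl0 -EFinD addrAC subrr add0r. Qed.

(** By the occupation formula this is almost surely the average of L over [A n]. *)
Definition mean_local_time (n : nat) (w : Om) : R := n.+1%:R * fine (Z n w).

Let rE n w : (mean_local_time n w)%:E = (n.+1%:R%:E * Z n w)%E.
Proof.
rewrite /mean_local_time EFinM fineK// ge0_fin_numE ?occupation_time_ge0//.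
exact: le_lt_trans (occupation_time_le1 (measurable_meander cm) (mA n) w) (ltry _).
Qed.

Let r0 n w : 0 <= mean_local_time n w.
Proof. by rewrite mulr_ge0// fine_ge0// occupation_time_ge0. Qed.

Let mZ n : measurable_fun setT (Z n). Proof. exact: (measurable_occupation_time (measurable_meander cm)). Qed.

Let mr n : measurable_fun setT (mean_local_time n).
Proof.
apply/measurable_EFinP; rewrite (_ : _ \o _ = (fun w => n.+1%:R%:E * Z n w)%E); last by apply/funext => w; rewrite -rE.
by apply: emeasurable_funM.
Qed.

Let rl : {ae P, forall w, mean_local_time n w @[n --> \oo] --> L y w}.
Proof.
apply: filterS hL => w [cL HL]; apply/cvgrPdist_le => e e0.
have /subspace_continuousP := cL => /(_ y); rewrite /= in_itv/= andbT => /(_ y0) /cvgrPdist_le /(_ e e0) [eta /= eta0 H].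
near=> n.
have dn : dl n < eta by near: n; exact: (near_infty_natSinv_lt (PosNum eta0)).
have HA x : A n x -> `|L y w - L x w| <= e.
  rewrite /A/= in_itv/= => /andP[h1 h2]; apply: H => /=; last by rewrite in_itv/= andbT (le_trans y0).
  by rewrite distrC ger0_norm ?subr_ge0//; lra.
have mL : measurable_fun (A n) (fun x => L x w).
  have mL0 : measurable_fun (`[0, +oo[%classic : set R) (fun x => L x w : R).
    by apply: subspace_continuous_measurable_fun => //; exact: measurable_itv.
  apply: (measurable_funS _ _ mL0); first exact: measurable_itv.
  by move=> x; rewrite /A/= !in_itv/= andbT => /andP[h _]; exact: le_trans h.
have iL : mu.-integrable (A n) (fun x => (L x w)%:E).
  apply: (@measurable_bounded_integrable _ _ R mu (fun x => L x w) (A n) (mA n)) => //.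
    by rewrite [X in (X < _)%E]muA ltry.
  exists (`|L y w| + e); split; first exact: num_real.
  move=> M hM x Ax; apply: le_trans (ltW hM).
  by rewrite -lerBlDl; apply: le_trans (HA x Ax); rewrite distrC; exact: le_trans (ler_norm _) (ler_dist_dist _ _).
have iC c : mu.-integrable (A n) (EFin \o cst c).
  apply: (@measurable_bounded_integrable _ _ R mu (cst c) (A n) (mA n)) => //.
    by rewrite [X in (X < _)%E]muA ltry.
  by exists `|c|; split; [exact: num_real | move=> M hM x _; exact: ltW].
have ZE : Z n w = (\int[mu]_(x in A n) (L x w)%:E)%E.
  rewrite /Z /occupation_time (HL (\1_(A n))) ?measurable_indic//.
  rewrite [LHS]integral_mkcond [RHS]integral_mkcond; apply: eq_integral => x _.
  rewrite !patchE indicE !mem_setE !in_itv/= andbT.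
  case: ifP => x0; first by case: ifP => _; rewrite ?mul1r ?mul0r.
  by case: ifP => // /andP[h _]; rewrite (le_trans y0 h) in x0.
have dln : (dl n)%:E != 0%E by rewrite eqe gt_eqF.
have n0 : 0 < n.+1%:R :> R by rewrite ltr0n.
have ci c : (\int[mu]_(x in A n) (EFin \o cst c) x)%E = (c * dl n)%:E.
  by rewrite (integral_cst mu (mA n) c%:E) [X in (_ * X)%E]muA.
have lo : ((L y w - e)%:E <= (mean_local_time n w)%:E)%E.
  rewrite rE ZE -lee_pdivrMl// -EFinM mulrC -ci; apply: le_integral => //; first exact: mA.
  by move=> x /set_mem /HA; rewrite lee_fin /= ler_norml; lra.
have hi : ((mean_local_time n w)%:E <= (L y w + e)%:E)%E.
  rewrite rE ZE -lee_pdivlMl// -EFinM mulrC -ci; apply: le_integral => //; first exact: mA.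
  by move=> x /set_mem /HA; rewrite lee_fin /= ler_norml; lra.
by move: lo hi; rewrite !lee_fin ler_norml; lra.
Unshelve. all: by end_near. Qed.

(** The sign comes from the occupation times that approximate L. *)
Let L_ge0 : {ae P, forall w, 0 <= L y w}.
Proof.
apply: filterS rl => w h; rewrite -(cvg_lim _ h)//; apply: limr_ge; first by apply/cvg_ex; exists (L y w).
by near=> n; exact: r0.
Unshelve. all: by end_near. Qed.

Let ErE n : (\int[P]_w (mean_local_time n w)%:E = n.+1%:R%:E * \int[P]_w Z n w)%E.
Proof.
under eq_integral do rewrite rE.
by rewrite ge0_integralZl// => w _; exact: occupation_time_ge0.
Qed.

Let dlV n : (n.+1%:R%:E * (dl n)%:E = 1 :> \bar R)%E.
Proof. by rewrite -EFinM divff ?pnatr_eq0. Qed.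

Let Er_le n : (\int[P]_w (mean_local_time n w)%:E <= level_density y + (4 * dl n)%:E)%E.
Proof.
rewrite ErE (meander_occupation_mean cm hB hlaw (mA n)).
have [h _] := level_density_itv y0 (dl0 n).
apply: (@le_trans _ _ (n.+1%:R%:E * ((level_density y + (4 * dl n)%:E) * (dl n)%:E))%E).
  by apply: lee_wpmul2l => //; rewrite lee_fin.
by rewrite muleCA dlV mule1.
Qed.

Let Er_ge n : (level_density y + (- (4 * dl n))%:E <= \int[P]_w (mean_local_time n w)%:E)%E.
Proof.
rewrite ErE (meander_occupation_mean cm hB hlaw (mA n)).
have [_ h] := level_density_itv y0 (dl0 n).
rewrite EFinN leeBlDr//.
have n0 : (0 <= (n.+1%:R)%:E :> \bar R)%E by rewrite lee_fin.
have := lee_wpmul2l n0 h.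
rewrite muleCA dlV mule1 => h2; apply: (le_trans h2).
rewrite muleDr// ?leeD2l//; last by rewrite fin_num_adde_defl.
by rewrite [(4 * dl n * _)%:E]EFinM muleCA dlV mule1.
Qed.

Let rD : (\int[P]_w (mean_local_time n w)%:E)%E @[n --> \oo] --> (fine (level_density y))%:E.
Proof.
have dlc : (4 * dl n) @[n --> \oo] --> (0 : R).
  by rewrite -(mulr0 (4 : R)); apply: cvgM; [exact: cvg_cst | exact: cvg_harmonic].
rewrite fineK ?level_density_fin//.
apply: (@squeeze_cvge _ _ _ _ (fun n => level_density y + (- (4 * dl n))%:E)%E _ (fun n => level_density y + (4 * dl n)%:E)%E).
- by near=> n; rewrite Er_le Er_ge.
- rewrite -[X in _ --> X]adde0; apply: cvgeD; [exact: fin_num_adde_defl | exact: cvg_cst |].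
  by apply: cvg_EFin; [near=> n | rewrite -oppr0; exact: cvgN].
- rewrite -[X in _ --> X]adde0; apply: cvgeD; [exact: fin_num_adde_defl | exact: cvg_cst |].
  by apply: cvg_EFin; [near=> n | exact: dlc].
Unshelve. all: by end_near. Qed.

(** In [meander_second_moment] the window width absorbs one factor n + 1 of the squared
    normalisation, so the second moments are at most K times the means, themselves at most D(y) + 4.
    Positivity of [gband 1 y] needs y > 0. *)
Let r_sqr : 0 < y -> exists M : R, forall n, (\int[P]_w (mean_local_time n w * mean_local_time n w)%:E <= M%:E)%E.
Proof.
move=> yp; have g0 := gband_gt0 yp.
set K := 4 * (2 / Num.sqrt (2 * pi)) / gband 1 y.
have K0 : 0 <= K by rewrite !(mulr_ge0, invr_ge0, sqrtr_ge0)// ltW.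
exists (K * (fine (level_density y) + 4)) => n.
have -> : (\int[P]_w (mean_local_time n w * mean_local_time n w)%:E =
   (n.+1%:R * n.+1%:R)%:E * \int[P]_w (Z n w * Z n w))%E.
  have mZZ : measurable_fun setT (fun w => Z n w * Z n w)%E by exact: emeasurable_funM.
  have ZZ0 w : [set: Om] w -> (0 <= Z n w * Z n w)%E by rewrite mule_ge0// occupation_time_ge0.
  rewrite -ge0_integralZl// ?lee_fin ?mulr_ge0//.
  by apply: eq_integral => w _; rewrite [LHS]EFinM !rE [in RHS]EFinM muleACA.
have h := meander_second_moment cm hB hlaw yp (dl0 n).
have h2 : (\int[P]_w (Z n w * Z n w) <= (K * dl n)%:E * \int[P]_w Z n w)%E.
  rewrite -lee_pdivlMl// in h; apply: (le_trans h).
  rewrite muleA -EFinM; set c := (X in (X%:E * _)%E); set c' := (X in (_ <= X%:E * _)%E).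
  suff -> : c = c' by [].
  by rewrite /c /c' /K; generalize (Num.sqrt (2 * @pi R)) => s; ring.
apply: (@le_trans _ _ ((n.+1%:R * n.+1%:R)%:E * ((K * dl n)%:E * \int[P]_w Z n w))%E).
  by apply: lee_wpmul2l => //; rewrite lee_fin mulr_ge0.
have -> : ((n.+1%:R * n.+1%:R)%:E * ((K * dl n)%:E * \int[P]_w Z n w) = K%:E * \int[P]_w (mean_local_time n w)%:E)%E.
  rewrite ErE !muleA -!EFinM; congr (_%:E * _)%E; rewrite /dl.
  have : n.+1%:R != 0 :> R by rewrite pnatr_eq0.
  by generalize (n.+1%:R : R) => s s0; field.
rewrite [leRHS]EFinM; apply: lee_wpmul2l; first by rewrite lee_fin.
apply: (le_trans (Er_le n)); rewrite EFinD fineK ?level_density_fin// leeD2l// lee_fin.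
by rewrite ger_pMr// invf_le1// ler1n.
Qed.

Lemma expectation_local_time : ('E_P[L y] = level_density y)%E.
Proof.
have -> : ('E_P[L y] = \int[P]_w `|L y w|%:E)%E.
  rewrite unlock; apply: ae_eq_integral => //.
  - by apply/measurable_EFinP; exact: measurable_funPT.
  - by apply/measurable_EFinP; apply: measurableT_comp => //; exact: measurable_funPT.
  - by apply: filterS L_ge0 => w h _; rewrite ger0_norm.
have mL : measurable_fun setT (L y : Om -> R) by exact: measurable_funPT.
have h1 := integral_norm_limit_le mr mL r0 rl rD.
rewrite fineK ?level_density_fin// in h1.
apply/le_anti; rewrite h1/=.
have [yp|] := ltP 0 y.
  have [M hM] := r_sqr yp.
  have := integral_norm_limit_ge mr mL r0 rl rD hM.
  by rewrite fineK ?level_density_fin.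
(* At y = 0 the second moment bound degenerates, [gband 1 0] being 0, but D(0) = 0 is trivially a
   lower bound. *)
move=> h; have y00 : y = 0 by apply/le_anti/andP.
by rewrite [in X in (X <= _)%E]y00 level_density0 integral_ge0.
Qed.

End LocalTimeMean.

(** * The product representation *)

Section RayleighTimesUniform.
Context {R : realType} {d : measure_display} {Om : measurableType d}.
Variables (P : probability Om R) (E W : {RV P >-> R}).
Hypotheses (hE : standard_exponential P E) (hW : uniformly_distributed P 2^-1 1 W).
Hypothesis hEW : independent_rv P E W.
Notation mu := (@lebesgue_measure R).

Let integral_exponential (f : R -> \bar R) : measurable_fun setT f -> (forall x, 0 <= f x)%E ->
  (\int[distribution P E]_x f x = \int[mu]_(x in `]0%R, +oo[) (f x * (expR (- x))%:E))%E.
Proof.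
move=> mf f0.
rewrite (@ge0_integral_image_density R _ _ (measurableTypeR R) R mu id (exponential_pdf 1)).
- rewrite [RHS]integral_itv_obnd_cbnd//; last first.
    by apply: measurable_funTS; apply: emeasurable_funM => //; apply/measurable_EFinP; mfun.
  rewrite [RHS]integral_mkcond; apply: eq_integral => x _.
  rewrite patchE mem_setE in_itv/= andbT /exponential_pdf patchE mem_setE in_itv/= andbT.
  by case: ifP => _; rewrite ?mule0// mul1r mulN1r.
- exact: measurable_id.
- exact: measurable_exponential_pdf.
- by move=> x; exact: exponential_pdf_ge0.
- by move=> A mA; exact: hE.
- exact: mf.
- exact: f0.
Qed.

(** The substitution x = z^2 / 2, that is z = sqrt (2 x), through which sqrt (2 E) appears as a
    Rayleigh variable. *)
Let half_sqr (f : R -> \bar R) : measurable_fun setT f -> (forall x, 0 <= f x)%E ->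
  (\int[mu]_(x in `]0%R, +oo[) f x = \int[mu]_(z in `]0%R, +oo[) (f (z ^+ 2 / 2)%R * z%:E))%E.
Proof.
move=> mf f0.
have {1}-> : `]0, +oo[%classic = (fun z : R => z ^+ 2 / 2) @` `]0, +oo[%classic.
  apply/seteqP; split => [x|_ [z + <-]]/=; rewrite !in_itv/= !andbT => x0.
    exists (Num.sqrt (2 * x)); first by rewrite in_itv/= andbT sqrtr_gt0 mulr_gt0.
    by rewrite sqr_sqrtr ?mulr_ge0 ?(ltW x0)// mulrC mulKf.
  by move: x0; rewrite in_itv/= andbT => z0; rewrite divr_gt0// exprn_gt0.
apply: ge0_integral_image_increasing => //.
- exact: interval_is_interval.
- move=> z _; apply: is_derive_eq; rewrite /GRing.scale/=.
  by rewrite ?expr1; field.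
- by move=> z _; exact: cvg_id.
- by move=> z /=; rewrite in_itv/= andbT.
Qed.

Variable A : set R.
Hypothesis mA : measurable A.

Let m1A : measurable_fun setT (\1_A : R -> R). Proof. exact: measurable_indic. Qed.

Let J (x w : R) : \bar R := (\1_A (Num.sqrt (2 * x) * w))%:E.

Let mJ : measurable_fun setT (fun z : R * R => J z.1 z.2).
Proof. by apply/measurable_EFinP; apply: (measurableT_comp m1A); mfun. Qed.

(** By independence E and W are integrated one after the other; 2 is the density of W on
    [1/2, 1]. *)
Let scaled_product_law :
  P ((fun w => Num.sqrt (2 * E w) * W w) @^-1` A) =
  (\int[distribution P E]_x \int[mu]_(w in `[2^-1%R, 1%R]) (J x w * 2%:E))%E.
Proof.
pose S : set (R * R) := [set z | A (Num.sqrt (2 * z.1) * z.2)].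
have mS : measurable S.
  have mq : measurable_fun setT (fun z : R * R => Num.sqrt (2 * z.1) * z.2) by mfun.
  by rewrite -[X in measurable X]setTI; exact: (mq measurableT _ mA).
have mEW : measurable_fun setT (fun w => (E w, W w)).
  by apply/measurable_fun_pair; exact: measurable_funPT.
pose m' : {measure set (R * R) -> \bar R} := pushforward P (fun w => (E w, W w)).
have rect (C D : set R) : measurable C -> measurable D ->
    m' mEW (C `*` D) = (distribution P E C * distribution P W D)%E.
  by move=> mC mD; exact: hEW.
have HS := @product_measure_unique _ _ R R R (distribution P E) (distribution P W) (m' mEW) rect S mS.
transitivity (m' mEW S) => //.
rewrite -HS; apply: eq_integral => x _ /=.
have mSx : measurable (xsection S x) by exact: measurable_xsection.
rewrite (measure_integral_indic (distribution P W) mSx).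
rewrite (integral_uniformly_distributed hW); last 2 first.
- by apply/measurable_EFinP; exact: measurable_indic.
- by move=> w; rewrite lee_fin.
apply: eq_integral => w _; congr (_ * _%:E)%E; last by field.
by rewrite /J !indicE; congr ((nat_of_bool _)%:R%:E); rewrite xsectionE; apply/idP/idP => /set_mem H; apply/mem_set.
Qed.

(** With y = z w the condition 1/2 <= w <= 1 becomes y <= z <= 2 y, which is how the interval
    [y, 2 y] enters the law of the product. *)
Let inner (z : R) : 0 < z ->
  (\int[mu]_(w in `[2^-1%R, 1%R]) (J (z ^+ 2 / 2)%R w * 2%:E) =
   \int[mu]_(y in `]0%R, +oo[) (((\1_A y)%:E * 2%:E) * ((\1_`[y, 2 * y]%classic z * z^-1)%R)%:E))%E.
Proof.
move=> z0.
have sz w : Num.sqrt (2 * (z ^+ 2 / 2)) * w = z * w.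
  by rewrite (_ : 2 * (z ^+ 2 / 2) = z ^+ 2) ?sqrtr_sqr ?gtr0_norm//; field.
have ratio (y : R) : (2^-1 <= z^-1 * y <= 1) = (y <= z <= 2 * y).
  rewrite (mulrC z^-1) ler_pdivlMr// ler_pdivrMr// mul1r andbC; congr (_ && _).
  by rewrite (mulrC 2^-1 z) ler_pdivrMr// (mulrC y).
transitivity (\int[mu]_(w in `]0%R, +oo[) ((\1_`[2^-1, 1]%classic w)%:E * ((\1_A (z * w)%R)%:E * 2%:E)))%E.
  rewrite [LHS]integral_mkcond [RHS]integral_mkcond; apply: eq_integral => w _.
  rewrite !patchE !mem_setE !in_itv/= andbT /J sz [in RHS]indicE mem_setE in_itv/=.
  case: ifP => [/andP[h1 h2]|_]; last by case: ifP => // _; rewrite mul0e.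
  by rewrite (lt_le_trans _ h1)// mul1e.
rewrite (@ge0_integral_scale R z^-1); last 3 first.
- by rewrite invr_gt0.
- apply: emeasurable_funM; first by apply/measurable_EFinP; exact: measurable_indic.
  by apply: emeasurable_funM => //; apply/measurable_EFinP; apply: (measurableT_comp m1A); mfun.
- by move=> y; rewrite !mule_ge0// lee_fin.
apply: eq_integral => y; rewrite inE/= in_itv/= andbT => y0.
rewrite mulrA divff ?gt_eqF// mul1r [in RHS]EFinM [RHS]muleA [X in (X * _)%E]muleC; congr (_ * _%:E * _)%E.
rewrite !indicE !mem_setE !in_itv/=; congr ((nat_of_bool _)%:R).
exact: ratio.
Qed.

Lemma sqrt_exponential_uniform_law :
  (P ((fun w => (Num.sqrt (2 * E w) * W w)%R) @^-1` A) =
   \int[mu]_(y in `]0%R, +oo[) ((\1_A y)%:E * level_density y))%E.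
Proof.
rewrite scaled_product_law.
have mJ2 : measurable_fun setT (fun x => \int[mu]_(w in `[2^-1%R, 1%R]) (J x w * 2%:E))%E.
  apply: (measurable_integral_param (f := fun x w => (J x w * 2%:E)%E)) => //.
  - exact: emeasurable_funM.
  - by move=> x w; rewrite mule_ge0// lee_fin.
have J20 x : (0 <= \int[mu]_(w in `[2^-1%R, 1%R]) (J x w * 2%:E))%E.
  by apply: integral_ge0 => w _; rewrite mule_ge0// lee_fin.
rewrite integral_exponential// half_sqr; last 2 first.
- by apply: emeasurable_funM => //; apply/measurable_EFinP; mfun.
- by move=> x; rewrite mule_ge0// lee_fin expR_ge0.
pose K (z y : R) : \bar R := (((\1_A y)%:E * 2%:E) * ((\1_`[y, 2 * y]%classic z * expR (- z ^+ 2 / 2))%R)%:E)%E.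
pose S : set (R * R) := [set p | p.2 - p.1 <= 0] `&` [set p | p.1 - 2 * p.2 <= 0].
have mS : measurable S by apply: measurableI; apply: measurable_set_le; mfun.
have SE y z : (\1_`[y, 2 * y]%classic z : R) = \1_S (z, y).
  rewrite !indicE; congr ((nat_of_bool _)%:R); apply/idP/idP => /set_mem H; apply/mem_set; move: H.
    by rewrite /S/= in_itv/= !subr_le0 => /andP.
  by rewrite /S/= in_itv/= !subr_le0 => -[-> ->].
have mSt : measurable_fun setT (fun p : R * R => (\1_`[p.2, 2 * p.2]%classic p.1 : R)).
  by rewrite (_ : (fun p => _) = \1_S); [exact: measurable_indic | apply/funext => -[z y]; exact: SE].
have mK : measurable_fun setT (fun p : R * R => K p.1 p.2).
  apply: emeasurable_funM.
    apply: emeasurable_funM => //; apply/measurable_EFinP.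
    exact: (measurableT_comp m1A measurable_snd).
  by apply/measurable_EFinP; apply: measurable_funM => //; mfun.
transitivity (\int[mu]_(z in `]0%R, +oo[) \int[mu]_(y in `]0%R, +oo[) K z y)%E.
  apply: eq_integral => z; rewrite inE/= in_itv/= andbT => z0.
  rewrite (inner z0) -muleA -EFinM -ge0_integralZr//; last 3 first.
  - apply: measurable_funTS; apply: emeasurable_funM.
      by apply: emeasurable_funM => //; exact/measurable_EFinP.
    apply/measurable_EFinP; apply: measurable_funM => //.
    exact: (measurableT_comp mSt (measurable_pair1 z)).
  - by move=> y _; rewrite !mule_ge0// lee_fin mulr_ge0// invr_ge0 ltW.
  - by rewrite lee_fin mulr_ge0 ?expR_ge0// ltW.
  (* The 1 / z of the conditional density cancels the z of the Rayleigh density. *)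
  apply: eq_integral => y _; rewrite -muleA /K; congr (_ * _)%E.
  rewrite -EFinM; congr (_%:E); rewrite -mulrA; congr (_ * _).
  by rewrite mulrCA mulVf ?gt_eqF// mulr1 mulNr.
rewrite (integral_swap (f := K))//; last first.
  by move=> z y _ _; rewrite !mule_ge0// lee_fin mulr_ge0 ?expR_ge0.
apply: eq_integral => y; rewrite inE/= in_itv/= andbT => y0.
have mky : measurable_fun (`]0, +oo[%classic : set R) (fun z : R => (\1_`[y, 2 * y]%classic z * expR (- z ^+ 2 / 2))%:E).
  apply/measurable_EFinP; apply: measurable_funTS; apply: measurable_funM.
    exact: (measurableT_comp mSt (measurable_pair2 y)).
  by mfun.
have ky0 (z : R) : (`]0, +oo[%classic : set R) z -> (0 <= (\1_`[y, 2 * y]%classic z * expR (- z ^+ 2 / 2))%:E)%E.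
  by move=> _; rewrite lee_fin mulr_ge0 ?expR_ge0.
have y20 : (0 <= (\1_A y : R)%:E * 2%:E)%E by rewrite mule_ge0// lee_fin.
rewrite /K ge0_integralZl//.
rewrite /level_density -muleA; congr (_ * (_ * _))%E.
rewrite [LHS]integral_mkcond [RHS]integral_mkcond; apply: eq_integral => z _.
rewrite !patchE !mem_setE !in_itv/= andbT indicE mem_setE in_itv/=.
case: (ltP 0 z) => z0; first by case: ifP => _; rewrite ?mul1r ?mul0r.
by case: ifP => // /andP[h _]; move: (lt_le_trans y0 h); rewrite ltNge z0.
Qed.

End RayleighTimesUniform.

(** * Conclusion *)

Lemma measurable_rayleigh_pdf {R : realType} : measurable_fun setT (@rayleigh_pdf R).
Proof.
rewrite /rayleigh_pdf; apply/(measurable_restrictT _ (measurable_itv _)).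
by apply: measurable_funTS; mfun.
Qed.

Lemma rayleigh_pdf_ge0 {R : realType} (x : R) : 0 <= rayleigh_pdf x.
Proof.
rewrite /rayleigh_pdf patchE mem_setE in_itv/= andbT; case: ifP => // x0.
by rewrite mulr_ge0 ?expR_ge0.
Qed.

Theorem corollary4p1 (R : realType) (d : measure_display)
  (T : measurableType d) (P : probability T R)
  (m : R -> {RV P >-> R}) (L : R -> {RV P >-> R}) (U : {RV P >-> R})
  (hm : brownian_meander P m)
  (hL : local_times P m L)
  (hU01 : forall w, 0 <= U w <= 1)
  (hU : uniformly_distributed P 0 1 U)
  (hUm : independent_of_process P `[0, 1] U m) :
  has_density P (m 1) (fun l => (rayleigh_pdf l)%:E) /\
  has_density P (fun w => m (U w) w) ((fun y => 'E_P[L y]%E) \_ `[0, +oo[) /\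
  (forall y : R, 0 <= y ->
     ('E_P[L y] =
      2%:E * \int[lebesgue_measure]_(z in `[y, (2 * y)%R])
                (expR (- z ^+ 2 / 2))%:E)%E) /\
  (forall (d' : measure_display) (T' : measurableType d')
          (P' : probability T' R) (E W : {RV P' >-> R}),
     standard_exponential P' E ->
     uniformly_distributed P' 2^-1 1 W ->
     independent_rv P' E W ->
     forall A : set R, measurable A ->
       P ((fun w => m (U w) w) @^-1` A) =
       P' ((fun w => Num.sqrt (2 * E w) * W w) @^-1` A)).
Proof.
have [cm [d' [Om' [P' [B [hB hlaw]]]]]] := hm.
have EL y : 0 <= y -> ('E_P[L y] = level_density y)%E.
  by move=> y0; exact: (expectation_local_time cm hB hlaw hL y0).
have time_law (A : set R) : measurable A -> (P ((fun w => m (U w) w) @^-1` A) =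
    \int[lebesgue_measure]_(y in `]0%R, +oo[) ((\1_A y)%:E * level_density y))%E.
  move=> mA; rewrite (random_time_law cm hU01 hU hUm mA) -(meander_time_law hB mA).
  by apply: eq_integral => u; rewrite inE/= in_itv/= => u01; exact: (meander_marginal hlaw).
have DE : (fun y => 'E_P[L y]%E) \_ `[0, +oo[ = (@level_density R) \_ `[0, +oo[.
  by apply/funext => y; rewrite !patchE mem_setE in_itv/= andbT; case: ifP => // /EL.
split; [|split; [|split]].
- split.
  + exact: measurable_funPT.
  + by apply/measurable_EFinP; exact: measurable_rayleigh_pdf.
  + by move=> x; rewrite lee_fin rayleigh_pdf_ge0.
  + move=> A mA; rewrite -(meander_endpoint_law hB mA).
    have i1 : 0 <= (1 : R) <= 1 by rewrite ler01 lexx.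
    transitivity (P' [set w | A (meander_path (B ^~ w) 1)]); first exact: (meander_marginal hlaw mA i1).
    (* At u = 1 the time g + u (1 - g) is 1. *)
    congr (P' _); apply/seteqP; split => w;
      by rewrite /meander_path/= mul1r (addrC (last_zero _)) subrK.
- rewrite DE; split.
  + exact: (random_time_measurable cm hU01).
  + apply/(measurable_restrictT _ (measurable_itv _)).
    by apply: measurable_funTS; exact: measurable_level_density.
  + by move=> y; rewrite patchE; case: ifP => // _; exact: level_density_ge0.
  + move=> A mA; rewrite time_law// [LHS]integral_mkcond [RHS]integral_mkcond; apply: eq_integral => y _.
    rewrite !patchE !mem_setE !in_itv/= !andbT indicE.
    case: (ltP 0 y) => y0; first by rewrite (ltW y0); case: ifP => _; rewrite ?mul1e ?mul0e.
    (* Level 0 belongs to the domain of the stated density but not to that of [time_law]; the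
       density vanishes there. *)
    case: ifP => // _; case: ifP => // y0'; have -> : y = 0 by apply/le_anti/andP.
    by rewrite level_density0.
- exact: EL.
- move=> d2 T2 P2 E W hE hW hEW A mA.
  by rewrite time_law// -(sqrt_exponential_uniform_law hE hW hEW mA).
Qed.
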